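(* The set of invertible elements $\bigcup_{q\in L_{\mathcal R}}\mathcal S(\mathcal R,q)^\times=\{(x,q):x\text{ is invertible in }\mathcal S(\mathcal R,q)\}$ is open in $\mathcal S(\mathcal R)\times L_{\mathcal R}$, and inverting, $(x,q)\mapsto((x,q)^{-1},q)$, is a continuous map from this set to itself.
   Context: $\mathcal R=(X,Y,R_0,R_0^\vee,F_0)$ is a reduced based root datum: $X,Y$ free abelian groups of the same finite rank with a perfect pairing $\langle\cdot,\cdot\rangle$; $R_0\subset X$, $R_0^\vee\subset Y$ finite with a bijection $\alpha\mapsto\alpha^\vee$ such that $\langle\alpha,\alpha^\vee\rangle=2$, $s_\alpha(x)=x-\langle x,\alpha^\vee\rangle\alpha$ preserves $R_0$, the dual reflections preserve $R_0^\vee$, and $\mathbb Z\alpha\cap R_0=\{\pm\alpha\}$; $F_0$ a basis of simple roots; $R_0^\pm$ the positive/negative roots. $W_0=\langle s_\alpha\rangle$, $Q=\mathbb ZR_0$, $W=X\rtimes W_0$ acting on $X$ by affine maps, $t_x$ translation by $x$. Length: $\ell(wt_x)=\sum_{\alpha\in R_0^+\cap w^{-1}(R_0^-)}|\langle x,\alpha^\vee\rangle+1|+\sum_{\alpha\in R_0^+\cap w^{-1}(R_0^+)}|\langle x,\alpha^\vee\rangle|$ for $w\in W_0$, $x\in X$. $S_{\rm aff}=\{s_\alpha:\alpha\in F_0\}\cup\{t_\alpha s_\alpha:\alpha^\vee$ the highest coroot of an irreducible component of $R_0^\vee\}$. $L_{\mathcal R}$ is the set of positive label functions $q:W\to(0,\infty)$,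 i.e. $q(\omega)=1$ if $\ell(\omega)=0$ and $q(wv)=q(w)q(v)$ if $\ell(wv)=\ell(w)+\ell(v)$, with the topology of the metric $\rho(q,q')=\max_{s\in S_{\rm aff}}|(q(s)^{1/2}-q(s)^{-1/2})-(q'(s)^{1/2}-q'(s)^{-1/2})|$. $\mathcal H(\mathcal R,q)$ has basis $T_w$ $(w\in W)$, $T_wT_v=T_{wv}$ if lengths add, $T_s^2=(q(s)-1)T_s+q(s)T_e$ for $s\in S_{\rm aff}$; $N_w=q(w)^{-1/2}T_w$. Let $f:X\otimes\mathbb R\to[0,\infty)$ be $Q\otimes\mathbb R$-invariant, $f(X)\subset\mathbb Z$, inducing a norm on $(X\otimes\mathbb R)/(Q\otimes\mathbb R)$; $\mathcal N(w)=\ell(w)+f(w(0))$. $\mathcal S(\mathcal R,q)$ is the completion of $\mathcal H(\mathcal R,q)$ for the norms $p_n(\sum x_wN_w)=\sup_w|x_w|(\mathcal N(w)+1)^n$; it is a unital Fréchet algebra. Via the bases $N_w$ all these Fréchet spaces are identified with one space $\mathcal S(\mathcal R)$; $(x,q)$ means $x\in\mathcal S(\mathcal R)$ considered as an element of the algebra $\mathcal S(\mathcal R,q)$. *)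

(* Defs.v *)
From HB Require Import structures.
From mathcomp Require Import all_boot all_order all_algebra finmap.
From mathcomp Require Import complex.
From mathcomp Require Import all_classical all_reals all_analysis.

Set Implicit Arguments.
Unset Strict Implicit.
Unset Printing Implicit Defensive.
Import Order.TTheory GRing.Theory Num.Theory ComplexField.Normc.
Local Open Scope classical_set_scope.
Local Open Scope complex_scope.
Local Open Scope ring_scope.

Definition int_basis (X : zmodType) (n : nat) (e : 'I_n -> X) : Prop :=
  forall x, exists! c : {ffun 'I_n -> int}, x = \sum_i e i *~ c i.

(* The bijection between roots and coroots is [coroot] restricted to [roots];
   its values elsewhere are irrelevant. *)
Record based_root_datum := BasedRootDatum {
  lat : zmodType;
  colat : zmodType;
  pairing : lat -> colat -> int;
  roots : {fset lat};
  coroot : lat -> colat;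
  simple : {fset lat};
  lat_free : exists n, (exists e : 'I_n -> lat, int_basis e) /\
                       (exists e : 'I_n -> colat, int_basis e);
  pairingDl : forall x x' y, pairing (x + x') y = pairing x y + pairing x' y;
  pairingDr : forall x y y', pairing x (y + y') = pairing x y + pairing x y';
  perfectl : forall g : {additive lat -> int},
    exists! y, forall x, pairing x y = g x;
  perfectr : forall g : {additive colat -> int},
    exists! x, forall y, pairing x y = g y;
  coroot_inj : {in roots &, injective coroot};
  pairing_coroot : forall a, a \in roots -> pairing a (coroot a) = 2;
  refl_roots : forall a b, a \in roots -> b \in roots ->
    b - a *~ pairing b (coroot a) \in roots;
  corefl_coroots : forall a b, a \in roots -> b \in roots ->
    exists2 c, c \in roots &
      coroot b - coroot a *~ pairing a (coroot b) = coroot c;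
  roots_reduced : forall a (k : int), a \in roots -> a *~ k \in roots ->
    a *~ k = a \/ a *~ k = - a;
  simple_sub : {subset simple <= roots};
  simple_free : forall c : lat -> int, \sum_(b <- simple) b *~ c b = 0 ->
    forall b, b \in simple -> c b = 0;
  simple_span : forall a, a \in roots -> exists c : lat -> nat,
    a = \sum_(b <- simple) b *+ c b \/ a = - \sum_(b <- simple) b *+ c b }.

Section AffineWeylGroup.
Context (D : based_root_datum).
Local Notation X := (lat D).
Local Notation Y := (colat D).

Definition pos_root : pred X := fun a => (a \in roots D) &&
  `[< exists c : X -> nat, a = \sum_(b <- simple D) b *+ c b >].
Definition neg_root : pred X := fun a => (a \in roots D) &&
  `[< exists c : X -> nat, a = - \sum_(b <- simple D) b *+ c b >].

Definition refl (a x : X) : X := x - a *~ pairing x (coroot a).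

Inductive refl_generated : (X -> X) -> Prop :=
| refl_generated_id : refl_generated id
| refl_generated_comp a w : a \in roots D -> refl_generated w ->
    refl_generated (refl a \o w).

(* Elements of W_0 carry their inverse, which is determined by the map. *)
Record finite_weyl := FiniteWeyl {
  fw_fun :> X -> X;
  fw_inv : X -> X;
  fw_gen : refl_generated fw_fun;
  fw_funK : cancel fw_fun fw_inv;
  fw_invK : cancel fw_inv fw_fun }.

Lemma refl_generated_mul u v :
  refl_generated u -> refl_generated v -> refl_generated (u \o v).
Proof.
elim=> [//|a w aR _ IH] vg; have := refl_generated_comp aR (IH vg).
by rewrite compA.
Qed.

Definition fw_one : finite_weyl :=
  @FiniteWeyl id id refl_generated_id (fun=> erefl) (fun=> erefl).

Definition fw_mul (u v : finite_weyl) : finite_weyl :=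
  FiniteWeyl (refl_generated_mul (fw_gen u) (fw_gen v))
    (can_comp (fw_funK u) (fw_funK v)) (can_comp (fw_invK v) (fw_invK u)).

Lemma finite_weyl_eq (u v : finite_weyl) : fw_fun u = fw_fun v -> u = v.
Proof.
case: u v => [u u' ug uK u'K] [v v' vg vK v'K] /= uv; subst v.
have uv' : u' = v' by apply/funext => x; rewrite -{1}(v'K x) uK.
by subst v'; congr FiniteWeyl; exact: Prop_irrelevance.
Qed.

(* The pair (t, w) stands for t_t w, that is for the affine map v |-> w v + t. *)
Record weyl := Weyl { w_tr : X; w_lin : finite_weyl }.

HB.instance Definition _ := gen_eqMixin weyl.
HB.instance Definition _ := gen_choiceMixin weyl.

Definition w_act (w : weyl) (v : X) : X := w_lin w v + w_tr w.
Definition w_one : weyl := Weyl 0 fw_one.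
Definition w_mul (u v : weyl) : weyl :=
  Weyl (w_tr u + w_lin u (w_tr v)) (fw_mul (w_lin u) (w_lin v)).

(* t_t w = w t_x with x = w^-1 t. *)
Definition len (w : weyl) : nat :=
  let x := fw_inv (w_lin w) (w_tr w) in
  (\sum_(a <- roots D | pos_root a && neg_root (w_lin w a))
     `|(pairing x (coroot a) + 1)%R|%N
   + \sum_(a <- roots D | pos_root a && pos_root (w_lin w a))
     `|pairing x (coroot a)|%N)%N.

Definition orthogonal_split (C E : set X) : Prop :=
  forall a b, C a -> E b ->
    pairing a (coroot b) = 0 /\ pairing b (coroot a) = 0.

(* C^vee is an irreducible component of R_0^vee. *)
Definition irreducible_component (C : set X) : Prop :=
  [/\ C `<=` [set` roots D], C !=set0,
      orthogonal_split C ([set` roots D] `\` C) &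
      forall E, E `<=` C -> E !=set0 -> orthogonal_split E (C `\` E) -> E = C].

Definition highest_coroot (a : X) : Prop :=
  exists C, [/\ irreducible_component C, C a &
    forall b, C b -> exists c : X -> nat,
      coroot a - coroot b = \sum_(g <- simple D) coroot g *+ c g].

Definition Saff : set weyl := [set s |
  (exists2 a, a \in simple D & w_tr s = 0 /\ (w_lin s : X -> X) = refl a) \/
  (exists2 a, highest_coroot a & w_tr s = a /\ (w_lin s : X -> X) = refl a)].

Lemma finite_Saff : finite_set Saff.
Proof.
pose P (z : X * X) : set weyl :=
  [set s | w_tr s = z.1 /\ (w_lin s : X -> X) = refl z.2].
pose I : set (X * X) := [set (0, a) | a in [set` roots D]] `|`
  [set (a, a) | a in [set` roots D]].
have finI : finite_set I.
  by rewrite finite_setU; split; apply: finite_image; exact: finite_fset.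
apply: (@sub_finite_set _ _ (\bigcup_(z in I) P z)).
  move=> s [] [a aR [st sl]].
    exists (0, a) => //; left; exists a => //; exact: simple_sub.
  exists (a, a) => //; right; exists a => //.
  by case: aR => C [[CR _ _ _] Ca _]; exact: CR.
apply: bigcup_finite => // z _.
have [[s [st sl]]|nP] := pselect (P z !=set0); last first.
  rewrite (_ : P z = set0)//; apply/seteqP; split => // s sP.
  by case: nP; exists s.
apply: (@sub_finite_set _ _ [set s]) => // -[t w] [/= tt wl].
case: s st sl => [t' w'] /= st sl; congr Weyl; first by rewrite tt st.
by apply: finite_weyl_eq; rewrite wl sl.
Qed.
End AffineWeylGroup.

Lemma finite_has_ubound (R : realType) (A : set R) : finite_set A -> has_ubound A.
Proof.
move=> /finite_seqP[s ->]; exists (\sum_(x <- s) `|x|) => x /= xs.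
apply: le_trans (ler_norm x) _; rewrite (big_rem x xs) /= lerDl.
by apply: sumr_ge0.
Qed.

Lemma normc_ge0 (R : realType) (z : R[i]) : 0 <= normc z.
Proof. by case: z => a b; exact: sqrtr_ge0. Qed.

Section LabelFunctions.
Context (R : realType) (D : based_root_datum).
Local Notation W := (weyl D).

Record label := Label {
  lab :> W -> R;
  lab_gt0 : forall w, 0 < lab w;
  lab_len0 : forall w, len w = 0%N -> lab w = 1;
  lab_mul : forall w v, len (w_mul w v) = (len w + len v)%N ->
    lab (w_mul w v) = lab w * lab v }.

HB.instance Definition _ := gen_eqMixin label.
HB.instance Definition _ := gen_choiceMixin label.

Definition label_param (q : label) (s : W) : R :=
  Num.sqrt (q s) - (Num.sqrt (q s))^-1.

(* Saff is finite, so that the supremum is a maximum; it is 0 if there are no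
   roots, in which case the only label function is the constant 1. *)
Definition label_dist (q q' : label) : R :=
  sup [set `|label_param q s - label_param q' s| | s in @Saff D].

Lemma label_dist_ge (q q' : label) s : Saff s ->
  `|label_param q s - label_param q' s| <= label_dist q q'.
Proof.
move=> sS; apply: ub_le_sup; last by exists s.
by apply: finite_has_ubound; apply: finite_image; exact: finite_Saff.
Qed.

Lemma label_dist_le (q q' : label) e : 0 <= e ->
  (forall s, Saff s -> `|label_param q s - label_param q' s| <= e) ->
  label_dist q q' <= e.
Proof.
move=> e0 H; rewrite /label_dist; set A := (X in sup X).
have [A0|A0] := pselect (A !=set0); last first.
  by rewrite (_ : A = set0) ?sup0//; apply/seteqP; split => // x Ax; case: A0; exists x.
by apply: ge_sup => // _ [s sS <-]; exact: H.
Qed.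

Lemma label_dist_ge0 (q q' : label) : 0 <= label_dist q q'.
Proof.
rewrite /label_dist; set A := (X in sup X).
have [[x Ax]|A0] := pselect (A !=set0).
  by case: (Ax) => s sS _; exact: le_trans (label_dist_ge q q' sS).
rewrite (_ : A = set0) ?sup0//; apply/seteqP; split => // x Ax.
by case: A0; exists x.
Qed.

Lemma label_distxx q : label_dist q q = 0.
Proof.
apply/eqP; rewrite eq_le label_dist_ge0 andbT.
by apply: label_dist_le => // s _; rewrite subrr normr0.
Qed.

Lemma label_distC q q' : label_dist q q' = label_dist q' q.
Proof.
by congr sup; apply/seteqP; split => _ [s sS <-]; exists s; rewrite // distrC.
Qed.

Lemma label_distD q' q q'' :
  label_dist q q'' <= label_dist q q' + label_dist q' q''.
Proof.
apply: label_dist_le => [|s sS]; first by rewrite addr_ge0 ?label_dist_ge0.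
apply: le_trans (ler_distD (label_param q' s) _ _) _.
by apply: lerD; exact: label_dist_ge.
Qed.

Definition label_ball (q : label) (e : R) : set label :=
  [set q' | label_dist q q' < e].

Let label_ent : set_system (label * label) := entourage_ label_ball.

HB.instance Definition _ := hasNbhs.Build label (nbhs_ label_ent).

Let label_ball_center q (e : R) : 0 < e -> label_ball q e q.
Proof. by move=> e0; rewrite /label_ball/= label_distxx. Qed.

Let label_ball_sym q q' (e : R) : label_ball q e q' -> label_ball q' e q.
Proof. by rewrite /label_ball/= label_distC. Qed.

Let label_ball_triangle q q' q'' (e e' : R) :
  label_ball q e q' -> label_ball q' e' q'' -> label_ball q (e + e') q''.
Proof.
rewrite /label_ball/= => ? ?.
by rewrite (le_lt_trans (label_distD q' _ _))// ltrD.
Qed.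

HB.instance Definition _ := @Nbhs_isPseudoMetric.Build R label
  label_ent erefl label_ball label_ball_center label_ball_sym
  label_ball_triangle erefl.
End LabelFunctions.

(* V is X (x) R: X is free of finite rank, so an additive map from X to a real
   vector space is an extension of scalars if and only if it sends one, or
   equivalently every, basis of X to a basis. *)
Definition is_scalar_extension (R : realType) (X : zmodType) (V : lmodType R)
    (i : {additive X -> V}) : Prop :=
  forall n (e : 'I_n -> X), int_basis e ->
    forall v, exists! c : {ffun 'I_n -> R}, v = \sum_k c k *: i (e k).

Definition in_real_root_span (R : realType) (D : based_root_datum)
    (V : lmodType R) (i : lat D -> V) (v : V) : Prop :=
  exists c : lat D -> R, v = \sum_(a <- roots D) c a *: i a.

(* The function f on X (x) R. A Q (x) R-invariant f induces a norm on the
   quotient by Q (x) R if and only if it satisfies the last three conditions. *)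
Record length_extension (R : realType) (D : based_root_datum) :=
  LengthExtension {
  real_lat : lmodType R;
  real_incl : {additive lat D -> real_lat};
  real_inclP : is_scalar_extension real_incl;
  ext_fun :> real_lat -> R;
  ext_ge0 : forall v, 0 <= ext_fun v;
  ext_inv : forall u v, in_real_root_span real_incl u ->
    ext_fun (v + u) = ext_fun v;
  ext_int : forall x, ext_fun (real_incl x) \is a Num.int;
  ext_triangle : forall u v, ext_fun (u + v) <= ext_fun u + ext_fun v;
  ext_homogeneous : forall (c : R) v, ext_fun (c *: v) = `|c| * ext_fun v;
  ext_separated : forall v, ext_fun v = 0 -> in_real_root_span real_incl v }.

Section SchwartzAlgebra.
Context (R : realType) (D : based_root_datum) (f : length_extension R D).
Local Notation W := (weyl D).
Local Notation C := R[i].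

Definition ext_len (w : W) : R := (len w)%:R + f (real_incl f (w_act w 0)).

Definition weight (n : nat) (w : W) : R := (ext_len w + 1) ^+ n.

Lemma ext_len_ge0 w : 0 <= ext_len w.
Proof. by rewrite addr_ge0 ?ext_ge0 ?ler0n. Qed.

Lemma weight_ge0 n w : 0 <= weight n w.
Proof. by rewrite exprn_ge0 // addr_ge0 ?ext_len_ge0. Qed.

Lemma weight_le m n w : (m <= n)%N -> weight m w <= weight n w.
Proof. by move=> mn; rewrite ler_weXn2l // lerDr ext_len_ge0. Qed.

(* A function x : W -> C stands for the formal sum of the x_w N_w. *)
Definition finitely_supported (x : W -> C) : Prop :=
  finite_set [set w | x w != 0].

(* The norms are p_n(x) = sup_w |x_w| * weight n w. The completion for them of
   the space of finitely supported functions is realized as the closure of this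
   space in the complete space of the functions all of whose p_n are finite. *)
Definition in_schwartz : {pred (W -> C^o)} := fun x =>
  `[< forall n (e : R), 0 < e -> exists2 h : W -> C, finitely_supported h &
        forall w, normc (x w - h w) * weight n w <= e >].

Lemma in_schwartz_fin (x : W -> C^o) : finitely_supported x -> x \in in_schwartz.
Proof.
move=> fx; apply/asboolP => n e e0; exists x => // w.
by rewrite subrr normc0 mul0r ltW.
Qed.

Lemma in_schwartz_submod : submod_closed in_schwartz.
Proof.
split=> [|a x y /asboolP xS /asboolP yS].
  apply: in_schwartz_fin; rewrite /finitely_supported (_ : mkset _ = set0)//.
  by apply/seteqP; split => // w /=; rewrite eqxx.
apply/asboolP => n e e0.
have a0 : 0 < normc a + 1 by rewrite ltr_wpDl // normc_ge0.
have [h hf hx] := xS n (e / 2 / (normc a + 1)) ltac:(by rewrite !divr_gt0).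
have [k kf ky] := yS n (e / 2) ltac:(by rewrite divr_gt0).
exists (fun w => a * h w + k w).
  apply: (@sub_finite_set _ _ ([set w | h w != 0] `|` [set w | k w != 0])).
    move=> w /= hk; apply/orP; apply: contraNT hk.
    by rewrite negb_or !negbK => /andP[/eqP -> /eqP ->]; rewrite mulr0 addr0.
  by rewrite finite_setU.
move=> w; have -> : (a *: x + y) w - (a * h w + k w) =
    a * (x w - h w) + (y w - k w) by rewrite mulrBr opprD addrACA.
apply: (@le_trans _ _ (normc a * (normc (x w - h w) * weight n w)
    + normc (y w - k w) * weight n w)).
  rewrite mulrA -mulrDl -normcM ler_wpM2r ?weight_ge0 //; exact: le_normcD.
rewrite [e]splitr lerD //.
apply: (@le_trans _ _ (normc a * (e / 2 / (normc a + 1)))).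
  by rewrite ler_wpM2l ?normc_ge0.
rewrite mulrCA -[leRHS]mulr1; apply: ler_wpM2l; first by rewrite divr_ge0 ?ltW.
by rewrite ler_pdivrMr // mul1r lerDl.
Qed.

HB.instance Definition _ :=
  GRing.isSubmodClosed.Build C (W -> C^o) in_schwartz in_schwartz_submod.

Record schwartz := Schwartz {
  schwartz_fun :> W -> C^o;
  schwartzP : schwartz_fun \in in_schwartz }.

HB.instance Definition _ := [isSub of schwartz for schwartz_fun].
HB.instance Definition _ := [Choice of schwartz by <:].
HB.instance Definition _ := [SubChoice_isSubLmodule of schwartz by <:].
HB.instance Definition _ := isPointed.Build schwartz 0.

Definition seminorm (n : nat) (x : schwartz) : R :=
  sup [set normc (x w) * weight n w | w in setT].

Lemma seminorm_has_ubound n (x : schwartz) :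
  has_ubound [set normc (x w) * weight n w | w in setT].
Proof.
case: x => x /= /asboolP /(_ n 1 ltr01) [h hf xh].
have [b hb] : has_ubound ([set normc (h w) * weight n w | w in [set w | h w != 0]]).
  by apply: finite_has_ubound; exact: finite_image.
exists (1 + Num.max b 0) => _ [w _ <-].
apply: (@le_trans _ _ (normc (x w - h w) * weight n w + normc (h w) * weight n w)).
  rewrite -mulrDl ler_wpM2r ?weight_ge0 // -[X in normc X](subrK (h w)).
  exact: le_normcD.
rewrite lerD // le_max; have [->|hw] := eqVneq (h w) 0.
  by rewrite normc0 mul0r lexx orbT.
by rewrite hb //; exists w.
Qed.

Lemma seminorm_ge n (x : schwartz) w : normc (x w) * weight n w <= seminorm n x.
Proof. by apply: ub_le_sup; [exact: seminorm_has_ubound|exists w]. Qed.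

Lemma seminorm_le n (x : schwartz) e :
  (forall w, normc (x w) * weight n w <= e) -> seminorm n x <= e.
Proof.
move=> H; apply: ge_sup => [|_ [w _ <-]//].
by exists (normc (x (w_one D)) * weight n (w_one D)), (w_one D).
Qed.

Lemma seminorm0 n : seminorm n 0 = 0.
Proof.
apply/eqP; rewrite eq_le; apply/andP; split.
  by apply: seminorm_le => w; rewrite normc0 mul0r.
by apply: le_trans (seminorm_ge n 0 (w_one D)); rewrite mulr_ge0 ?normc_ge0 ?weight_ge0.
Qed.

Lemma seminormD n (x y : schwartz) :
  seminorm n (x + y) <= seminorm n x + seminorm n y.
Proof.
apply: seminorm_le => w.
apply: le_trans (lerD (seminorm_ge n x w) (seminorm_ge n y w)).
by rewrite -mulrDl ler_wpM2r ?weight_ge0 //; exact: le_normcD.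
Qed.

Lemma seminorm_mono m n (x : schwartz) : (m <= n)%N -> seminorm m x <= seminorm n x.
Proof.
move=> mn; apply: seminorm_le => w; apply: le_trans (seminorm_ge n x w).
by rewrite ler_wpM2l ?normc_ge0 // weight_le.
Qed.

Definition schwartz_ball (x : schwartz) (i : nat * R) : set schwartz :=
  [set y | seminorm i.1 (y - x) < i.2].

Definition schwartz_nbhs (x : schwartz) : set_system schwartz :=
  filter_from [set i | 0 < i.2] (schwartz_ball x).

HB.instance Definition _ := hasNbhs.Build schwartz schwartz_nbhs.

Let schwartz_nbhs_filter (x : schwartz) : ProperFilter (nbhs x).
Proof.
apply: filter_from_proper => [|[n e] /= e0]; last first.
  by exists x; rewrite /schwartz_ball/= subrr seminorm0.
apply: filter_from_filter; first by exists (0%N, 1) => /=.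
move=> [n e] [n' e'] /= e0 e'0; exists (maxn n n', Num.min e e') => /=.
  by rewrite lt_min e0.
move=> y; rewrite /schwartz_ball /= lt_min => /andP[ye ye']; split=> /=.
  by apply: le_lt_trans ye; apply: seminorm_mono; exact: leq_maxl.
by apply: le_lt_trans ye'; apply: seminorm_mono; exact: leq_maxr.
Qed.

Let schwartz_nbhs_singleton (x : schwartz) (A : set schwartz) : nbhs x A -> A x.
Proof.
by move=> [[n e] /= e0]; apply; rewrite /schwartz_ball/= subrr seminorm0.
Qed.

Let schwartz_nbhs_nbhs (x : schwartz) (A : set schwartz) :
  nbhs x A -> nbhs x (nbhs^~ A).
Proof.
move=> [[n e] /= e0 xA]; exists (n, e / 2) => /=; first by rewrite divr_gt0.
move=> y xy; exists (n, e / 2) => /=; first by rewrite divr_gt0.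
move=> z yz; apply: xA; rewrite /schwartz_ball/= (splitr e) -(subrKA y).
by apply: le_lt_trans (seminormD n _ _) _; rewrite ltrD.
Qed.

HB.instance Definition _ := Nbhs_isNbhsTopological.Build schwartz
  schwartz_nbhs_filter schwartz_nbhs_singleton schwartz_nbhs_nbhs.

(* H(R, q), as a vector space. *)
Definition hecke : set schwartz := [set x | finitely_supported x].

Definition basis_fun (w : W) : W -> C^o := fun v => (v == w)%:R.

Lemma basis_fun_schwartz w : basis_fun w \in in_schwartz.
Proof.
apply: in_schwartz_fin; apply: (@sub_finite_set _ _ [set w]) => // v /=.
by apply: contra_neqP => /eqP vw; rewrite /basis_fun (negbTE vw).
Qed.

Definition basisN (w : W) : schwartz := Schwartz (basis_fun_schwartz w).

Local Notation label := (label R D).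

(* T_w, which depends on q in the coordinates given by the N_w. *)
Definition basisT (q : label) (w : W) : schwartz :=
  (Num.sqrt (q w))%:C *: basisN w.

(* The values of m outside H(R, q) are irrelevant. *)
Record is_hecke_mul (q : label) (m : schwartz -> schwartz -> schwartz) : Prop :=
  IsHeckeMul {
  hecke_mul_closed : forall x y, hecke x -> hecke y -> hecke (m x y);
  hecke_mul_linearl : forall (c : C) x x' y, hecke x -> hecke x' -> hecke y ->
    m (c *: x + x') y = c *: m x y + m x' y;
  hecke_mul_linearr : forall (c : C) x y y', hecke x -> hecke y -> hecke y' ->
    m x (c *: y + y') = c *: m x y + m x y';
  hecke_mulA : forall x y z, hecke x -> hecke y -> hecke z ->
    m x (m y z) = m (m x y) z;
  hecke_mul1l : forall x, hecke x -> m (basisT q (w_one D)) x = x;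
  hecke_mul1r : forall x, hecke x -> m x (basisT q (w_one D)) = x;
  hecke_mul_length : forall w v, len (w_mul w v) = (len w + len v)%N ->
    m (basisT q w) (basisT q v) = basisT q (w_mul w v);
  hecke_mul_quadratic : forall s, Saff s ->
    m (basisT q s) (basisT q s) =
      (q s - 1)%:C *: basisT q s + (q s)%:C *: basisT q (w_one D) }.

(* The relations determine the product of H(R, q) uniquely. *)
Definition hecke_mul (q : label) : schwartz -> schwartz -> schwartz :=
  xget (fun _ _ => 0) [set m | is_hecke_mul q m].

(* The product of S(R, q): the extension by continuity of that of H(R, q). *)
Definition schwartz_mul (q : label) (x y : schwartz) : schwartz :=
  lim ((fun z : schwartz * schwartz => hecke_mul q z.1 z.2) @
         within (hecke `*` hecke) (nbhs (x, y))).

Definition schwartz_is_inverse (q : label) (x y : schwartz) : Prop :=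
  schwartz_mul q x y = basisT q (w_one D) /\
  schwartz_mul q y x = basisT q (w_one D).

Definition schwartz_inv (q : label) (x : schwartz) : schwartz :=
  get (schwartz_is_inverse q x).

Definition invertible_set : set (schwartz * label) :=
  [set z | exists y, schwartz_is_inverse z.2 z.1 y].

Definition inversion (z : schwartz * label) : schwartz * label :=
  (schwartz_inv z.2 z.1, z.2).
End SchwartzAlgebra.

Arguments invertible_set {R D} f.

(* Main.v *)
From HB Require Import structures.
From mathcomp Require Import all_boot all_order all_algebra finmap.
From mathcomp Require Import complex.
From mathcomp Require Import all_classical all_reals all_analysis.
From mathcomp Require Import ring lra zify.
Require Import Defs.

(* Write N_u N_v as a sum over the reduced word of u: at each letter s one either
   multiplies by s, or, if that would shorten the current element, stays and picks
   up the factor q(s)^(1/2) - q(s)^(-1/2). Staying strictly decreases the number of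
   gradients of affine roots that are inverted by both the current element and the
   remaining word, so at most |R_0| factors occur and the coefficients of N_u N_v
   have an l^1 norm that is polynomial in the length of u, locally uniformly in q
   (this is Lusztig's argument). As W has polynomial growth, the topology is given
   by the weighted l^1 norms P_n, and with nu = |R_0|
     P_n(x y) <= C (P_nu(x) P_n(y) + n P_(nu+n)(x) P_(n-1)(y)).
   Only P_nu(x) multiplies the top norm of y, so 1 + x is invertible, by a Neumann
   series converging in all P_n, as soon as C P_nu(x) <= 1/2, for all q near a
   given one. If y0 inverts x0 at q0, then x y0 and y0 x are close to 1 for (x, q)
   near (x0, q0), hence invertible, and x^-1 = y0 (x y0)^-1. *)

Set Implicit Arguments.
Unset Strict Implicit.
Unset Printing Implicit Defensive.
Import Order.TTheory GRing.Theory Num.Theory ComplexField.Normc.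
Import numFieldNormedType.Exports.
Local Open Scope classical_set_scope.
Local Open Scope complex_scope.
Local Open Scope ring_scope.

(** * Root data *)

(** A neighbourhood in the Fréchet topology bounds finitely many norms, while an inverse must have
    all of them finite. If a norm of [x] growing with [n] multiplied the top norm of [y], the radius
    of convergence would shrink with [n]. The binomial expansion of the weight of a product isolates
    the term in which the full power falls on [y], and there [x] enters through an exponent that
    depends on the root system alone. The higher norms then follow by induction on [n], the lower
    ones acting as an inhomogeneous term. The product of the Hecke algebra is given by relations
    only, so its existence has to be shown: left and right multiplications by generators act on
    functions on [W] and commute, which yields associativity. All of this rests on descents, hence
    on the simple reflections detecting length 0, and this requires a highest coroot in every
    component, which is derived here from the axioms. The integrality of [f] enters in the count of
    group elements. *)

Lemma int_basis_torsion_free (X : zmodType) n (e : 'I_n -> X) (x : X) (k : int) :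
  int_basis e -> k != 0 -> x *~ k = 0 -> x = 0.
Proof.
move=> eB k0 xk; have [c [xc _]] := eB x; have [d [_ dU]] := eB 0.
have d0 : d = [ffun=> 0].
  by apply: dU; rewrite big1 // => i _; rewrite ffunE mulr0z.
have : d = [ffun i => c i * k].
  apply: dU; rewrite -[LHS]xk xc mulrz_suml; apply: eq_bigr => i _.
  by rewrite ffunE mulrzA.
rewrite d0 => /ffunP dk; rewrite xc big1 // => i _.
have /eqP := dk i; rewrite !ffunE eq_sym mulf_eq0 (negbTE k0) orbF => /eqP ->.
by rewrite mulr0z.
Qed.

Section RootDatum.
Context (D : based_root_datum).
Local Notation X := (lat D).
Local Notation Y := (colat D).
Local Notation R0 := (roots D).
Implicit Types (x y : X) (a b c : X) (k : int).

Lemma lat_torsion_free x k : k != 0 -> x *~ k = 0 -> x = 0.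
Proof. by have [n [[e eB] _]] := lat_free D; exact: int_basis_torsion_free eB. Qed.

Lemma colat_torsion_free (v : Y) k : k != 0 -> v *~ k = 0 -> v = 0.
Proof. by have [n [_ [e eB]]] := lat_free D; exact: int_basis_torsion_free eB. Qed.

Lemma pairing0l (v : Y) : pairing (0 : X) v = 0.
Proof. by apply: (addrI (pairing 0 v)); rewrite -pairingDl !addr0. Qed.

Lemma pairing0r x : pairing x (0 : Y) = 0.
Proof. by apply: (addrI (pairing x 0)); rewrite -pairingDr !addr0. Qed.

Lemma pairingNl x (v : Y) : pairing (- x) v = - pairing x v.
Proof. by apply: (addrI (pairing x v)); rewrite -pairingDl !subrr pairing0l. Qed.

Lemma pairingNr x (v : Y) : pairing x (- v) = - pairing x v.
Proof. by apply: (addrI (pairing x v)); rewrite -pairingDr !subrr pairing0r. Qed.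

Lemma pairingBl x x' (v : Y) : pairing (x - x') v = pairing x v - pairing x' v.
Proof. by rewrite pairingDl pairingNl. Qed.

Lemma pairingBr x (v v' : Y) : pairing x (v - v') = pairing x v - pairing x v'.
Proof. by rewrite pairingDr pairingNr. Qed.

Lemma pairing_suml (I : Type) (r : seq I) (P : pred I) (F : I -> X) (v : Y) :
  pairing (\sum_(i <- r | P i) F i) v = \sum_(i <- r | P i) pairing (F i) v.
Proof. by apply: (big_morph (fun x => pairing x v)) => [? ?|]; rewrite ?pairingDl ?pairing0l. Qed.

Lemma pairing_sumr (I : Type) (r : seq I) (P : pred I) (F : I -> Y) x :
  pairing x (\sum_(i <- r | P i) F i) = \sum_(i <- r | P i) pairing x (F i).
Proof. by apply: (big_morph (pairing x)) => [? ?|]; rewrite ?pairingDr ?pairing0r. Qed.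

Lemma pairingMnl x (v : Y) (n : nat) : pairing (x *+ n) v = pairing x v *+ n.
Proof. by elim: n => [|n IH]; rewrite ?pairing0l // !mulrS pairingDl IH. Qed.

Lemma pairingMnr x (v : Y) (n : nat) : pairing x (v *+ n) = pairing x v *+ n.
Proof. by elim: n => [|n IH]; rewrite ?pairing0r // !mulrS pairingDr IH. Qed.

Lemma pairingMzl x (v : Y) k : pairing (x *~ k) v = k * pairing x v.
Proof.
case: k => n; last rewrite NegzE mulrNz pairingNl mulNr; congr (- _) || idtac.
  by rewrite -pmulrn pairingMnl -mulr_natl natz.
by rewrite -pmulrn pairingMnl -mulr_natl natz.
Qed.

Lemma pairingMzr x (v : Y) k : pairing x (v *~ k) = k * pairing x v.
Proof.
case: k => n; last rewrite NegzE mulrNz pairingNr mulNr; congr (- _) || idtac.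
  by rewrite -pmulrn pairingMnr -mulr_natl natz.
by rewrite -pmulrn pairingMnr -mulr_natl natz.
Qed.

Definition pairingE := (pairingDl, pairingDr, pairingBl, pairingBr, pairingNl,
  pairingNr, pairingMzl, pairingMzr, pairing0l, pairing0r).

Lemma pairing_inj (v v' : Y) : (forall x, pairing x v = pairing x v') -> v = v'.
Proof.
move=> vv'; pose g : X -> int := fun x => pairing x v.
have gA : zmod_morphism g by move=> x y; rewrite /g pairingBl.
pose G := GRing.isZmodMorphism.Build X int g gA.
pose g' : {additive X -> int} := HB.pack g G.
have [w [_ wU]] := perfectl g'.
rewrite -(wU v) // -(wU v') // => x; exact/esym/vv'.
Qed.

Lemma root_neq0 a : a \in R0 -> a != 0.
Proof.
by move=> aR; apply/eqP => a0; have := pairing_coroot aR; rewrite a0 pairing0l.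
Qed.

Lemma refl_root a b : a \in R0 -> b \in R0 -> refl a b \in R0.
Proof. exact: refl_roots. Qed.

Lemma reflD a x y : refl a (x + y) = refl a x + refl a y.
Proof. by rewrite /refl pairingDl mulrzDr opprD addrACA. Qed.

Lemma reflN a x : refl a (- x) = - refl a x.
Proof. by rewrite /refl pairingNl mulrNz opprD opprK. Qed.

Lemma refl_id a : a \in R0 -> refl a a = - a.
Proof. by move=> aR; rewrite /refl pairing_coroot // opprD addrA subrr add0r. Qed.

Lemma reflK a : a \in R0 -> involutive (refl a).
Proof.
move=> aR x; rewrite /refl !pairingE pairing_coroot //.
rewrite -addrA -opprD -mulrzDr [X in a *~ X](_ : _ = 0) ?mulr0z ?subr0 //; ring.
Qed.

Lemma oppr_root a : (- a \in R0) = (a \in R0).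
Proof.
suff H b : b \in R0 -> - b \in R0 by apply/idP/idP => /H //; rewrite opprK.
by move=> bR; rewrite -(refl_id bR) refl_root.
Qed.

(* Up to a factor, [root_form] is the Gram form of the embedding of the roots
   by their pairings with all coroots. *)
Definition root_form x y : int :=
  \sum_(c <- R0) pairing x (coroot c) * pairing y (coroot c).

Definition root_dual x : Y := \sum_(c <- R0) coroot c *~ pairing x (coroot c).

Lemma pairing_root_dual x y : pairing x (root_dual y) = root_form x y.
Proof.
by rewrite pairing_sumr; apply: eq_bigr => c _; rewrite pairingMzr mulrC.
Qed.

Lemma root_formC x y : root_form x y = root_form y x.
Proof. by apply: eq_bigr => c _; rewrite mulrC. Qed.

Lemma root_form_ge0 x : 0 <= root_form x x.
Proof. by apply: sumr_ge0 => c _; rewrite -expr2 sqr_ge0. Qed.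

Lemma root_form_eq0 x : root_form x x = 0 ->
  forall c, c \in R0 -> pairing x (coroot c) = 0.
Proof.
move=> /eqP; rewrite psumr_eq0 => [|c _]; last by rewrite -expr2 sqr_ge0.
by move=> /allP H c cR; have := H c cR; rewrite /= mulf_eq0 orbb => /eqP.
Qed.

Lemma root_form_gt0 a : a \in R0 -> 0 < root_form a a.
Proof.
move=> aR; rewrite lt_def root_form_ge0 andbT; apply/eqP.
by move=> /root_form_eq0 /(_ a aR); rewrite pairing_coroot.
Qed.

(** [corefl_coroots] gives some coroot as the image without saying which, so the dual reflection is
    seen to permute the coroots by counting: it is an injective map of a finite list into itself. *)
Lemma reindex_coroots a (V : zmodType) (F : Y -> V) : a \in R0 ->
  \sum_(c <- R0) F (coroot c - coroot a *~ pairing a (coroot c)) =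
  \sum_(c <- R0) F (coroot c).
Proof.
move=> aR; pose s (v : Y) := v - coroot a *~ pairing a v.
have sK : involutive s.
  move=> v; rewrite /s !pairingE pairing_coroot //.
  rewrite -addrA -opprD -mulrzDr [X in _ *~ X](_ : _ = 0) ?mulr0z ?subr0 //; ring.
have uC : uniq [seq coroot c | c <- R0].
  by rewrite map_inj_in_uniq ?fset_uniq // => x y xR yR; apply: coroot_inj.
have sC : {subset [seq s v | v <- [seq coroot c | c <- R0]] <= [seq coroot c | c <- R0]}.
  move=> _ /mapP[_ /mapP[c cR ->] ->].
  by have [d dR] := corefl_coroots aR cR; rewrite /s => ->; exact: map_f.
have usC : uniq [seq s v | v <- [seq coroot c | c <- R0]].
  by rewrite map_inj_uniq //; exact: inv_inj.
have [|_ eqC] := uniq_min_size usC sC; first by rewrite !size_map.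
rewrite -[RHS](big_map (fun c => coroot c) xpredT).
rewrite -(perm_big _ (uniq_perm usC uC eqC)) /= !big_map.
exact: eq_bigr.
Qed.

(* The dual reflection negates [root_dual a], as it permutes the coroots. *)
Lemma root_dual_root a : a \in R0 ->
  root_dual a *~ 2 = coroot a *~ root_form a a.
Proof.
move=> aR; pose s (v : Y) := v - coroot a *~ pairing a v.
have sD v w : s (v + w) = s v + s w.
  by rewrite /s pairingDr mulrzDr opprD addrACA.
have s0 : s 0 = 0 by rewrite /s pairing0r mulr0z subr0.
have sM v k : s (v *~ k) = s v *~ k.
  by rewrite /s pairingMzr mulrzBl -mulrzA mulrC.
have sr : s (root_dual a) = - root_dual a.
  rewrite /root_dual (big_morph s sD s0) -sumrN.
  rewrite -(@reindex_coroots a _ (fun v => - (v *~ pairing a v))) //=.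
  apply: eq_bigr => c _; rewrite sM.
  have -> : pairing a (s (coroot c)) = - pairing a (coroot c).
    by rewrite /s pairingBr pairingMzr pairing_coroot //; ring.
  by rewrite mulrNz opprK.
have := sr; rewrite /s pairing_root_dual => /eqP; rewrite subr_eq addrC -subr_eq.
by rewrite opprK => /eqP <-; rewrite mulrz_nat mulr2n.
Qed.

(** The formula [2 (x, a) / (a, a)] for the pairing with a coroot, cleared of denominators. The
    symmetry of the form then relates the two pairings of a pair of roots. *)
Lemma coroot_cartan a x : a \in R0 ->
  root_form a a * pairing x (coroot a) = 2 * root_form x a.
Proof.
by move=> aR; rewrite -pairingMzr -root_dual_root // pairingMzr pairing_root_dual.
Qed.

Lemma root_dual_comb x y (k l : int) :
  root_dual (x *~ k - y *~ l) = root_dual x *~ k - root_dual y *~ l.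
Proof.
rewrite /root_dual !mulrz_suml -sumrB; apply: eq_bigr => c _.
by rewrite !pairingE mulrzBr -!mulrzA ![_ * pairing _ _]mulrC.
Qed.

(** The roots need not span [X], so the hypothesis does not give equality at once. But
    [coroot a - coroot b] is, up to a factor, [root_dual z] for a combination [z] of roots. The
    hypothesis makes [root_form z z] vanish, positivity makes [root_dual z] vanish, and the
    colattice is torsion free. *)
Lemma coroot_eq a b : a \in R0 -> b \in R0 ->
  (forall c, c \in R0 -> pairing c (coroot a) = pairing c (coroot b)) -> a = b.
Proof.
move=> aR bR ab; apply: (coroot_inj aR bR).
set A := root_form a a; set B := root_form b b.
pose z := a *~ (2 * B) - b *~ (2 * A).
have dz : root_dual z = (coroot a - coroot b) *~ (A * B).
  rewrite root_dual_comb !mulrzA !root_dual_root // -!mulrzA -/A -/B.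
  by rewrite [B * A]mulrC -mulrzBl.
have z0 : root_form z z = 0.
  rewrite -pairing_root_dual dz pairingMzr pairingBr.
  rewrite /z !pairingBl !pairingMzl !ab //; ring.
have dz0 : root_dual z = 0.
  by rewrite /root_dual big1_seq // => c /= cR; rewrite root_form_eq0 // mulr0z.
apply/eqP; rewrite -subr_eq0; apply/eqP.
apply: (@colat_torsion_free _ (A * B)); last by rewrite -dz dz0.
by rewrite mulf_neq0 // gt_eqF // root_form_gt0.
Qed.
End RootDatum.

(** * Equivariance of coroots and the action of the finite Weyl group *)

Section PositiveRoots.
Context (D : based_root_datum).
Local Notation X := (lat D).
Local Notation Y := (colat D).
Local Notation R0 := (roots D).
Local Notation S0 := (simple D).
Implicit Types (x y : X) (a b c : X) (k : int).

(* Two reflections with the same root [e] that preserve [roots D] differ by the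
   unipotent map [x |-> x + (g x - h x) e], which has no unbounded orbit. *)
Lemma reflection_unique (e : X) (g h : X -> int) :
  e \in R0 -> (forall x y, g (x + y) = g x + g y) ->
  (forall x y, h (x + y) = h x + h y) ->
  g e = 2 -> h e = 2 ->
  (forall c, c \in R0 -> c - e *~ g c \in R0) ->
  (forall c, c \in R0 -> c - e *~ h c \in R0) ->
  {in R0, g =1 h}.
Proof.
move=> eR gD hD ge he gR hR c cR; apply/eqP; rewrite -subr_eq0.
apply/negP => d0; pose d : int := g c - h c; rewrite -/d in d0.
have addM (q : X -> int) : (forall x y, q (x + y) = q x + q y) ->
    forall x k, q (x *~ k) = k * q x.
  move=> qD x k.
  have q0 : q 0 = 0 by apply: (addrI (q 0)); rewrite -qD !addr0.
  have qn n : q (x *+ n) = n%:Z * q x.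
    by elim: n => [|n IH]; rewrite ?mulr0n ?q0 ?mul0r // mulrS qD IH; lia.
  case: k => n; first by rewrite -pmulrn qn.
  rewrite NegzE mulrNz -pmulrn; apply: (addrI (q (x *+ n.+1))).
  by rewrite -qD subrr q0 qn; lia.
have orbit n : c + e *~ (d *+ n) \in R0.
  elim: n => [|n IH]; first by rewrite mulr0n mulr0z addr0.
  set y := c + _ in IH; have := hR _ (gR _ IH).
  have -> // : y - e *~ g y - e *~ h (y - e *~ g y) = c + e *~ (d *+ n.+1).
  rewrite -mulrNz hD addM // he -addrA -!mulrNz -!mulrzDr {1}/y -addrA -mulrzDr.
  by congr (_ + _ *~ _); rewrite /y gD hD !addM // ge he mulrS /d; lia.
have bounded n : (`|pairing (c + e *~ (d *+ n)) (coroot e)| <=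
    \sum_(b <- R0) `|pairing b (coroot e)|)%R.
  by rewrite (big_rem _ (orbit n)) /= lerDl sumr_ge0.
pose B : int := \sum_(b <- R0) `|pairing b (coroot e)|; rewrite -/B in bounded.
have B0 : 0 <= B by rewrite sumr_ge0.
pose p : int := pairing c (coroot e).
have := bounded (absz (B + `|p| + 1)).
rewrite !pairingE pairing_coroot // -/p.
set n := absz _; have nE : n%:R = B + `|p| + 1 by rewrite natz /n gez0_abs; lia.
rewrite -[d *+ n]mulr_natl nE; move/eqP: d0 => d0; nia.
Qed.

Lemma reflMz a x k : refl a (x *~ k) = refl a x *~ k.
Proof. by rewrite /refl pairingMzl mulrzBl -!mulrzA [k * _]mulrC. Qed.

(** The axioms do not say that passing to coroots commutes with reflections. It does, because
    [coroot (refl a b)] and the dual reflection of [coroot b] both define reflections with root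
    [refl a b] that preserve the roots: [reflection_unique] compares them on the roots, and
    [coroot_eq] removes the restriction to roots. *)
Lemma pairing_reflr a b x : a \in R0 -> b \in R0 ->
  pairing x (coroot (refl a b)) = pairing (refl a x) (coroot b).
Proof.
move=> aR bR.
have sR := refl_root aR bR.
have [c cR sE] := corefl_coroots aR bR.
have spair y : pairing y (coroot c) = pairing (refl a y) (coroot b).
  by rewrite -sE /refl !pairingE; ring.
suff -> : refl a b = c by [].
apply: coroot_eq => // d dR.
apply: (@reflection_unique (refl a b) (fun y => pairing y (coroot (refl a b)))
  (fun y => pairing y (coroot c))) => //.
- by move=> y z; rewrite pairingDl.
- by move=> y z; rewrite pairingDl.
- by rewrite pairing_coroot.
- by rewrite spair reflK // pairing_coroot.
- by move=> y yR; exact: refl_root.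
move=> y yR; rewrite spair.
have := refl_root aR (refl_root bR (refl_root aR yR)).
rewrite [X in refl a X](_ : _ = refl a y - b *~ pairing (refl a y) (coroot b)) //.
by rewrite reflD reflK // reflN reflMz.
Qed.

Lemma coroot_refl a b : a \in R0 -> b \in R0 ->
  coroot (refl a b) = coroot b - coroot a *~ pairing a (coroot b).
Proof.
move=> aR bR; apply: pairing_inj => x.
by rewrite pairing_reflr // /refl !pairingE; ring.
Qed.

Lemma corootN a : a \in R0 -> coroot (- a) = - coroot a.
Proof.
move=> aR; rewrite -(refl_id aR) coroot_refl // pairing_coroot //.
by rewrite -[X in X - _]mulr1z -mulrzBr.
Qed.

Implicit Types (v w : finite_weyl D).

Lemma fw_additive w x y : w (x + y) = w x + w y.
Proof.
by elim: (fw_gen w) => //= a u _ _ IH; rewrite IH reflD.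
Qed.

Lemma fw0 w : w 0 = 0.
Proof. by apply: (addrI (w 0)); rewrite -fw_additive !addr0. Qed.

Lemma fwN w x : w (- x) = - w x.
Proof. by apply: (addrI (w x)); rewrite -fw_additive !subrr fw0. Qed.

Lemma fwMz w x k : w (x *~ k) = w x *~ k.
Proof. by elim: (fw_gen w) => //= a u _ _ IH; rewrite IH reflMz. Qed.

Lemma fw_root w a : (w a \in R0) = (a \in R0).
Proof.
have H (u : finite_weyl D) b : b \in R0 -> u b \in R0.
  by elim: (fw_gen u) => //= d v' dR _ IH bR; exact/refl_root/IH.
apply/idP/idP; last exact: H.
elim: (fw_gen w) => //= c u cR _ IH aR; apply: IH.
by rewrite -(reflK cR (u a)) refl_root.
Qed.

Lemma fw_pairing w x a : a \in R0 -> pairing (w x) (coroot (w a)) = pairing x (coroot a).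
Proof.
suff H (u : X -> X) : refl_generated u ->
    a \in R0 -> u a \in R0 /\ pairing (u x) (coroot (u a)) = pairing x (coroot a).
  by move=> aR; have [] := H _ (fw_gen w) aR.
elim=> //= c {}u cR _ IH aR; have [uR <-] := IH aR; split; first exact: refl_root.
by rewrite pairing_reflr // reflK.
Qed.

Lemma fw_span w x : exists c : X -> int, w x = x + \sum_(a <- R0) a *~ c a.
Proof.
elim: (fw_gen w) => [|a u aR _ [c /= ->]].
  by exists (fun=> 0); rewrite big1 ?addr0.
set z := x + _; exists (fun b => c b - (b == a)%:Z * pairing z (coroot a)).
rewrite /refl -addrA; congr (_ + _); under [RHS]eq_bigr do rewrite mulrzBr.
rewrite sumrB; congr (_ - _).
rewrite (bigD1_seq a) //= ?fset_uniq // eqxx mul1r big1 ?addr0 // => b ba.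
by rewrite (negbTE ba) mul0r mulr0z.
Qed.

End PositiveRoots.

(** * Simple roots, positivity and heights *)

Lemma perm_map_inj (T : eqType) (s : seq T) (g : T -> T) : uniq s ->
  {in s &, injective g} -> {in s, forall x, g x \in s} -> perm_eq (map g s) s.
Proof.
move=> us gI gs; have ugs : uniq (map g s) by rewrite map_inj_in_uniq.
apply: uniq_perm => //; have [||] := uniq_min_size ugs (s2 := s) => //.
  by move=> _ /mapP[x xs ->]; exact: gs.
by rewrite size_map.
Qed.

Section SimpleRoots.
Context (D : based_root_datum).
Local Notation X := (lat D).
Local Notation Y := (colat D).
Local Notation R0 := (roots D).
Local Notation S0 := (simple D).
Implicit Types (x y : X) (a b c d : X) (k : int).

Lemma pos_root_sub a : pos_root a -> a \in R0.
Proof. by move=> /andP[]. Qed.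

Lemma neg_rootE a : neg_root a = pos_root (- a).
Proof.
rewrite /neg_root /pos_root oppr_root; congr (_ && _).
by apply: asbool_equiv_eq; split=> -[c ac]; exists c; rewrite ?ac ?opprK // -ac opprK.
Qed.

Lemma simple_comb_inj (m n : X -> int) :
  \sum_(b <- S0) b *~ m b = \sum_(b <- S0) b *~ n b -> {in S0, m =1 n}.
Proof.
move=> mn b bS; apply/eqP; rewrite -subr_eq0; apply/eqP.
apply: (simple_free (c := fun b => m b - n b)) bS.
by under eq_bigr do rewrite mulrzBr; rewrite sumrB mn subrr.
Qed.

Lemma root_pos_or_neg a : a \in R0 -> pos_root a || neg_root a.
Proof.
move=> aR; have [c [|]] := simple_span aR => ac.
  by apply/orP; left; rewrite /pos_root aR; apply/asboolP; exists c.
by apply/orP; right; rewrite /neg_root aR; apply/asboolP; exists c.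
Qed.

Lemma pos_rootN a : pos_root a -> ~~ pos_root (- a).
Proof.
rewrite -neg_rootE => /andP[aR /asboolP[m am]]; apply/negP => /andP[_ /asboolP[n an]].
have /simple_comb_inj mn : \sum_(b <- S0) b *~ (m b)%:Z = \sum_(b <- S0) b *~ - (n b)%:Z.
  by under [RHS]eq_bigr do rewrite mulrNz; rewrite sumrN -[LHS]am -an.
have := root_neq0 aR; rewrite am big1_seq ?eqxx // => b /= bS.
have := mn b bS; case: (m b) => [|k] //; lia.
Qed.

Lemma nposE a : a \in R0 -> ~~ pos_root a = pos_root (- a).
Proof.
move=> aR; apply/idP/idP => [na|ma].
  by have := root_pos_or_neg aR; rewrite (negbTE na) neg_rootE.
by rewrite -[a]opprK pos_rootN.
Qed.

Lemma simple_pos b : b \in S0 -> pos_root b.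
Proof.
move=> bS; rewrite /pos_root simple_sub //; apply/asboolP.
exists (fun c => (c == b : nat)); rewrite (bigD1_seq b) ?fset_uniq //= eqxx mulr1n.
by rewrite big1 ?addr0 // => c /negbTE ->; rewrite mulr0n.
Qed.

(** As the system is reduced, [a] involves a simple root other than [b]; its coefficient survives
    the reflection in [b] and decides the sign. *)
Lemma pos_refl_simple b a : b \in S0 -> pos_root a -> a != b -> pos_root (refl b a).
Proof.
move=> bS aP ab; have bR := simple_sub bS; have aR := pos_root_sub aP.
have sR := refl_root bR aR; case/andP: (aP) => _ /asboolP[m am].
have [d /andP[dS /andP[db md]]] : exists d, (d \in S0) && ((d != b) && (0 < m d)%N).
  apply: contrapT => nd; have am' : a = b *~ m b.
    rewrite am (bigD1_seq b) ?fset_uniq //= big1_seq ?addr0 // => d /andP[db dS].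
    have [->|md] := posnP (m d); first by rewrite mulr0n.
    by case: nd; exists d; rewrite dS db.
  have := roots_reduced bR (k := m b); rewrite -am' => /(_ aR) [] a_b.
    by rewrite a_b eqxx in ab.
  by have := pos_rootN (simple_pos bS); rewrite -a_b aP.
have := root_pos_or_neg sR; case: (boolP (pos_root (refl b a))) => //= _.
move=> /andP[_ /asboolP[n sn]].
have /simple_comb_inj mn : \sum_(c <- S0) c *~ - (n c)%:Z =
    \sum_(c <- S0) c *~ ((m c)%:Z - (c == b)%:Z * pairing a (coroot b)).
  under eq_bigr do rewrite mulrNz; rewrite sumrN -[LHS]sn /refl {1}am.
  under [RHS]eq_bigr do rewrite mulrzBr; rewrite sumrB; congr (_ - _).
  rewrite (bigD1_seq b) ?fset_uniq //= eqxx mul1r big1 ?addr0 // => c /negbTE ->.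
  by rewrite mul0r mulr0z.
by have := mn d dS; rewrite (negbTE db) mul0r; lia.
Qed.

Lemma pairing_gt0C a b : a \in R0 -> b \in R0 ->
  0 < pairing a (coroot b) -> 0 < pairing b (coroot a).
Proof.
move=> aR bR ab; have := coroot_cartan a bR; have := coroot_cartan b aR.
have := root_form_gt0 aR; have := root_form_gt0 bR; rewrite (root_formC b a); nia.
Qed.

Lemma pairing_eq0C a b : a \in R0 -> b \in R0 ->
  pairing a (coroot b) = 0 -> pairing b (coroot a) = 0.
Proof.
move=> aR bR ab; have := coroot_cartan a bR; have := coroot_cartan b aR.
have := root_form_gt0 aR; have := root_form_gt0 bR; rewrite (root_formC b a) ab; nia.
Qed.

(** Otherwise [root_form a a], expanded over the simple roots in its first argument, would be at
    most 0. *)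
Lemma exists_simple_pairing a : pos_root a ->
  exists2 b, b \in S0 & 0 < pairing a (coroot b).
Proof.
move=> aP; have aR := pos_root_sub aP; apply: contrapT => nb.
have ab b : b \in S0 -> root_form b a <= 0.
  move=> bS; have bR := simple_sub bS.
  have : pairing a (coroot b) <= 0.
    by rewrite leNgt; apply/negP => ab; case: nb; exists b.
  have := coroot_cartan a bR; have := root_form_gt0 bR; rewrite root_formC; nia.
case/andP: aP => _ /asboolP[m am].
have := root_form_gt0 aR; apply/negP; rewrite -leNgt.
rewrite -pairing_root_dual {1}am pairing_suml big_seq; apply: sumr_le0 => b bS.
by rewrite pairingMnl pairing_root_dual -mulr_natl mulr_ge0_le0 ?ler0n ?ab.
Qed.

(** Reflecting in a simple root whose coroot pairs positively with [a] lowers the sum of the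
    coefficients. The step is given the sign of the transposed pairing, that of [b] with [coroot a],
    because the induction serves to prove properties of coroots. *)
Lemma pos_root_ind (P : X -> Prop) : {in S0, forall b, P b} ->
  (forall a b, b \in S0 -> pos_root a -> pos_root (refl b a) ->
    0 < pairing b (coroot a) -> P (refl b a) -> P a) ->
  forall a, pos_root a -> P a.
Proof.
move=> PS PR a aP; have := aP; case/andP => _ /asboolP[m am].
have [n] := ubnP (\sum_(b <- S0) m b)%N.
elim: n a m aP am => // n IH a m aP am mn.
have [b bS ab] := exists_simple_pairing aP; have bR := simple_sub bS.
have [->|neq] := eqVneq a b; first exact: PS.
have sP := pos_refl_simple bS aP neq.
apply: (PR a b) => //; first by apply: pairing_gt0C => //; exact: pos_root_sub.
case/andP: (sP) => _ /asboolP[l sl]; apply: (IH _ l) => //.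
have /simple_comb_inj lm : \sum_(c <- S0) c *~ (l c)%:Z =
    \sum_(c <- S0) c *~ ((m c)%:Z - (c == b)%:Z * pairing a (coroot b)).
  rewrite -[LHS]sl /refl {1}am.
  under [RHS]eq_bigr do rewrite mulrzBr; rewrite sumrB; congr (_ - _).
  rewrite (bigD1_seq b) ?fset_uniq //= eqxx mul1r big1 ?addr0 // => c /negbTE ->.
  by rewrite mul0r mulr0z.
rewrite ltnS in mn; apply: leq_trans mn; rewrite !(bigD1_seq b) ?fset_uniq //= -addSn.
apply: leq_add; first by have := lm b bS; rewrite eqxx; lia.
apply: eq_leq; rewrite big_seq_cond [RHS]big_seq_cond; apply: eq_bigr => c /andP[cS cb].
by have := lm c cS; rewrite (negbTE cb) mul0r; lia.
Qed.

Definition coroot_cone (v : Y) : Prop :=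
  exists m : X -> nat, v = \sum_(g <- S0) coroot g *+ m g.

Lemma coroot_cone0 : coroot_cone 0.
Proof. by exists (fun=> 0%N); rewrite big1 // => g _; rewrite mulr0n. Qed.

Lemma coroot_coneD u v : coroot_cone u -> coroot_cone v -> coroot_cone (u + v).
Proof.
move=> [m ->] [n ->]; exists (fun g => (m g + n g)%N).
by rewrite -big_split /=; apply: eq_bigr => g _; rewrite mulrnDr.
Qed.

Lemma coroot_coneMn v n : coroot_cone v -> coroot_cone (v *+ n).
Proof.
move=> [m ->]; exists (fun g => (m g * n)%N).
by rewrite -sumrMnl; apply: eq_bigr => g _; rewrite mulrnA.
Qed.

Lemma coroot_cone_simple b : b \in S0 -> coroot_cone (coroot b).
Proof.
move=> bS; exists (fun c => (c == b : nat)).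
rewrite (bigD1_seq b) ?fset_uniq //= eqxx mulr1n.
by rewrite big1 ?addr0 // => c /negbTE ->; rewrite mulr0n.
Qed.

Lemma coroot_step a b : b \in S0 -> pos_root a ->
  coroot a = coroot (refl b a) + coroot b *~ pairing b (coroot a).
Proof.
move=> bS aP; rewrite coroot_refl ?(simple_sub bS) ?(pos_root_sub aP) //.
by rewrite subrK.
Qed.

(** Positivity is defined through roots, highest coroots through coroots; this is the passage from
    one to the other. *)
Lemma pos_coroot_cone a : pos_root a -> coroot_cone (coroot a).
Proof.
elim/pos_root_ind => [b bS|{}a b bS aP sP ba IH]; first exact: coroot_cone_simple.
rewrite (coroot_step bS aP); apply: coroot_coneD => //.
rewrite -[pairing _ _]gez0_abs ?ltW // -pmulrn.
exact/coroot_coneMn/coroot_cone_simple.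
Qed.

(** Twice the Weyl vector, which itself need not lie in [X]. *)
Definition rho2 : X := \sum_(c <- R0 | pos_root c) c.

(** The reflection in [b] permutes the positive roots other than [b], hence moves [rho2] by
    [- 2 b]. *)
Lemma pairing_rho2_simple b : b \in S0 -> pairing rho2 (coroot b) = 2.
Proof.
move=> bS; have bR := simple_sub bS.
pose P := [seq c <- R0 | pos_root c && (c != b)].
have rhoE : rho2 = b + \sum_(c <- P) c.
  rewrite /rho2 /P [in RHS]big_filter -[LHS]big_filter (bigD1_seq b) /=.
  - by rewrite big_filter_cond.
  - by rewrite mem_filter simple_pos.
  - by rewrite filter_uniq ?fset_uniq.
have PP : perm_eq (map (refl b) P) P.
  apply: perm_map_inj; first by rewrite filter_uniq ?fset_uniq.
    by move=> x y _ _; exact: (inv_inj (reflK bR)).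
  move=> c; rewrite !mem_filter => /andP[/andP[cP cb] cR].
  rewrite pos_refl_simple ?refl_root //= andbT; apply/eqP => cE.
  have cN : c = - b by rewrite -(reflK bR c) cE refl_id.
  by have := pos_rootN (simple_pos bS); rewrite -cN cP.
have sP : refl b (\sum_(c <- P) c) = \sum_(c <- P) c.
  rewrite -[RHS](perm_big _ PP) big_map (big_morph (refl b) (id1 := 0) (op1 := +%R)) //.
    exact: reflD.
  by rewrite /refl pairing0l mulr0z subr0.
have : refl b rho2 = rho2 - b *~ 2.
  rewrite rhoE reflD sP refl_id // [RHS]addrAC; congr (_ + _).
  by rewrite -[X in X - _]mulr1z -mulrzBr.
rewrite /refl => /addrI /oppr_inj /eqP; rewrite -subr_eq0 -mulrzBr => /eqP bz.
apply/eqP; rewrite -subr_eq0; apply/negP => /negP nz.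
by have := root_neq0 bR; rewrite (lat_torsion_free nz bz) eqxx.
Qed.

(** Twice the usual height: each simple coroot counts 2, by [pairing_rho2_simple]. *)
Definition height (v : Y) : int := pairing rho2 v.

Lemma height_cone (m : X -> nat) :
  height (\sum_(g <- S0) coroot g *+ m g) = \sum_(g <- S0) (2 * m g)%:Z.
Proof.
rewrite /height pairing_sumr; apply: eq_big_seq => g gS.
rewrite pairingMnr pairing_rho2_simple // PoszM.
by rewrite -[LHS]mulr_natr [X in _ * X]natz.
Qed.

Lemma height_cone_ge0 v : coroot_cone v -> 0 <= height v.
Proof. by move=> [m ->]; rewrite height_cone sumr_ge0. Qed.

Lemma height_cone_eq0 v : coroot_cone v -> height v <= 0 -> v = 0.
Proof.
move=> [m ->]; rewrite height_cone => h0.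
have /eqP : \sum_(g <- S0) (2 * m g)%:Z = 0 by apply/eqP; rewrite eq_le h0 sumr_ge0.
rewrite psumr_eq0 // => /allP m0; rewrite big1_seq // => g /= gS.
by have := m0 g gS; case: (m g) => //; rewrite mulr0n.
Qed.

Lemma heightD u v : height (u + v) = height u + height v.
Proof. exact: pairingDr. Qed.

Lemma heightB u v : height (u - v) = height u - height v.
Proof. exact: pairingBr. Qed.

Lemma heightN u : height (- u) = - height u.
Proof. exact: pairingNr. Qed.

Lemma heightMz u k : height (u *~ k) = k * height u.
Proof. exact: pairingMzr. Qed.

Lemma heightMn u n : height (u *+ n) = n%:Z * height u.
Proof. by rewrite -heightMz -pmulrn. Qed.

Lemma height_pos a : pos_root a -> 0 < height (coroot a).
Proof.
elim/pos_root_ind => [b bS|{}a b bS aP sP ba IH].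
  by rewrite /height pairing_rho2_simple.
rewrite (coroot_step bS aP) heightD /height pairingMzr (pairing_rho2_simple bS).
by rewrite addr_gt0 // mulr_gt0.
Qed.

Lemma pos_rootP a : a \in R0 -> pos_root a = (0 < height (coroot a)).
Proof.
move=> aR; apply/idP/idP => [|ha]; first exact: height_pos.
apply: contraTT ha => na; rewrite nposE // in na; have := height_pos na.
by rewrite corootN // /height pairingNr -leNgt; lia.
Qed.
End SimpleRoots.

(** * Irreducible components and their highest coroots *)

Lemma seq_argmax (T : eqType) (F : T -> int) (s : seq T) (x0 : T) : x0 \in s ->
  exists2 x, x \in s & {in s, forall y, F y <= F x}.
Proof.
elim: s x0 => // x s IH x0 _; have [->|[y ys]] : s = [::] \/ exists y, y \in s.
- by case: s {IH} => [|y s]; [left|right; exists y; rewrite mem_head].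
- by exists x; rewrite ?mem_head // => y; rewrite inE => /eqP ->.
have [z zs zmax] := IH y ys; have [xz|zx] := leP (F x) (F z).
  exists z; first by rewrite inE zs orbT.
  by move=> t; rewrite inE => /orP[/eqP ->|/zmax].
exists x; rewrite ?mem_head // => t; rewrite inE => /orP[/eqP -> //|/zmax tz].
exact: le_trans tz (ltW zx).
Qed.

Section HighestCoroot.
Context (D : based_root_datum).
Local Notation X := (lat D).
Local Notation Y := (colat D).
Local Notation R0 := (roots D).
Local Notation S0 := (simple D).
Implicit Types (x y : X) (a b c d e : X) (k : int).

Lemma height_neq0 a : a \in R0 -> height (coroot a) != 0.
Proof.
move=> aR; case: (boolP (pos_root a)) => [/height_pos/gt_eqF -> //|].
rewrite nposE // => /height_pos; rewrite corootN // /height pairingNr; lia.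
Qed.

(** The component is the intersection of all sets of roots that contain [c] and split off
    orthogonally. A subset that splits off from it either contains [c], hence everything, or its
    complement does, and then the subset is empty. *)
Lemma component_exists c : c \in R0 ->
  exists2 C, @irreducible_component D C & C c.
Proof.
move=> cR; pose split (E : set X) :=
  [/\ E `<=` [set` R0], orthogonal_split E ([set` R0] `\` E) & E c].
pose C := [set a | forall E, split E -> E a].
have sR : split [set` R0] by split => // a b _ [].
have CR : C `<=` [set` R0] by move=> a /(_ _ sR).
have Csplit : orthogonal_split C ([set` R0] `\` C).
  move=> a b Ca [bR nCb]; apply: contrapT => nab; apply: nCb => E sE.
  apply: contrapT => nEb; apply: nab; have [_ EO _] := sE.
  exact: EO (Ca _ sE) (conj bR nEb).
exists C; last by move=> E [].
split => //; first by exists c => E [].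
move=> E EC E0 EO; apply/seteqP; split => // a Ca.
have EsplitR : orthogonal_split E ([set` R0] `\` E).
  move=> x y Ex [yR nEy]; have [Cy|nCy] := pselect (C y); first exact: EO.
  exact: Csplit (EC _ Ex) (conj yR nCy).
have CEsplit : orthogonal_split (C `\` E) ([set` R0] `\` (C `\` E)).
  move=> x y [Cx nEx] [yR nCEy]; have [Ey|nEy] := pselect (E y).
    by have [] := EO _ _ Ey (conj Cx nEx).
  by apply: Csplit => //; split => // Cy; apply: nCEy.
have [Ec|nEc] := pselect (E c).
  by apply: Ca; split => // x /EC /CR.
have [x Ex] := E0; have Cx := EC _ Ex.
have [] // := Cx (C `\` E) _; split => //; first by move=> y [/CR].
by split => // F [].
Qed.

Section Component.
Context (C : set X) (irrC : @irreducible_component D C).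

Lemma component_root a : C a -> a \in R0.
Proof. by case: irrC => CR _ _ _ /CR. Qed.

Lemma component_refl d a : d \in R0 -> C a -> C (refl d a).
Proof.
case: irrC => CR _ CO _ dR Ca; apply: contrapT => nC.
have ad : pairing a (coroot d) = 0; last by apply: nC; rewrite /refl ad mulr0z subr0.
have [Cd|nCd] := pselect (C d); last by have [] := CO _ _ Ca (conj dR nCd).
have [_] := CO _ _ Cd (conj (refl_root dR (CR _ Ca)) nC).
by rewrite /refl pairingBl pairingMzl pairing_coroot //; lia.
Qed.

Lemma componentN a : C a -> C (- a).
Proof.
move=> Ca; have aR := component_root Ca; rewrite -(refl_id aR).
exact: component_refl.
Qed.
End Component.

(** These are the values needed to see that the affine reflection of [t] changes the sign of a
    single positive affine root. The bounds on the pairing come from comparing [coroot t] with the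
    coroots of [refl t c] and of its negative. *)
Lemma highest_coroot_spec t : highest_coroot t ->
  [/\ t \in R0, pos_root t & forall c, pos_root c -> c != t ->
    (pairing c (coroot t) = 0 /\ pairing t (coroot c) = 0) \/
    (pairing t (coroot c) = 1 /\ pos_root (refl t c) = false)].
Proof.
move=> [C [irrC Ct tmax]]; have tR := component_root irrC Ct.
have tP : pos_root t.
  have := height_cone_ge0 (tmax _ (componentN irrC Ct)).
  by rewrite corootN // opprK heightD pos_rootP //; have := height_neq0 tR; lia.
split => // c cP ct; have cR := pos_root_sub cP; case: (irrC) => CR _ CO _.
have [Cc|nCc] := pselect (C c); last by left; have [] := CO _ _ Ct (conj cR nCc).
set m := pairing t (coroot c).
have Cd := component_refl irrC tR Cc.
have dE : coroot (refl t c) = coroot c - coroot t *~ m by rewrite coroot_refl.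
have [m0|m0] := eqVneq m 0; first by left; rewrite (pairing_eq0C tR cR m0).
have ht := height_pos tP; have hc := height_pos cP.
right; have mle1 : m <= 1.
  rewrite leNgt; apply/negP => m2.
  (* Comparison with the coroot of [- refl t c] puts [coroot t + coroot c - m coroot t] in the cone;
     adding [m - 2] times [coroot t] leaves [coroot c - coroot t]. As its negative is in the cone
     too, [c = t]. *)
  have c1 : coroot_cone (coroot c - coroot t).
    have := tmax _ (componentN irrC Cd); rewrite corootN ?refl_root // dE opprK.
    move=> /coroot_coneD /(_ (coroot_coneMn (absz (m - 2)) (pos_coroot_cone tP))).
    congr coroot_cone; rewrite pmulrn gez0_abs ?subr_ge0 // mulrzBr.
    set M := coroot t *~ m; set z := coroot t; set w := coroot c.
    rewrite -[z *~ _]/(z + z).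
    by rewrite [z + _]addrA [LHS]addrA subrK opprD addrA [z + w]addrC addrK.
  have c2 := tmax _ Cc; have := height_cone_eq0 c1.
  have := height_cone_ge0 c2; rewrite !heightB => h1 h2.
  have /eqP := h2 ltac:(lia); rewrite subr_eq0 => /eqP /(coroot_inj cR tR) ct'.
  by rewrite ct' eqxx in ct.
have m1 : m = 1.
  have := height_cone_ge0 (tmax _ Cd); rewrite dE !heightB heightMz; nia.
split => //; apply/negbTE; rewrite pos_rootP ?refl_root // dE heightB heightMz m1 -leNgt.
by have := height_cone_ge0 (tmax _ Cc); rewrite heightB; lia.
Qed.

Lemma pairing_simple_le0 b g : b \in S0 -> g \in S0 -> b != g ->
  pairing b (coroot g) <= 0.
Proof.
move=> bS gS bg; have := pos_refl_simple gS (simple_pos bS) bg.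
move=> /andP[_ /asboolP[m sm]].
have /simple_comb_inj mn : \sum_(c <- S0) c *~ (m c)%:Z =
    \sum_(c <- S0) c *~ ((c == b)%:Z - (c == g)%:Z * pairing b (coroot g)).
  rewrite -[LHS]sm /refl; under [RHS]eq_bigr do rewrite mulrzBr.
  rewrite sumrB; congr (_ - _).
    by rewrite (bigD1_seq b) ?fset_uniq //= eqxx big1 ?addr0 // => c /negbTE ->.
  rewrite (bigD1_seq g) ?fset_uniq //= eqxx mul1r big1 ?addr0 // => c /negbTE ->.
  by rewrite mul0r mulr0z.
by have := mn g gS; rewrite eqxx eq_sym (negbTE bg); lia.
Qed.

Definition coroot_cone_on (T : pred X) (v : Y) : Prop :=
  exists m : X -> nat, v = \sum_(g <- S0 | T g) coroot g *+ m g.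

Lemma coroot_cone_onD T u v :
  coroot_cone_on T u -> coroot_cone_on T v -> coroot_cone_on T (u + v).
Proof.
move=> [m ->] [n ->]; exists (fun g => (m g + n g)%N).
by rewrite -big_split /=; apply: eq_bigr => g _; rewrite mulrnDr.
Qed.

Lemma coroot_cone_on_simple (T : pred X) b n :
  b \in S0 -> T b -> coroot_cone_on T (coroot b *+ n).
Proof.
move=> bS Tb; exists (fun c => (c == b) * n)%N.
rewrite -big_filter (bigD1_seq b) ?filter_uniq ?fset_uniq ?mem_filter ?Tb //= eqxx mul1n.
by rewrite big1 ?addr0 // => c /negbTE ->; rewrite mul0n mulr0n.
Qed.

Lemma pairing_cone_on0 (T : pred X) x v : coroot_cone_on T v ->
  (forall g, g \in S0 -> T g -> pairing x (coroot g) = 0) -> pairing x v = 0.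
Proof.
move=> [m ->] H; rewrite pairing_sumr big_seq_cond big1 // => g /andP[gS Tg].
by rewrite pairingMnr H // mul0rn.
Qed.

(** In the induction, [b] has nonzero pairing with the coroot of [refl b a], so it cannot lie in the
    part orthogonal to the support of that coroot. *)
Lemma pos_coroot_cone_on (T : pred X) :
  {in S0 &, forall b g, T b != T g -> pairing b (coroot g) = 0} ->
  forall a, pos_root a ->
    coroot_cone_on T (coroot a) \/ coroot_cone_on (predC T) (coroot a).
Proof.
move=> TO a; elim/pos_root_ind => [b bS|{}a b bS aP sP ba IH].
  rewrite -[coroot b]mulr1n; case: (boolP (T b)) => Tb; [left|right].
    exact: coroot_cone_on_simple.
  exact: coroot_cone_on_simple.
have spair : pairing b (coroot (refl b a)) = - pairing b (coroot a).
  have bR := simple_sub bS; rewrite pairing_reflr ?(pos_root_sub aP) //.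
  by rewrite refl_id // pairingNl.
have bn : coroot b *~ pairing b (coroot a) = coroot b *+ absz (pairing b (coroot a)).
  by rewrite pmulrn gez0_abs // ltW.
rewrite (coroot_step bS aP) bn.
case: (boolP (T b)) => Tb; case: IH => IH.
- by left; apply: coroot_cone_onD => //; exact: coroot_cone_on_simple.
- have := pairing_cone_on0 (x := b) IH; rewrite spair => H.
  suff : - pairing b (coroot a) = 0 by lia.
  by apply: H => g gS Tg; apply: TO => //; move: Tg => /= /negbTE ->; rewrite Tb.
- have := pairing_cone_on0 (x := b) IH; rewrite spair => H.
  suff : - pairing b (coroot a) = 0 by lia.
  by apply: H => g gS Tg; apply: TO => //; rewrite Tg; move: Tb => /negbTE ->.
by right; apply: coroot_cone_onD => //; exact: coroot_cone_on_simple.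
Qed.
End HighestCoroot.

Section HighestCorootExists.
Context (D : based_root_datum).
Local Notation X := (lat D).
Local Notation Y := (colat D).
Local Notation R0 := (roots D).
Local Notation S0 := (simple D).
Implicit Types (x y : X) (a b c d e t : X) (k : int).

Definition dominant e : Prop := {in S0, forall b, 0 <= pairing b (coroot e)}.

Lemma dominant_pairing_ge0 e a : dominant e -> pos_root a -> 0 <= pairing a (coroot e).
Proof.
move=> eD /andP[_ /asboolP[m ->]]; rewrite pairing_suml big_seq sumr_ge0 // => b bS.
by rewrite pairingMnl mulrn_wge0 ?eD.
Qed.

Lemma dominant_pairing_simple_ge0 e b : e \in R0 -> dominant e -> b \in S0 ->
  0 <= pairing e (coroot b).
Proof.
move=> eR eD bS; have bR := simple_sub bS.
have := eD b bS; have := coroot_cartan e bR; have := coroot_cartan b eR.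
have := root_form_gt0 eR; have := root_form_gt0 bR; rewrite (root_formC b e); nia.
Qed.

Section Maximal.
Context (C : set X) (irrC : @irreducible_component D C) (t : X) (Ct : C t).
Context (tmax : forall d, C d -> height (coroot d) <= height (coroot t)).

Lemma maximal_pos : pos_root t.
Proof.
have tR := component_root irrC Ct; rewrite pos_rootP // lt_def height_neq0 //=.
have := tmax (componentN irrC Ct); rewrite corootN // /height pairingNr; lia.
Qed.

Lemma maximal_dominant : dominant t.
Proof.
move=> b bS; have bR := simple_sub bS; have tR := component_root irrC Ct.
have := tmax (component_refl irrC bR Ct).
by rewrite coroot_refl // heightB /height pairingMzr (pairing_rho2_simple bS); lia.
Qed.

(** If the pairing were positive, the bound on the heights of reflected coroots would leave only the
    values 1 and 2 for it and for its transpose. A value 1 puts [e] below [t] or produces a coroot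
    of height 0; the value 2 in both directions is the equality case of Cauchy-Schwarz and gives
    [t = e]. *)
Lemma dominant_pairing_maximal e : C e -> pos_root e ->
  ~ coroot_cone (coroot t - coroot e) -> pairing t (coroot e) <= 0.
Proof.
move=> Ce eP net; rewrite leNgt; apply/negP => te.
have tP := maximal_pos; have tR := component_root irrC Ct.
have eR := component_root irrC Ce; have et := pairing_gt0C tR eR te.
(* The coroots of [refl b a] and of its negative both have height at most that of [coroot t]. *)
have bnd a b : C a -> C b -> `|height (coroot a) - pairing b (coroot a) * height (coroot b)|
    <= height (coroot t).
  move=> Ca Cb; have aR := component_root irrC Ca; have bR := component_root irrC Cb.
  have Cr := component_refl irrC bR Ca.
  have := tmax (componentN irrC Cr); have := tmax Cr.
  rewrite corootN ?refl_root // coroot_refl // heightN.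
  by rewrite heightB heightMz; lia.
have b1 := bnd _ _ Ce Ct; have b2 := bnd _ _ Ct Ce.
have ht := height_pos tP; have he := height_pos eP; have hte := tmax Ce.
have m1 : pairing t (coroot e) != 1.
  apply/eqP => m1.
  have dE : coroot (refl t e) = coroot e - coroot t by rewrite coroot_refl // m1.
  have dR := refl_root tR eR; have hd : height (coroot (refl t e)) <= 0.
    by rewrite dE heightB; lia.
  apply: net; have : pos_root (- refl t e) by rewrite -nposE // pos_rootP // -leNgt.
  by move=> /pos_coroot_cone; rewrite corootN // dE opprB.
have twice (k h : int) : 0 < h -> 0 < k -> k != 1 -> k * h <= 2 * h -> k = 2.
  move=> h0 k0 k1; rewrite ler_pM2r //; lia.
have m2 : pairing t (coroot e) = 2.
  by apply: (twice _ (height (coroot t))) => //; lia.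
have hE : height (coroot e) = height (coroot t) by move: b1; rewrite m2; lia.
have n1 : pairing e (coroot t) != 1.
  apply/eqP => n1; have dR := refl_root eR tR; have := height_neq0 dR.
  by rewrite coroot_refl // n1 heightB hE subrr eqxx.
have n2 : pairing e (coroot t) = 2.
  by apply: (twice _ (height (coroot t))) => //; move: b2; rewrite hE; lia.
have := coroot_cartan e tR; have := coroot_cartan t eR.
rewrite n2 m2 (root_formC t e) => f1 f2.
have f0 : root_form (t - e) (t - e) = 0.
  rewrite (_ : root_form _ _ = root_form t t - 2 * root_form e t + root_form e e); first by lia.
  rewrite /root_form mulr_sumr -sumrB -big_split /=; apply: eq_bigr => c _.
  by rewrite !pairingBl; ring.
apply: net; rewrite (_ : t = e) ?subrr; first exact: coroot_cone0.
apply: coroot_eq => // c cR.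
have := coroot_cartan c tR; have := coroot_cartan c eR.
have -> : root_form c t = root_form c e.
  apply: eq_big_seq => d dR; congr (_ * _); apply/eqP; rewrite -subr_eq0 -pairingBl.
  by rewrite (root_form_eq0 f0).
by have := root_form_gt0 eR; nia.
Qed.

(** A counterexample [e] of maximal height is dominant, hence orthogonal to [t], hence to every
    simple root in the support of [coroot t]. As [t] is dominant too, that support is orthogonal to
    the remaining simple roots, so by irreducibility it carries the whole component. Then [e] would
    be orthogonal to itself. *)
Lemma maximal_highest d : C d -> coroot_cone (coroot t - coroot d).
Proof.
move=> Cd; apply: contrapT => nd.
pose B := [seq c <- R0 | `[< C c /\ ~ coroot_cone (coroot t - coroot c) >]].
have dB : d \in B.
  by rewrite mem_filter (component_root irrC Cd) andbT; apply/asboolP.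
have [e] := @seq_argmax _ (fun c => height (coroot c)) _ _ dB.
rewrite mem_filter => /andP[/asboolP[Ce ne] eR] emax.
have tP := maximal_pos; have tR := component_root irrC Ct.
have eP : pos_root e.
  apply: contrapT => /negP; rewrite nposE // => /pos_coroot_cone; rewrite corootN //.
  by move=> /(coroot_coneD (pos_coroot_cone tP)).
(* If [b] pairs negatively, reflecting in [b] raises the height, so [refl b e] is no counterexample;
   then neither is [e], whose coroot is smaller by a multiple of [coroot b]. *)
have eD : dominant e.
  move=> b bS; rewrite leNgt; apply/negP => be; have bR := simple_sub bS.
  set p := pairing _ _ in be.
  have Cr := component_refl irrC bR Ce.
  have rE : coroot (refl b e) = coroot e + coroot b *+ absz p.
    rewrite coroot_refl // -mulrNz; congr (_ + _); rewrite pmulrn; congr (_ *~ _).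
    by rewrite -/p; lia.
  have [rcone|nr] := pselect (coroot_cone (coroot t - coroot (refl b e))).
    apply: ne; have := coroot_coneD rcone (coroot_coneMn (absz p) (coroot_cone_simple bS)).
    by rewrite rE opprD addrA subrK.
  have : refl b e \in B.
    by rewrite mem_filter (component_root irrC Cr) andbT; apply/asboolP.
  move=> /emax; rewrite rE heightD heightMn [height (coroot b)]pairing_rho2_simple //.
  by lia.
have tD := maximal_dominant.
have te : pairing t (coroot e) = 0.
  by apply/eqP; rewrite eq_le dominant_pairing_maximal // dominant_pairing_ge0.
have et := pairing_eq0C tR eR te.
have [m tm] := pos_coroot_cone tP.
pose T : pred X := fun g => (0 < m g)%N.
have e0 g : g \in S0 -> T g -> pairing e (coroot g) = 0.
  move=> gS mg; move: et; rewrite tm pairing_sumr => /eqP.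
  rewrite big_seq psumr_eq0 => [|b bS]; last first.
    by rewrite pairingMnr mulrn_wge0 ?dominant_pairing_simple_ge0.
  move=> /allP /(_ g gS); rewrite gS pairingMnr /= mulrn_eq0.
  by move: mg; rewrite /T; case: (m g) => //= n _ /eqP.
have TO' b g : b \in S0 -> g \in S0 -> ~~ T b -> T g -> pairing b (coroot g) = 0.
  move=> bS gS nTb Tg; have neq c : T c -> b != c.
    by move=> Tc; apply: contraNneq nTb => ->.
  have bt : \sum_(c <- S0) pairing b (coroot c *+ m c) <= 0.
    rewrite big_seq sumr_le0 // => c cS; rewrite pairingMnr.
    have [->|mc] := posnP (m c); first by rewrite mulr0n.
    by rewrite mulrn_wle0 ?pairing_simple_le0 ?neq.
  have /eqP : - \sum_(c <- S0) pairing b (coroot c *+ m c) = 0.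
    by have := tD b bS; rewrite tm pairing_sumr; lia.
  rewrite -sumrN big_seq psumr_eq0 => [|c cS]; last first.
    rewrite oppr_ge0 pairingMnr; have [->|mc] := posnP (m c); first by rewrite mulr0n.
    by rewrite mulrn_wle0 ?pairing_simple_le0 ?neq.
  move=> /allP /(_ g gS); rewrite gS pairingMnr /= oppr_eq0 mulrn_eq0.
  by move: Tg; rewrite /T; case: (m g) => //= n _ /eqP.
have TO : {in S0 &, forall b g, T b != T g -> pairing b (coroot g) = 0}.
  move=> b g bS gS; case: (boolP (T b)) => Tb; case: (boolP (T g)) => Tg //= _.
    by apply: pairing_eq0C; rewrite ?simple_sub ?TO'.
  exact: TO'.
pose on (U : pred X) a := coroot_cone_on U (coroot a) \/ coroot_cone_on U (coroot (- a)).
have on_or a : a \in R0 -> on T a \/ on (predC T) a.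
  move=> aR; case: (boolP (pos_root a)) => [/(pos_coroot_cone_on TO)[]|].
  - by left; left.
  - by right; left.
  by rewrite nposE // => /(pos_coroot_cone_on TO)[]; [left; right|right; right].
have on0 (U : pred X) x a : a \in R0 -> on U a ->
    (forall g, g \in S0 -> U g -> pairing x (coroot g) = 0) -> pairing x (coroot a) = 0.
  move=> aR [] /pairing_cone_on0 H /H //.
  by rewrite corootN // pairingNr => /eqP; rewrite oppr_eq0 => /eqP.
pose E := [set a | C a /\ on T a].
have EC : E = C.
  have [_ _ _] := irrC; apply; first by move=> a [].
    exists t; split => //; left; exists m.
    rewrite tm (bigID T) /= [X in _ + X]big1 ?addr0 // => g.
    by rewrite /T lt0n negbK => /eqP ->; rewrite mulr0n.
  move=> a b [Ca onTa] [Cb nEb]; have aR := component_root irrC Ca.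
  have bR := component_root irrC Cb.
  have onTb : on (predC T) b by case: (on_or b bR) => // onTb; case: nEb; split.
  have ab : pairing a (coroot b) = 0; last by split => //; exact: pairing_eq0C.
  apply: (on0 _ _ _ bR onTb) => // g gS nTg; apply: pairing_eq0C => //; first exact: simple_sub.
  by apply: (on0 _ _ _ aR onTa) => b' b'S Tb'; exact: TO'.
have [_ onTe] : E e by rewrite EC.
by have := on0 _ e _ eR onTe e0; rewrite pairing_coroot.
Qed.
End Maximal.

Lemma highest_coroot_exists c : c \in R0 ->
  exists2 t, highest_coroot t & coroot_cone (coroot t - coroot c).
Proof.
move=> cR; have [C irrC Cc] := component_exists cR.
have cC : c \in [seq a <- R0 | `[< C a >]] by rewrite mem_filter cR andbT; apply/asboolP.
have [t] := @seq_argmax _ (fun a => height (coroot a)) _ _ cC.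
rewrite mem_filter => /andP[/asboolP Ct tR] tmax.
have tmax' d : C d -> height (coroot d) <= height (coroot t).
  move=> Cd; apply: tmax; rewrite mem_filter (component_root irrC Cd) andbT.
  exact/asboolP.
have H d := maximal_highest irrC Ct tmax' (d := d).
by exists t; [exists C|exact: H].
Qed.
End HighestCorootExists.

(** * The affine Weyl group *)

Section AffineWeyl.
Context (D : based_root_datum).
Local Notation X := (lat D).
Local Notation R0 := (roots D).
Local Notation S0 := (simple D).
Local Notation W := (weyl D).
Local Notation "u *w v" := (w_mul u v) (at level 40, left associativity).
Local Notation one := (w_one D).
Implicit Types (x y z : X) (a b c d t : X) (k : int) (u v w s : W).

Lemma weyl_eq u v : w_tr u = w_tr v -> w_lin u =1 w_lin v -> u = v.
Proof.
case: u v => [t u] [t' v] /= -> uv; congr Weyl; apply: finite_weyl_eq.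
exact/funext.
Qed.

Lemma w_mulA u v w : u *w (v *w w) = u *w v *w w.
Proof. by apply: weyl_eq => //=; rewrite fw_additive addrA. Qed.

Lemma w_mul1 w : one *w w = w.
Proof. by apply: weyl_eq => //=; rewrite add0r. Qed.

Lemma w_mulr1 w : w *w one = w.
Proof. by apply: weyl_eq => //=; rewrite fw0 addr0. Qed.

Lemma refl_generated_inv (g g' : X -> X) : refl_generated g ->
  cancel g g' -> cancel g' g -> refl_generated g'.
Proof.
move=> gG; elim: gG g' => [|a h aR hG IH] g' gK g'K.
  by rewrite (_ : g' = id); [exact: refl_generated_id|apply/funext => x; exact: gK].
have hG' : refl_generated (g' \o refl a).
  apply: IH => x /=; first exact: gK.
  by apply: (can_inj (reflK aR)); exact: g'K.
rewrite (_ : g' = (g' \o refl a) \o (refl a \o id)).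
  exact/refl_generated_mul/refl_generated_comp/refl_generated_id.
by apply/funext => x /=; rewrite reflK.
Qed.

Definition fw_inverse (g : finite_weyl D) : finite_weyl D :=
  FiniteWeyl (refl_generated_inv (fw_gen g) (fw_funK g) (fw_invK g))
    (fw_invK g) (fw_funK g).

Definition w_inv w : W :=
  Weyl (- fw_inv (w_lin w) (w_tr w)) (fw_inverse (w_lin w)).

Lemma w_mulV w : w_inv w *w w = one.
Proof. by apply: weyl_eq => [|x] /=; rewrite ?addNr ?fw_funK. Qed.

Lemma w_mulVr w : w *w w_inv w = one.
Proof. by apply: weyl_eq => [|x] /=; rewrite ?fwN ?fw_invK ?subrr. Qed.

Lemma w_mulKV v w : w_inv v *w (v *w w) = w.
Proof. by rewrite w_mulA w_mulV w_mul1. Qed.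

Lemma w_mulVK v w : v *w (w_inv v *w w) = w.
Proof. by rewrite w_mulA w_mulVr w_mul1. Qed.

Lemma w_mulI u : injective (w_mul u).
Proof. exact: can_inj (w_mulKV u). Qed.

Lemma w_invM u v : w_inv (u *w v) = w_inv v *w w_inv u.
Proof.
by apply: (@w_mulI (u *w v)); rewrite w_mulVr -w_mulA w_mulVK w_mulVr.
Qed.

Lemma w_invK : involutive w_inv.
Proof. by move=> w; apply: (@w_mulI (w_inv w)); rewrite w_mulVr w_mulV. Qed.

Definition fw_refl a (aR : a \in R0) : finite_weyl D :=
  FiniteWeyl (refl_generated_comp aR (@refl_generated_id D)) (reflK aR) (reflK aR).

Definition depth c : int := (~~ pos_root c)%:Z.

(* The affine root [x |-> <x, c^v> + k] is positive if [depth c <= k], and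
   [w_shift w c] is the number of positive affine roots with gradient [c] that [w]
   makes negative, if it is nonnegative. *)
Definition w_shift w c : int :=
  pairing (w_tr w) (coroot (w_lin w c)) + depth (w_lin w c) - depth c.

Lemma depthN c : c \in R0 -> depth (- c) = 1 - depth c.
Proof.
by move=> cR; rewrite /depth -nposE //; case: (pos_root c).
Qed.

(** A cocycle identity; through it, lengths of products are compared gradient by gradient. *)
Lemma w_shiftM u v c : c \in R0 ->
  w_shift (u *w v) c = w_shift v c + w_shift u (w_lin v c).
Proof.
move=> cR; rewrite /w_shift /= pairingDl fw_pairing ?fw_root //; ring.
Qed.

Lemma w_shiftN w c : c \in R0 -> w_shift w (- c) = - w_shift w c.
Proof.
move=> cR; rewrite /w_shift fwN corootN ?fw_root // pairingNr !depthN ?fw_root //; ring.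
Qed.

Lemma w_shift1 c : w_shift one c = 0.
Proof. by rewrite /w_shift pairing0l add0r subrr. Qed.

Lemma big_roots_fw (V : nmodType) (g : finite_weyl D) (F : X -> V) :
  \sum_(c <- R0) F (g c) = \sum_(c <- R0) F c.
Proof.
have gR : perm_eq (map g R0) R0.
  apply: perm_map_inj; rewrite ?fset_uniq //.
    by move=> x y _ _; exact: (can_inj (fw_funK g)).
  by move=> c cR; rewrite /= fw_root.
by rewrite -[RHS](perm_big _ gR) big_map.
Qed.

Lemma big_rootsN (V : nmodType) (F : X -> V) (P : pred X) :
  \sum_(c <- R0 | P (- c)) F (- c) = \sum_(c <- R0 | P c) F c.
Proof.
have gR : perm_eq (map -%R R0) R0.
  apply: perm_map_inj; rewrite ?fset_uniq //; first by move=> x y _ _; exact: oppr_inj.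
  by move=> c cR; rewrite /= oppr_root.
by rewrite -[RHS](perm_big _ gR) big_map.
Qed.

Lemma lenE w : (len w)%:Z = \sum_(c <- R0 | pos_root c) `|w_shift w c|.
Proof.
have tr a : a \in R0 -> pairing (fw_inv (w_lin w) (w_tr w)) (coroot a) =
    pairing (w_tr w) (coroot (w_lin w a)).
  by move=> aR; rewrite -[in RHS](fw_invK (w_lin w) (w_tr w)) fw_pairing.
rewrite /len PoszD !(big_morph Posz PoszD (erefl _)) /= addrC.
rewrite [RHS](bigID (fun c => pos_root (w_lin w c))) /=; congr (_ + _).
  rewrite big_seq_cond [RHS]big_seq_cond; apply: eq_bigr => c /andP[cR /andP[cP wP]].
  by rewrite abszE tr // /w_shift /depth cP wP subr0 addr0.
rewrite big_seq_cond [RHS]big_seq_cond; apply: eq_big => [c|c].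
  by apply: andb_id2l => cR; rewrite neg_rootE nposE // fw_root.
move=> /andP[cR /andP[cP wP]]; rewrite neg_rootE -nposE ?fw_root // in wP.
by rewrite abszE tr // /w_shift /depth cP wP subr0.
Qed.

(** Summing over all roots instead of the positive ones allows reindexing by elements of the finite
    Weyl group, which do not preserve positivity. *)
Lemma len_double w : 2 * (len w)%:Z = \sum_(c <- R0) `|w_shift w c|.
Proof.
rewrite [RHS](bigID (@pos_root D)) /= -lenE mulrDl mul1r; congr (_ + _).
rewrite lenE -(big_rootsN (fun c => `|w_shift w c|)) big_seq_cond [RHS]big_seq_cond.
apply: eq_big => [c|c /andP[cR _]]; last by rewrite w_shiftN // normrN.
by apply: andb_id2l => cR; rewrite nposE.
Qed.

Lemma len_inv w : len (w_inv w) = len w.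
Proof.
suff : 2 * (len (w_inv w))%:Z = 2 * (len w)%:Z by lia.
rewrite !len_double -(big_roots_fw (w_lin w)); apply: eq_big_seq => c cR.
have := w_shiftM (w_inv w) w cR; rewrite w_mulV w_shift1 => /esym/eqP.
by rewrite addrC addr_eq0 => /eqP ->; rewrite normrN.
Qed.

Lemma len_mul_le u v : (len (u *w v) <= len u + len v)%N.
Proof.
suff : 2 * (len (u *w v))%:Z <= 2 * (len u)%:Z + 2 * (len v)%:Z by lia.
rewrite !len_double -(big_roots_fw (w_lin v) (fun c => `|w_shift u c|)) -big_split /=.
rewrite big_seq [leRHS]big_seq; apply: ler_sum => c cR.
by rewrite w_shiftM // addrC ler_normD.
Qed.

Lemma w_shift_len0 w c : len w = 0%N -> c \in R0 -> w_shift w c = 0.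
Proof.
move=> w0 cR; have := len_double w; rewrite w0 mulr0 => /esym/eqP.
by rewrite psumr_eq0 // => /allP /(_ _ cR); rewrite /= normr_eq0 => /eqP.
Qed.

Lemma len1 : len one = 0%N.
Proof. by apply/eqP; rewrite -(eqr_nat int) natz lenE big1 // => c _; rewrite w_shift1. Qed.

Lemma len_mul0l u v : len u = 0%N -> len (u *w v) = len v.
Proof.
move=> u0; suff : 2 * (len (u *w v))%:Z = 2 * (len v)%:Z by lia.
rewrite !len_double; apply: eq_big_seq => c cR.
by rewrite w_shiftM // (w_shift_len0 u0) ?fw_root // addr0.
Qed.

Lemma len_mul0r u v : len v = 0%N -> len (u *w v) = len u.
Proof.
by move=> v0; rewrite -len_inv w_invM len_mul0l len_inv.
Qed.
End AffineWeyl.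

(** * Simple affine reflections and the change of length *)

Section SimpleAffine.
Context (D : based_root_datum).
Local Notation X := (lat D).
Local Notation R0 := (roots D).
Local Notation S0 := (simple D).
Local Notation W := (weyl D).
Local Notation "u *w v" := (w_mul u v) (at level 40, left associativity).
Local Notation one := (w_one D).
Implicit Types (x y z : X) (a b c d t : X) (k : int) (u v w s : W).

(* [a] is the gradient of the simple affine root of the simple reflection [s]. *)
Definition is_gradient s a : Prop :=
  [/\ a \in R0, (w_lin s : X -> X) = refl a, w_tr s = - a *~ depth a, s *w s = one &
      forall c, c \in R0 -> w_shift s c = (c == a)%:Z - (c == - a)%:Z].

Lemma refl_opp a : a \in R0 -> refl (- a) = refl a.
Proof.
by move=> aR; apply/funext => x; rewrite /refl corootN // pairingNr mulrNz mulNrz opprK.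
Qed.

Lemma root_oppr_neq a : a \in R0 -> (a == - a) = false.
Proof.
move=> aR; apply/negbTE/eqP => aN; have := pairing_coroot aR.
by have := pairingNl a (coroot a); rewrite -aN; lia.
Qed.

Lemma simple_gradient s b : b \in S0 -> w_tr s = 0 ->
  (w_lin s : X -> X) = refl b -> is_gradient s b.
Proof.
move=> bS st sl; have bR := simple_sub bS; split => //.
    by rewrite /depth simple_pos // mulr0z.
  apply: weyl_eq => [|x] /=; first by rewrite st fw0 addr0.
  by rewrite sl reflK.
have shift_pos c : pos_root c -> w_shift s c = (c == b)%:Z.
  move=> cP; rewrite /w_shift st pairing0l add0r sl /depth cP subr0.
  have [->|cb] := eqVneq c b; last by rewrite pos_refl_simple.
  by rewrite refl_id // pos_rootN // simple_pos.
move=> c cR; case: (boolP (pos_root c)) => cP.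
  rewrite shift_pos //; case: (c =P - b) => [cb|]; last by rewrite subr0.
  by have := pos_rootN (simple_pos bS); rewrite -cb cP.
rewrite nposE // in cP; rewrite -[c in LHS]opprK w_shiftN ?oppr_root // shift_pos //.
rewrite eqr_oppLR; case: (c =P b) => [cb|]; last by rewrite sub0r.
by have := pos_rootN (simple_pos bS); rewrite -cb cP.
Qed.

(** The mirror is [<x, t^v> = 1] and the simple affine root is [1 - <x, t^v>], whence the gradient
    [- t]. [highest_coroot_spec] excludes any other change of sign. *)
Lemma highest_gradient s t : highest_coroot t -> w_tr s = t ->
  (w_lin s : X -> X) = refl t -> is_gradient s (- t).
Proof.
move=> tH st sl; have [tR tP tmax] := highest_coroot_spec tH; split.
- by rewrite oppr_root.
- by rewrite refl_opp.
- by rewrite opprK depthN // /depth tP subr0.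
- apply: weyl_eq => [|x] /=; first by rewrite sl st refl_id // subrr.
  by rewrite sl reflK.
have shift_pos c : pos_root c -> w_shift s c = - (c == t)%:Z.
  move=> cP; have cR := pos_root_sub cP.
  rewrite /w_shift st sl pairing_reflr // refl_id // pairingNl /depth cP subr0.
  have [->|ct] := eqVneq c t.
    by rewrite pairing_coroot // refl_id // pos_rootN.
  have [[c0 t0]|[t1 ->]] := tmax c cP ct; last by rewrite t1.
  by rewrite t0 /refl c0 mulr0z subr0 cP.
move=> c cR; rewrite opprK; case: (boolP (pos_root c)) => cP.
  rewrite shift_pos //; case: (c =P - t) => [ct|]; last by rewrite sub0r.
  by have := pos_rootN tP; rewrite -ct cP.
rewrite nposE // in cP; rewrite -[c in LHS]opprK w_shiftN ?oppr_root // shift_pos //.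
rewrite eqr_oppLR opprK; case: (c =P t) => [ct|]; last by rewrite subr0.
by have := pos_rootN tP; rewrite -ct cP.
Qed.

Lemma Saff_gradient s : Saff s -> exists a, is_gradient s a.
Proof.
move=> [[b bS [st sl]]|[t tH [st sl]]]; first by exists b; exact: simple_gradient.
by exists (- t); exact: highest_gradient.
Qed.

Lemma Saff_invol s : Saff s -> s *w s = one.
Proof. by move=> /Saff_gradient[a [? ? ? ss _]]. Qed.

Lemma Saff_mulK s w : Saff s -> s *w (s *w w) = w.
Proof. by move=> sS; rewrite w_mulA Saff_invol // w_mul1. Qed.

Lemma Saff_mulrK s w : Saff s -> w *w s *w s = w.
Proof. by move=> sS; rewrite -w_mulA Saff_invol // w_mulr1. Qed.

Lemma Saff_inv s : Saff s -> w_inv s = s.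
Proof. by move=> sS; apply: (@w_mulI _ s); rewrite w_mulVr Saff_invol. Qed.

Lemma sum_abs_perturb (F : X -> int) b : b \in R0 -> {in R0, forall c, F (- c) = - F c} ->
  \sum_(c <- R0) `|F c + ((c == b)%:Z - (c == - b)%:Z)| =
  \sum_(c <- R0) `|F c| + 2 * (`|F b + 1| - `|F b|).
Proof.
move=> bR FN; have bN := root_oppr_neq bR; pose d : int := `|F b + 1| - `|F b|.
have sum_at e : e \in R0 -> \sum_(c <- R0) (c == e)%:Z * d = d.
  move=> eR; rewrite (bigD1_seq e) ?fset_uniq //= eqxx mul1r big1 ?addr0 // => c /negbTE ->.
  by rewrite mul0r.
transitivity (\sum_(c <- R0) (`|F c| + ((c == b)%:Z * d + (c == - b)%:Z * d))).
  apply: eq_big_seq => c cR; rewrite /d; case: (eqVneq c b) => [->|cb]; first by rewrite bN; lia.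
  by case: (eqVneq c (- b)) => [->|cb']; rewrite ?FN //; lia.
by rewrite !big_split /= !sum_at ?oppr_root // -/d mulrDl mul1r.
Qed.

(** Multiplying by [s] changes [w_shift] by 1 at [b], the preimage of [a] under the linear part of
    [w], by the opposite at [- b], and nowhere else. *)
Lemma len_simple_l s a w : is_gradient s a ->
  if 0 <= w_shift w (fw_inv (w_lin w) a) then len (s *w w) = (len w).+1
  else len w = (len (s *w w)).+1.
Proof.
move=> [aR _ _ _ sa]; set b := fw_inv _ a.
have bR : b \in R0 by rewrite -(fw_root (w_lin w)) fw_invK.
have : 2 * (len (s *w w))%:Z = 2 * (len w)%:Z + 2 * (`|w_shift w b + 1| - `|w_shift w b|).
  rewrite !len_double -sum_abs_perturb //; last by move=> c cR; exact: w_shiftN.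
  apply: eq_big_seq => c cR; rewrite w_shiftM // sa ?fw_root //.
  have aE : a = w_lin w b by rewrite fw_invK.
  by rewrite aE -fwN !(inj_eq (can_inj (fw_funK _))).
by case: ifP; lia.
Qed.

Lemma len_simple_r s a w : is_gradient s a -> Saff s ->
  if w_shift w a <= 0 then len (w *w s) = (len w).+1
  else len w = (len (w *w s)).+1.
Proof.
move=> sa sS; have := len_simple_l (w_inv w) sa.
rewrite len_inv /= -{1 2}(Saff_inv sS) -w_invM len_inv.
have [aR _ _ _ _] := sa.
have := w_shiftM (w_inv w) w aR; rewrite w_mulV w_shift1.
by move=> /esym/eqP; rewrite addrC addr_eq0 => /eqP ->; rewrite oppr_ge0.
Qed.
End SimpleAffine.

(** * The fundamental alcove, existence and exchange of descents *)

Section Words.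
Context (D : based_root_datum).
Local Notation X := (lat D).
Local Notation R0 := (roots D).
Local Notation S0 := (simple D).
Local Notation W := (weyl D).
Local Notation "u *w v" := (w_mul u v) (at level 40, left associativity).
Local Notation one := (w_one D).
Implicit Types (x y z : X) (a b c d t : X) (k : int) (u v w s : W).

(** Larger in absolute value than every coroot at [rho2], so that [rho2 / period] is an interior
    point of the fundamental alcove. *)
Definition period : int := 1 + \sum_(c <- R0) `|height (coroot c)|.

(* [period] times the preimage under [w] of an interior point of the fundamental
   alcove. *)
Definition w_point w : X := fw_inv (w_lin w) (rho2 D - w_tr w *~ period).

Lemma period_gt0 : 0 < period.
Proof. by rewrite ltr_pwDl // sumr_ge0. Qed.

Lemma height_lt_period c : c \in R0 -> `|height (coroot c)| < period.
Proof.
move=> cR; rewrite /period (big_rem _ cR) /= addrCA ltrDl.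
by rewrite ltr_pwDl // sumr_ge0.
Qed.

(** The sign of an affine root is constant on the open fundamental alcove, so it can be tested at
    [rho2 / period]; this turns signs into linear inequalities. *)
Lemma depth_leE c k : c \in R0 ->
  (depth c <= k) = (0 < period * k + height (coroot c)).
Proof.
move=> cR; have := height_lt_period cR; have := period_gt0.
rewrite /depth pos_rootP //; have := height_neq0 cR.
set h := height _; move=> h0 p0 hp; apply/idP/idP; case: (ltP 0 h) => /= hh.
- by move=> k0; nia.
- by move=> k0; nia.
- by move=> H; rewrite leNgt; apply/negP => k0; nia.
- by move=> H; rewrite leNgt; apply/negP => k0; nia.
Qed.

Lemma pairing_fw_inv (g : finite_weyl D) x c : c \in R0 ->
  pairing (fw_inv g x) (coroot c) = pairing x (coroot (g c)).
Proof. by move=> cR; rewrite -[in RHS](fw_invK g x) fw_pairing. Qed.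

Lemma w_shift_leE w c k : c \in R0 ->
  (w_shift w c <= k) = (0 < period * (depth c + k) + pairing (w_point w) (coroot c)).
Proof.
move=> cR; rewrite /w_point pairing_fw_inv // pairingBl pairingMzl.
set wc := w_lin w c; have wcR : wc \in R0 by rewrite fw_root.
rewrite (_ : (_ <= k) = (depth wc <= depth c + k - pairing (w_tr w) (coroot wc))).
  by rewrite depth_leE // /height; congr (0 < _); ring.
by rewrite /w_shift -/wc; apply/idP/idP; lia.
Qed.

Lemma coroot_cone_pairing z (v : colat D) : {in S0, forall b, 0 < pairing z (coroot b)} ->
  coroot_cone v -> height v <= 2 * pairing z v.
Proof.
move=> zS [m ->]; rewrite height_cone pairing_sumr mulr_sumr big_seq [leRHS]big_seq.
apply: ler_sum => b bS; have := zS b bS.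
by rewrite pairingMnr -[pairing z _ *+ _]mulr_natr [(m b)%:R]natz; nia.
Qed.

(** The hypothesis places [w_point w] in [period] times the fundamental alcove, the simple coroots
    bounding it from below and the highest coroots from above. A positive coroot is a nonnegative
    combination of simple ones and lies below a highest one, so no affine root changes sign. *)
Lemma len0_simple_shift w : (forall s a, Saff s -> is_gradient s a -> w_shift w a <= 0) ->
  len w = 0%N.
Proof.
move=> H; pose z := w_point w.
have zS : {in S0, forall b, 0 < pairing z (coroot b)}.
  move=> b bS; pose s := Weyl 0 (fw_refl (simple_sub bS)).
  have sg : is_gradient s b by exact: simple_gradient.
  have := H s b ltac:(by left; exists b) sg.
  by rewrite w_shift_leE ?simple_sub // /depth simple_pos // !addr0 mulr0 add0r.
have zH t : highest_coroot t -> pairing z (coroot t) < period.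
  move=> tH; have [tR tP _] := highest_coroot_spec tH; pose s := Weyl t (fw_refl tR).
  have sg : is_gradient s (- t) by exact: highest_gradient.
  have := H s (- t) ltac:(by right; exists t) sg.
  rewrite w_shift_leE ?oppr_root // depthN // /depth tP /= subr0 addr0 mulr1.
  by rewrite corootN // pairingNr subr_gt0.
have pos0 c : pos_root c -> w_shift w c = 0.
  move=> cP; have cR := pos_root_sub cP.
  have [t tH tc] := highest_coroot_exists cR.
  apply/eqP; rewrite eq_le; apply/andP; split.
    rewrite w_shift_leE // /depth cP !addr0 mulr0 add0r -/z.
    by have := coroot_cone_pairing zS (pos_coroot_cone cP); have := height_pos cP; lia.
  rewrite -oppr_le0 -w_shiftN // w_shift_leE ?oppr_root // depthN // /depth cP subr0.
  rewrite addr0 mulr1 corootN // pairingNr subr_gt0 -/z; apply: le_lt_trans (zH t tH).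
  have := coroot_cone_pairing zS tc; have := height_cone_ge0 tc.
  by rewrite pairingBr; lia.
apply/eqP; rewrite -(eqr_nat int) natz lenE big_seq_cond big1 // => c /andP[_ cP].
by rewrite pos0.
Qed.

Lemma exists_right_descent w : (0 < len w)%N ->
  exists2 s, Saff s & len w = (len (w *w s)).+1.
Proof.
move=> w0; apply: contrapT => nH; suff w00 : len w = 0%N by rewrite w00 in w0.
apply: len0_simple_shift => s a sS sa; rewrite leNgt; apply/negP => wa; apply: nH.
by exists s => //; have := len_simple_r w sa sS; rewrite leNgt wa.
Qed.

Lemma exists_left_descent w : (0 < len w)%N ->
  exists2 s, Saff s & len w = (len (s *w w)).+1.
Proof.
move=> w0; have [|s sS ws] := @exists_right_descent (w_inv w); first by rewrite len_inv.
by exists s => //; rewrite -len_inv ws -(len_inv (s *w w)) w_invM (Saff_inv sS).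
Qed.

Lemma len_simple_lP s w : Saff s ->
  len (s *w w) = (len w).+1 \/ len w = (len (s *w w)).+1.
Proof.
move=> sS; have [a sa] := Saff_gradient sS; have := len_simple_l w sa.
by case: ifP; [left|right].
Qed.

Lemma len_simple_rP s w : Saff s ->
  len (w *w s) = (len w).+1 \/ len w = (len (w *w s)).+1.
Proof.
move=> sS; have [a sa] := Saff_gradient sS; have := len_simple_r w sa sS.
by case: ifP; [left|right].
Qed.

Lemma len_Saff s : Saff s -> len s = 1%N.
Proof.
by move=> sS; have := len_simple_lP one sS; rewrite w_mulr1 len1 => -[].
Qed.

Definition descent_l s w : bool := (len (s *w w) < len w)%N.
Definition descent_r s w : bool := (len (w *w s) < len w)%N.

Lemma descent_lE s a w : is_gradient s a ->
  descent_l s w = (w_shift w (fw_inv (w_lin w) a) < 0).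
Proof.
move=> sa; have := len_simple_l w sa; rewrite /descent_l ltNge.
by case: ifP => _ ->; rewrite ?ltnSn //= ltnNge leqnSn.
Qed.

Lemma descent_rE s a w : Saff s -> is_gradient s a -> descent_r s w = (0 < w_shift w a).
Proof.
move=> sS sa; have := len_simple_r w sa sS; rewrite /descent_r ltNge.
by case: ifP => _ ->; rewrite ?ltnSn //= ltnNge leqnSn.
Qed.

(** Here [w] maps the simple affine root of [t] to that of [s], hence conjugates one reflection into
    the other. *)
Lemma gradient_conj s (t : W) a b w : is_gradient s a -> is_gradient t b ->
  w_lin w b = a -> w_shift w b = 0 -> s *w w = w *w t.
Proof.
move=> [aR sl st _ _] [bR tl tt _ _] wb; rewrite /w_shift wb => /eqP; rewrite subr_eq0 => /eqP h.
apply: weyl_eq => [|x] /=.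
  rewrite st tt sl fwMz fwN wb /refl -h mulrzDr mulNrz [LHS]addrC -addrA; congr (_ + _).
  by rewrite mulNrz.
rewrite sl tl /refl fw_additive fwN fwMz wb; congr (_ - _ *~ _).
by rewrite -wb fw_pairing.
Qed.

Lemma int_unit_signs (h : int) :
  (h != 0 -> (h - 1 < 0) = (h < 0) /\ (0 < h + 1) = (0 < h)) /\
  (h != 1 -> (- h + 1 < 0) = (- h < 0) /\ (0 < h - 1) = (0 < h)).
Proof. by split=> h0; split; apply/idP/idP; lia. Qed.

(* The descents [descent_l s (w t)] and [descent_l s w] differ only if [w] maps
   the simple affine root of [t] to plus or minus that of [s]. *)
Lemma descent_exchange s (t : W) w : Saff s -> Saff t ->
  (descent_l s (w *w t) = descent_l s w /\ descent_r t (s *w w) = descent_r t w) \/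
  [/\ s *w w = w *w t, descent_l s w = descent_r t w &
      descent_l s (w *w t) = descent_r t (s *w w)].
Proof.
move=> sS tS; have [a sa] := Saff_gradient sS; have [b tb] := Saff_gradient tS.
rewrite !(descent_lE _ sa) !(descent_rE _ tS tb).
have [aR sl _ ss sh] := sa; have [bR tl _ tt th] := tb.
set c := fw_inv (w_lin w) a; have ca : w_lin w c = a by rewrite fw_invK.
have cR : c \in R0 by rewrite -(fw_root (w_lin w)) ca.
have -> : fw_inv (w_lin (w *w t)) a = w_lin t c.
  by apply: (can_inj (fw_funK (w_lin (w *w t)))); rewrite fw_invK /= tl reflK.
have tcR : w_lin t c \in R0 by rewrite fw_root.
have tcc : w_lin t (w_lin t c) = c by rewrite tl reflK.
have -> : w_shift (w *w t) (w_lin t c) = w_shift w c - w_shift t c.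
  have := w_shiftM t t cR; rewrite tt w_shift1 => /esym/eqP; rewrite addr_eq0 => /eqP ->.
  by rewrite opprK w_shiftM // tcc addrC.
rewrite w_shiftM // th // sh ?fw_root //.
have aN := root_oppr_neq aR; have bN := root_oppr_neq bR.
have wbE : (w_lin w b == a) = (c == b).
  by rewrite -ca (inj_eq (can_inj (fw_funK _))) eq_sym.
have wbNE : (w_lin w b == - a) = (c == - b).
  by rewrite -ca -fwN (inj_eq (can_inj (fw_funK _))) eq_sym eqr_oppLR.
rewrite wbE wbNE.
have [cb|_] := eqVneq c b.
  rewrite cb bN subr0; have [h0|h0] := eqVneq (w_shift w b) 0.
    right; split; last by rewrite h0.
      by apply: gradient_conj sa tb _ h0; rewrite -cb.
    by rewrite h0 ltxx.
  by left; exact: (int_unit_signs _).1 h0.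
have [cb|_] := eqVneq c (- b); last by left; rewrite !subrr subr0 addr0.
have wb : w_lin w b = - a by rewrite -ca cb fwN opprK.
rewrite cb w_shiftN // sub0r opprK; have [h1|h1] := eqVneq (w_shift w b) 1.
  right; split; rewrite ?h1 //; rewrite -[RHS](Saff_mulK _ sS); congr (_ *w _).
  have wb' : w_lin (s *w w) b = a by rewrite /= wb sl reflN refl_id // opprK.
  have sw0 : w_shift (s *w w) b = 0.
    by rewrite w_shiftM // h1 wb sh ?oppr_root // eqxx eq_sym aN.
  by rewrite w_mulA -(gradient_conj sa tb wb' sw0) Saff_mulK.
by left; exact: (int_unit_signs _).2 h1.
Qed.
End Words.

(** * Hecke operators *)

Section Operators.
Context (D : based_root_datum).
Local Notation W := (weyl D).
Local Notation "u *w v" := (w_mul u v) (at level 40, left associativity).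
Local Notation one := (w_one D).
Implicit Types (u v w s t : W) (l : seq W).

(* The letters of a word are multiplied from the left, the head first. *)
Definition wprod l v : W := foldl (fun x s => s *w x) v l.

Lemma wprodE l v : wprod l v = wprod l one *w v.
Proof.
elim/last_ind: l => [|l s IH]; first by rewrite /= w_mul1.
by rewrite /wprod !foldl_rcons -/(wprod l v) -/(wprod l one) IH w_mulA.
Qed.

Definition all_Saff l : Prop := forall s, s \in l -> Saff s.

Lemma all_Saff_cons s l : all_Saff (s :: l) -> Saff s /\ all_Saff l.
Proof.
move=> sl; split; first by apply: sl; rewrite mem_head.
by move=> t tl; apply: sl; rewrite inE tl orbT.
Qed.

Lemma len_wprod_le l v : all_Saff l -> (len (wprod l v) <= size l + len v)%N.
Proof.
elim: l v => // s l IH v /all_Saff_cons[sS lS]; rewrite /= -/(wprod l (s *w v)).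
apply: leq_trans (IH _ lS) _; rewrite addSnnS leq_add2l.
by case: (len_simple_lP v sS); lia.
Qed.

(** A word together with a factor of length 0, since [Saff] generates [W] only up to elements of
    length 0. *)
Definition is_reduced u (p : seq W * W) : Prop :=
  [/\ all_Saff p.1, len p.2 = 0%N, u = wprod p.1 p.2 & len u = size p.1].

Lemma reduced_exists u : exists p, is_reduced u p.
Proof.
have [n] := ubnP (len u); elim: n u => // n IH u un.
have [u0|u0] := posnP (len u); first by exists ([::], u).
have [s sS su] := exists_left_descent u0.
have [|[l w] [/= lS w0 suE lsu]] := IH (s *w u); first by rewrite su in un.
exists (rcons l s, w); split=> //=; last by rewrite size_rcons -lsu.
  by move=> t; rewrite mem_rcons inE => /orP[/eqP ->|/lS].
by rewrite /wprod foldl_rcons -/(wprod l w) -suE Saff_mulK.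
Qed.

Definition reduced u : seq W * W := sval (cid (reduced_exists u)).

Lemma reducedP u : is_reduced u (reduced u).
Proof. exact: (svalP (cid (reduced_exists u))). Qed.

Section Coefficients.
Context (K : comNzRingType) (eta : W -> K).
Implicit Types (phi : W -> K).

(* Left and right multiplication by [N_s] in the coordinates of the [N_w]; both
   make sense on functions with infinite support. *)
Definition lam s phi : W -> K :=
  fun w => phi (s *w w) + (if descent_l s w then eta s * phi w else 0).
Definition rho t phi : W -> K :=
  fun w => phi (w *w t) + (if descent_r t w then eta t * phi w else 0).
Definition shiftl u phi : W -> K := fun w => phi (w_inv u *w w).
Definition shiftr u phi : W -> K := fun w => phi (w *w w_inv u).

Definition opl l phi : W -> K := foldl (fun x s => lam s x) phi l.
Definition opr l phi : W -> K := foldl (fun x s => rho s x) phi l.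

(** Multiplication by [N_u] on the left and on the right. The right one reads a word of [w_inv u],
    whose letters come in the order in which they are multiplied from the right. *)
Definition Lop u phi : W -> K := opl (reduced u).1 (shiftl (reduced u).2 phi).
Definition Rop u phi : W -> K :=
  opr (reduced (w_inv u)).1 (shiftr (w_inv (reduced (w_inv u)).2) phi).

Definition delta u : W -> K := fun w => (w == u)%:R.

(** This is what the exceptional case of [descent_exchange] asks for; label functions provide it
    through [label_eq]. *)
Definition eta_invariant : Prop :=
  forall s t w, Saff s -> Saff t -> s *w w = w *w t -> eta s = eta t.

(** Associativity for one letter on either side. If the descents do not interact, the terms match
    one by one; in the exceptional case [s w = w t], and the two parameters are equal. *)
Lemma lam_rho s t phi : eta_invariant -> Saff s -> Saff t ->
  lam s (rho t phi) = rho t (lam s phi).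
Proof.
move=> etaI sS tS; apply/funext => w; rewrite /lam /rho w_mulA.
have [[-> ->]|[sw e1 e2]] := descent_exchange w sS tS.
  by case: (descent_l s w); case: (descent_r t w); ring.
rewrite e1 e2 sw (etaI s t w sS tS sw).
by case: (descent_r t w); case: (descent_r t _); ring.
Qed.

Lemma lam_shiftr s u phi : len u = 0%N -> lam s (shiftr u phi) = shiftr u (lam s phi).
Proof.
move=> u0; have u0' : len (w_inv u) = 0%N by rewrite len_inv.
by apply/funext => w; rewrite /lam /shiftr /descent_l w_mulA !(len_mul0r _ u0').
Qed.

Lemma shiftl_rho u t phi : len u = 0%N -> shiftl u (rho t phi) = rho t (shiftl u phi).
Proof.
move=> u0; have u0' : len (w_inv u) = 0%N by rewrite len_inv.
apply/funext => w; rewrite /rho /shiftl /descent_r -w_mulA.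
by rewrite !(len_mul0l _ u0').
Qed.

Lemma shiftlr u v phi : shiftl u (shiftr v phi) = shiftr v (shiftl u phi).
Proof. by apply/funext => w; rewrite /shiftl /shiftr w_mulA. Qed.

Lemma lam_Rop s v phi : eta_invariant -> Saff s -> lam s (Rop v phi) = Rop v (lam s phi).
Proof.
move=> etaI sS; have [lS w0 _ _] := reducedP (w_inv v); rewrite /Rop /opr.
rewrite -lam_shiftr; last by rewrite len_inv.
elim: (reduced _).1 lS (shiftr _ _) => //= t l IH /all_Saff_cons[tS lS] x.
by rewrite IH // lam_rho.
Qed.

Lemma shiftl_Rop u v phi : len u = 0%N -> shiftl u (Rop v phi) = Rop v (shiftl u phi).
Proof.
move=> u0; rewrite /Rop /opr -shiftlr.
elim: (reduced _).1 (shiftr _ _) => //= t l IH x.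
by rewrite IH // shiftl_rho.
Qed.

Lemma Lop_Rop u v phi : eta_invariant -> Lop u (Rop v phi) = Rop v (Lop u phi).
Proof.
move=> etaI; have [lS w0 _ _] := reducedP u; rewrite /Lop shiftl_Rop // /opl.
elim: (reduced u).1 lS (shiftl _ _) => //= t l IH /all_Saff_cons[tS lS] x.
by rewrite lam_Rop // IH.
Qed.

Lemma lam_delta s v : Saff s -> lam s (delta v) =
  fun w => delta (s *w v) w + (if descent_l s v then eta s * delta v w else 0).
Proof.
move=> sS; apply/funext => w; rewrite /lam /delta.
have -> : (s *w w == v) = (w == s *w v).
  by apply/eqP/eqP => [<-|->]; rewrite Saff_mulK.
by case: (eqVneq w v) => [->//|_]; rewrite !mulr0; do 2 case: ifP.
Qed.

Lemma rho_delta s v : Saff s -> rho s (delta v) =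
  fun w => delta (v *w s) w + (if descent_r s v then eta s * delta v w else 0).
Proof.
move=> sS; apply/funext => w; rewrite /rho /delta.
have -> : (w *w s == v) = (w == v *w s).
  by apply/eqP/eqP => [<-|->]; rewrite Saff_mulrK.
by case: (eqVneq w v) => [->//|_]; rewrite !mulr0; do 2 case: ifP.
Qed.

Lemma shiftl_delta u v : shiftl u (delta v) = delta (u *w v).
Proof.
apply/funext => w; rewrite /shiftl /delta; congr (_%:R); congr nat_of_bool.
by apply/eqP/eqP => [<-|->]; rewrite ?w_mulVK ?w_mulKV.
Qed.

Lemma shiftr_delta u v : shiftr u (delta v) = delta (v *w u).
Proof.
apply/funext => w; rewrite /shiftr /delta; congr (_%:R); congr nat_of_bool.
by apply/eqP/eqP => [<-|->]; rewrite -w_mulA ?w_mulV ?w_mulVr w_mulr1.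
Qed.

Lemma opl_delta l v : all_Saff l -> len (wprod l v) = (size l + len v)%N ->
  opl l (delta v) = delta (wprod l v).
Proof.
elim: l v => // s l IH v /all_Saff_cons[sS lS] /= lv.
have := len_wprod_le (s *w v) lS; rewrite lv addSnnS leq_add2l => sv.
have svE : len (s *w v) = (len v).+1 by case: (len_simple_lP v sS) => // E; lia.
have -> : lam s (delta v) = delta (s *w v).
  rewrite lam_delta //; apply/funext => w; rewrite /descent_l svE.
  by rewrite ltnNge leqnSn addr0.
by rewrite -IH // lv svE addSnnS.
Qed.

Lemma Lop_delta u v : len (u *w v) = (len u + len v)%N -> Lop u (delta v) = delta (u *w v).
Proof.
move=> uv; have [lS w0 uE lu] := reducedP u; rewrite /Lop shiftl_delta.
have uvE : wprod (reduced u).1 ((reduced u).2 *w v) = u *w v.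
  by rewrite wprodE w_mulA -(wprodE _ (reduced u).2) -uE.
by rewrite opl_delta // uvE // uv lu (len_mul0l _ w0).
Qed.

Lemma Lop_delta1 u : Lop u (delta one) = delta u.
Proof. by rewrite Lop_delta w_mulr1 // len1 addn0. Qed.

Lemma opr_delta l v : all_Saff l -> len (wprod l (w_inv v)) = (size l + len v)%N ->
  opr l (delta v) = delta (w_inv (wprod l (w_inv v))).
Proof.
elim: l v => [|s l IH] v; first by rewrite /= w_invK.
move=> /all_Saff_cons[sS lS] /= lv.
have sv : s *w w_inv v = w_inv (v *w s) by rewrite w_invM (Saff_inv sS).
have := len_wprod_le (s *w w_inv v) lS.
rewrite lv sv len_inv addSnnS leq_add2l => vs.
have vsE : len (v *w s) = (len v).+1 by case: (len_simple_rP v sS) => // E; lia.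
have -> : rho s (delta v) = delta (v *w s).
  rewrite rho_delta //; apply/funext => w; rewrite /descent_r vsE.
  by rewrite ltnNge leqnSn addr0.
by rewrite -/(opr l _) IH -?sv // lv vsE addSnnS.
Qed.

Lemma Rop_delta1 u : Rop u (delta one) = delta u.
Proof.
have [lS w0 uE lu] := reducedP (w_inv u); rewrite /Rop shiftr_delta w_mul1.
have w0' : len (w_inv (reduced (w_inv u)).2) = 0%N by rewrite len_inv.
by rewrite opr_delta ?w_invK ?w0' ?addn0 -?uE ?w_invK.
Qed.

Lemma Lop_delta_Rop u v : eta_invariant -> Lop u (delta v) = Rop v (delta u).
Proof. by move=> etaI; rewrite -{1}(Rop_delta1 v) Lop_Rop // Lop_delta1. Qed.

(** [reduced s] is only known to consist of a word of length 1 and a factor of length 0. Both sides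
    are therefore transported to [Rop v (delta s)], where the choice of the word no longer
    matters. *)
Lemma Lop_Saff s v : eta_invariant -> Saff s -> Lop s (delta v) = lam s (delta v).
Proof.
move=> etaI sS; rewrite Lop_delta_Rop // -[in RHS](Rop_delta1 v) lam_Rop //.
rewrite lam_delta // w_mulr1 /descent_l w_mulr1 len1 ltn0; congr (Rop v _).
by apply/funext => w; rewrite addr0.
Qed.

Definition linear_op (T : (W -> K) -> W -> K) : Prop :=
  forall (I : Type) (r : seq I) (a : I -> K) (phi : I -> W -> K),
    T (fun w => \sum_(i <- r) a i * phi i w) = fun w => \sum_(i <- r) a i * T (phi i) w.

Lemma linear_lam s : linear_op (lam s).
Proof.
move=> I r a phi; apply/funext => w; rewrite /lam.
case: ifP => _; last by rewrite addr0; apply: eq_bigr => i _; rewrite addr0.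
by rewrite mulr_sumr -big_split; apply: eq_bigr => i _ /=; rewrite mulrDr mulrCA.
Qed.

Lemma linear_rho s : linear_op (rho s).
Proof.
move=> I r a phi; apply/funext => w; rewrite /rho.
case: ifP => _; last by rewrite addr0; apply: eq_bigr => i _; rewrite addr0.
by rewrite mulr_sumr -big_split; apply: eq_bigr => i _ /=; rewrite mulrDr mulrCA.
Qed.

Lemma linear_opl l : linear_op (opl l).
Proof.
elim: l => // s l IH I r a phi; rewrite /= linear_lam; exact: IH.
Qed.

Lemma linear_opr l : linear_op (opr l).
Proof.
elim: l => // s l IH I r a phi; rewrite /= linear_rho; exact: IH.
Qed.

Lemma linear_Lop u : linear_op (Lop u).
Proof. by move=> I r a phi; exact: linear_opl. Qed.

Lemma linear_Rop u : linear_op (Rop u).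
Proof. by move=> I r a phi; exact: linear_opr. Qed.

Lemma linear_op2 T (a b : K) (phi psi : W -> K) : linear_op T ->
  T (fun w => a * phi w + b * psi w) = fun w => a * T phi w + b * T psi w.
Proof.
move=> TL; have := TL bool [:: true; false] (fun i => if i then a else b)
  (fun i => if i then phi else psi).
by under eq_fun do rewrite !big_cons big_nil addr0; move=> ->; apply/funext => w;
  rewrite !big_cons big_nil addr0.
Qed.
End Coefficients.
End Operators.

(** * Common inversions of two elements *)

Section MassBound.
Context (D : based_root_datum).
Local Notation X := (lat D).
Local Notation R0 := (roots D).
Local Notation W := (weyl D).
Local Notation "u *w v" := (w_mul u v) (at level 40, left associativity).
Local Notation one := (w_one D).
Implicit Types (u v w s t : W) (l : seq W) (a c d : X).

Definition common_inv u v c : bool := (0 < w_shift u c) && (0 < w_shift v c).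

Definition inv_count u v : nat := \sum_(c <- R0) common_inv u v c.

(** [period] times the value at [z / period] of the lowest positive affine root with gradient
    [c]. *)
Definition affine_level (z : X) c : int := period D * depth c + pairing z (coroot c).

Lemma w_shift_gt0E v c : c \in R0 -> (0 < w_shift v c) = (affine_level (w_point v) c <= 0).
Proof. by move=> cR; rewrite ltNge w_shift_leE // addr0 -leNgt. Qed.

(** [s] changes the sign of no affine root with gradient other than [a] and [- a], so it permutes
    the lowest positive affine roots with the remaining gradients. *)
Lemma depth_refl s a d : is_gradient s a -> d \in R0 -> d != a -> d != - a ->
  depth (refl a d) = depth d - pairing a (coroot d) * depth a.
Proof.
move=> [aR sl st _ sh] dR da dNa; have := sh d dR; rewrite (negbTE da) (negbTE dNa).
rewrite /w_shift sl st pairing_reflr // reflMz reflN refl_id // opprK pairingMzl; lia.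
Qed.

Lemma affine_level_refl s a z d : is_gradient s a -> d \in R0 -> d != a -> d != - a ->
  affine_level z (refl a d) = affine_level z d - pairing a (coroot d) * affine_level z a.
Proof.
move=> sa dR da dNa; have [aR _ _ _ _] := sa.
by rewrite /affine_level (depth_refl sa) // coroot_refl // pairingBr pairingMzr; ring.
Qed.

Section Step.
Context (s u v : W) (a : X) (sa : is_gradient s a).
Context (va : w_shift v a <= 0).

Lemma shift_mul_simple w d : d \in R0 ->
  w_shift (w *w s) d = (d == a)%:Z - (d == - a)%:Z + w_shift w (refl a d).
Proof. by have [_ sl _ _ sh] := sa => dR; rewrite w_shiftM // sh // sl. Qed.

(** After reindexing by [s] the terms agree except at [a] and [- a]; there the hypothesis that [v]
    does not invert [a] decides. *)
Lemma inv_count_unfold : (inv_count (u *w s) v <= inv_count u (v *w s))%N.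
Proof.
have [aR sl _ ss sh] := sa; rewrite /inv_count -(big_roots_fw (w_lin s)) sl.
rewrite big_seq [leqRHS]big_seq; apply: leq_sum => d dR.
have rdR := refl_root aR dR.
rewrite /common_inv !shift_mul_simple // reflK //.
have -> : (refl a d == a) = (d == - a).
  by rewrite -{2}[a](reflK aR) refl_id // (inj_eq (inv_inj (reflK aR))).
have -> : (refl a d == - a) = (d == a).
  by rewrite -(refl_id aR) (inj_eq (inv_inj (reflK aR))).
have aN := root_oppr_neq aR.
have [->|da] := eqVneq d a.
  rewrite aN refl_id // w_shiftN //; case: (boolP (_ && _)) => // /andP[h1 h2].
  by rewrite (_ : _ && _ = true) //; apply/andP; split; lia.
have [->|dNa] := eqVneq d (- a); last by rewrite !add0r.
by rewrite reflN refl_id // opprK [X in _ && X]ltNge va andbF.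
Qed.

(* For [d] other than [a] and [- a], at most as many of [d] and [refl a d] are
   common inversions of [u, v] as are of [u, v s]. *)
Lemma inv_count_fold : 0 < w_shift u a -> (inv_count u v < inv_count u (v *w s))%N.
Proof.
move=> ua; have [aR sl _ ss sh] := sa; have aN := root_oppr_neq aR.
pose F w d : nat := common_inv u w d.
have dbl w : (2 * inv_count u w = \sum_(d <- R0) (F w d + F w (refl a d)))%N.
  rewrite big_split /= -sl (big_roots_fw (w_lin s) (F w)) mul2n -addnn //.
have na : F v a = 0%N by rewrite /F /common_inv [X in _ && X]ltNge va andbF.
have nNa : F v (- a) = 0%N by rewrite /F /common_inv w_shiftN // oppr_gt0 ltNge ltW.
(* The gradient [a] itself becomes a common inversion, which makes the inequality strict. *)
have ya : F (v *w s) a = 1%N.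
  rewrite /F /common_inv ua shift_mul_simple // eqxx aN refl_id // w_shiftN //.
  by rewrite (_ : 0 < _ = true) //; lia.
have pair d : d \in R0 -> d != a -> d != - a ->
    (F v d + F v (refl a d) <= F (v *w s) d + F (v *w s) (refl a d))%N.
  move=> dR da dNa; have rdR := refl_root aR dR.
  have rda : refl a d != a by rewrite -{2}[a](reflK aR) refl_id // (inj_eq (inv_inj (reflK aR))).
  have rdNa : refl a d != - a by rewrite -(refl_id aR) (inj_eq (inv_inj (reflK aR))).
  have vsE e : e \in R0 -> e != a -> e != - a ->
      w_shift (v *w s) e = w_shift v (refl a e).
    by move=> eR ea eNa; rewrite shift_mul_simple // (negbTE ea) (negbTE eNa) add0r.
  rewrite /F /common_inv !vsE // reflK // !w_shift_gt0E //.
  set z := w_point u; set y := w_point v.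
  have zE := affine_level_refl z sa dR da dNa; have yE := affine_level_refl y sa dR da dNa.
  move: ua; rewrite w_shift_gt0E // -/z => za; move: va; rewrite leNgt w_shift_gt0E // -ltNge -/y => ya'.
  rewrite zE yE; set n := pairing a (coroot d).
  set Z := affine_level z d; set A := affine_level z a in za *.
  set Y := affine_level y d; set B := affine_level y a in ya' *.
  (* A rearrangement inequality: as [A <= 0 < B], passing from [d] to [refl a d] moves the two
     levels in opposite directions, whatever the sign of [n], so matching them crosswise can only
     raise the count. *)
  have [n0|n0] := leP n 0; case: (leP Z 0) => hZ; case: (leP Y 0) => hY;
    case: (leP (Z - n * A) 0) => hZ'; case: (leP (Y - n * B) 0) => hY' //; nia.
suff : (2 * inv_count u v < 2 * inv_count u (v *w s))%N by lia.
rewrite !dbl !(bigD1_seq a) ?fset_uniq //= refl_id // na nNa ya add0n.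
rewrite addSn ltnS; apply: leq_trans (leq_addl _ _).
rewrite big_seq_cond [leqRHS]big_seq_cond; apply: leq_sum => d /andP[dR da].
have [->|dNa] := eqVneq d (- a); last exact: pair.
by rewrite reflN refl_id // opprK na nNa.
Qed.
End Step.

Lemma inv_count_le u v : (inv_count u v <= size R0)%N.
Proof.
by rewrite /inv_count -sum1_size; apply: leq_sum => c _; case: common_inv.
Qed.
End MassBound.

(** * Positive majorants and the weighted mass of a product *)

Section Majorant.
Context (R : realType) (D : based_root_datum).
Local Notation X := (lat D).
Local Notation R0 := (roots D).
Local Notation W := (weyl D).
Local Notation C := R[i].
Local Notation "u *w v" := (w_mul u v) (at level 40, left associativity).
Local Notation one := (w_one D).
Implicit Types (u v w s t : W) (l : seq W) (M : R).

Local Notation cst M := (fun _ : W => M).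

Lemma opl_ge0 M l (phi : W -> R) : 0 <= M -> (forall w, 0 <= phi w) ->
  forall w, 0 <= opl (cst M) l phi w.
Proof.
move=> M0; elim: l phi => // s l IH phi H; apply: IH => w.
by rewrite /lam; case: ifP => _; rewrite addr_ge0 // mulr_ge0.
Qed.

(** The factor 2 pays for the product rule: a difference of terms [eta s * phi w] splits into two,
    each at most [M * (r * psi w)] because [1 <= M]. The same majorant thus serves the operator and
    its variation with the parameters. *)
Lemma opl_diff_majorant (eta eta' : W -> C) M r l (phi phi' : W -> C) (psi : W -> R) :
  all_Saff l -> 1 <= M -> 0 <= r ->
  (forall s, Saff s -> normc (eta s) <= M) -> (forall s, Saff s -> normc (eta' s) <= M) ->
  (forall s, Saff s -> normc (eta s - eta' s) <= r) ->
  (forall w, normc (phi' w) <= psi w) -> (forall w, normc (phi w - phi' w) <= r * psi w) ->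
  forall w, normc (opl eta' l phi' w) <= opl (cst (2 * M)) l psi w /\
    normc (opl eta l phi w - opl eta' l phi' w) <= r * opl (cst (2 * M)) l psi w.
Proof.
move=> lS M1 r0 eM e'M er; elim: l lS phi phi' psi => [|s l IH] lS phi phi' psi H H' //.
have [sS {}lS] := all_Saff_cons lS; apply: IH => // w; rewrite /lam; case: ifP => _.
- apply: le_trans (le_normcD _ _) _; rewrite lerD // normcM.
  apply: le_trans (ler_pM _ _ (e'M s sS) (H w)) _; rewrite ?normc_ge0 //.
  rewrite ler_wpM2r ?(le_trans (normc_ge0 _) (H w)) //; lra.
- by rewrite !addr0.
- rewrite opprD addrACA; apply: le_trans (le_normcD _ _) _; rewrite mulrDr lerD //.
  have -> : eta s * phi w - eta' s * phi' w =
      eta s * (phi w - phi' w) + (eta s - eta' s) * phi' w by ring.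
  apply: le_trans (le_normcD _ _) _; rewrite !normcM.
  have p0 := le_trans (normc_ge0 _) (H w).
  have h1 : normc (eta s) * normc (phi w - phi' w) <= M * (r * psi w).
    by apply: ler_pM; rewrite ?normc_ge0 ?eM.
  have h2 : normc (eta s - eta' s) * normc (phi' w) <= r * psi w.
    by apply: ler_pM; rewrite ?normc_ge0 ?er.
  apply: le_trans (lerD h1 h2) _; have rp := mulr_ge0 r0 p0.
  rewrite [leRHS](_ : _ = M * (r * psi w) + M * (r * psi w)); last by ring.
  by rewrite lerD2l ler_peMl.
- by rewrite !addr0.
Qed.

Lemma sum_delta_le (r : seq W) v : uniq r -> \sum_(w <- r) (delta R v w) <= 1.
Proof.
move=> ur; rewrite /delta; case: (boolP (v \in r)) => vr.
  by rewrite (bigD1_seq v) //= eqxx big1 ?addr0 // => w /negbTE ->.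
by rewrite big1_seq ?ler01 // => w /= wr; case: eqP vr wr => // -> /negbTE ->.
Qed.

(** A letter that multiplies does not raise the exponent, and staying costs a factor [M] but lowers
    it. With [k = size l + 1] the induction closes by [(M k)^(m+1) + M (M k)^m <= (M (k +
    1))^(m+1)], which is why the base contains the length of the word. *)
Lemma opl_mass M l v (r : seq W) : 1 <= M -> all_Saff l -> len (wprod l one) = size l ->
  uniq r -> \sum_(w <- r) opl (cst M) l (delta R v) w <=
    (M * (size l).+1%:R) ^+ inv_count (w_inv v) (wprod l one).
Proof.
move=> M1 lS lr ur; have M0 : 0 <= M by rewrite (le_trans ler01).
elim: l v lS lr => [|s l IH] v lS lr.
  apply: le_trans (sum_delta_le v ur) _; rewrite mulr1 exprn_ege1 //.
have [sS {}lS] := all_Saff_cons lS.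
have wE : wprod (s :: l) one = wprod l one *w s.
  by rewrite /wprod /= w_mulr1 -/(wprod l s) wprodE.
have l1 : len (wprod l one) = size l.
  apply/eqP; rewrite eqn_leq; apply/andP; split.
    by have := len_wprod_le one lS; rewrite len1 addn0.
  by have := len_mul_le (wprod l one) s; rewrite -wE lr (len_Saff sS) addn1 ltnS.
have [a sa] := Saff_gradient sS.
have ua : w_shift (wprod l one) a <= 0.
  by have := len_simple_r (wprod l one) sa sS; case: ifP => // _; rewrite -wE lr l1 /=; lia.
rewrite wE; set u := wprod l one in IH l1 ua *.
have m1 w : inv_count (w_inv (s *w w)) u = inv_count (w_inv w *w s) u.
  by rewrite w_invM (Saff_inv sS).
have step w : \sum_(x <- r) opl (cst M) l (delta R w) x <=
    (M * (size l).+1%:R) ^+ inv_count (w_inv w) u by exact: IH.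
have ge1 k : 1 <= M * k.+1%:R by rewrite (le_trans M1) // ler_peMr // ler1n.
have Mk : M * (size l).+1%:R <= M * (size l).+2%:R by rewrite ler_wpM2l // ler_nat.
have nofold : (inv_count (w_inv v *w s) u <= inv_count (w_inv v) (u *w s))%N.
  exact: (inv_count_unfold _ sa ua).
have -> : opl (cst M) (s :: l) (delta R v) = opl (cst M) l
    (fun w => delta R (s *w v) w + (if descent_l s v then M * delta R v w else 0)).
  by rewrite -(lam_delta (cst M) v sS).
case ds : (descent_l s v); last first.
  have -> : (fun w => delta R (s *w v) w + 0) = delta R (s *w v).
    by apply/funext => w; rewrite addr0.
  apply: le_trans (step _) _; rewrite m1.
  apply: le_trans (ler_weXn2l _ nofold) _; first exact: ge1.
  by rewrite lerXn2r ?nnegrE ?(le_trans ler01 (ge1 _)).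
(* A left descent of [v] at [s] means that [w_inv v] inverts [a], while [ua] says that the remaining
   word does not. *)
have fold : (inv_count (w_inv v) u < inv_count (w_inv v) (u *w s))%N.
  apply: (inv_count_fold sa ua).
  have := w_shiftM v (w_inv v) (let: And5 aR _ _ _ _ := sa in aR).
  by move: ds; rewrite (descent_lE _ sa) w_mulVr w_shift1 /=; lia.
have -> : (fun w => delta R (s *w v) w + M * delta R v w) =
    (fun w => 1 * delta R (s *w v) w + M * delta R v w) by under eq_fun do rewrite -[delta R (s *w v) _]mul1r.
rewrite (linear_op2 _ _ _ _ (@linear_opl _ _ _ l)) big_split /= -!mulr_sumr mul1r.
case: (inv_count (w_inv v) (u *w s)) nofold fold => // n nofold; rewrite ltnS => fold.
apply: (@le_trans _ _ ((M * (size l).+1%:R) ^+ n.+1 + M * (M * (size l).+1%:R) ^+ n)).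
  apply: lerD.
    by apply: le_trans (step _) _; rewrite m1 ler_weXn2l ?ge1.
  by rewrite ler_wpM2l // (le_trans (step _)) // ler_weXn2l ?ge1.
have k0 : 0 <= M * (size l).+1%:R := le_trans ler01 (ge1 _).
rewrite exprS -mulrDl [X in _ <= X]exprS ler_pM ?exprn_ge0 ?addr_ge0 //.
  by rewrite [size _]/= -[in leRHS]natr1 mulrDr mulr1.
by rewrite lerXn2r ?nnegrE // (le_trans k0).
Qed.
End Majorant.

(** The coefficient of [B ^+ n] is exactly 1. Applied to the weight of a product, this leaves the
    top power on one factor free of any [n]-dependent weight of the other. *)
Lemma add_pow_le (R : realFieldType) (a B : R) n : 0 <= a -> 1 <= B ->
  (a + B) ^+ n <= B ^+ n + n%:R * (1 + a) ^+ n * B ^+ n.-1.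
Proof.
move=> a0 B1; have B0 : 0 <= B := le_trans ler01 B1.
have A1 : 1 <= 1 + a by rewrite lerDl.
elim: n => [|n IH]; first by rewrite !expr0 !mul0r addr0.
have h1 : a * B ^+ n <= (1 + a) ^+ n.+1 * B ^+ n.
  rewrite ler_wpM2r ?exprn_ge0 // exprS -[leLHS]mulr1.
  by rewrite ler_pM ?lerDr // exprn_ege1.
set P := n%:R * _ * _ in IH.
have h2 : (a + B) * P <= n%:R * (1 + a) ^+ n.+1 * B ^+ n.
  rewrite /P; case: n {IH h1 P} => [|n]; first by rewrite !mul0r mulr0.
  rewrite [leRHS](_ : _ = ((1 + a) * B) * (n.+1%:R * (1 + a) ^+ n.+1 * B ^+ n)); last first.
    by rewrite [(1 + a) ^+ n.+2]exprS [B ^+ n.+1]exprS; ring.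
  rewrite ler_wpM2r ?mulr_ge0 ?exprn_ge0 ?ler0n ?addr_ge0 //.
  by rewrite mulrDl mul1r addrC lerD2l ler_peMr.
rewrite exprS; apply: le_trans (ler_wpM2l _ IH) _; first by rewrite addr_ge0.
rewrite -natr1 [B ^+ n.+1]exprS /=; move: h1 h2.
move: (B ^+ n) ((1 + a) ^+ n.+1) (P) (n%:R) => b c P' m; lra.
Qed.

Section Weights.
Context (R : realType) (D : based_root_datum) (f : length_extension R D).
Local Notation X := (lat D).
Local Notation R0 := (roots D).
Local Notation W := (weyl D).
Local Notation "u *w v" := (w_mul u v) (at level 40, left associativity).
Local Notation one := (w_one D).
Implicit Types (u v w s t : W) (l : seq W) (M : R) (x y a : X) (k : int).

Definition lat_norm x : R := f (real_incl f x).

Lemma lat_norm_add_root x a k : a \in R0 -> lat_norm (x + a *~ k) = lat_norm x.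
Proof.
move=> aR; rewrite /lat_norm raddfD ext_inv //; exists (fun b => ((b == a)%:Z * k)%:~R).
rewrite (bigD1_seq a) ?fset_uniq //= eqxx mul1r big1 ?addr0.
  by rewrite scaler_int raddfMz.
by move=> b /negbTE ->; rewrite mul0r scale0r.
Qed.

Lemma lat_norm_refl x a : a \in R0 -> lat_norm (refl a x) = lat_norm x.
Proof. by move=> aR; rewrite /refl -mulrNz lat_norm_add_root. Qed.

Lemma lat_norm_fw (g : finite_weyl D) x : lat_norm (g x) = lat_norm x.
Proof. by elim: (fw_gen g) => //= a u aR _ <-; rewrite lat_norm_refl. Qed.

Lemma lat_normD x y : lat_norm (x + y) <= lat_norm x + lat_norm y.
Proof. by rewrite /lat_norm raddfD; exact: ext_triangle. Qed.

Lemma lat_norm_ge0 x : 0 <= lat_norm x.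
Proof. exact: ext_ge0. Qed.

Lemma ext_lenE w : ext_len f w = (len w)%:R + lat_norm (w_tr w).
Proof. by rewrite /ext_len /w_act fw0 add0r. Qed.

Lemma lat_norm_Saff s w : Saff s -> lat_norm (w_tr (s *w w)) = lat_norm (w_tr w).
Proof.
move=> sS; have [a [aR sl st _ _]] := Saff_gradient sS.
by rewrite /= st sl mulNrz -mulrNz addrC lat_norm_add_root // lat_norm_refl.
Qed.

Lemma lat_norm_wprod l w : all_Saff l -> lat_norm (w_tr (wprod l w)) = lat_norm (w_tr w).
Proof.
elim: l w => // s l IH w /all_Saff_cons[sS lS].
by rewrite [wprod _ _]/= -/(wprod l _) IH // lat_norm_Saff.
Qed.

Lemma opl_support (K : comNzRingType) (eta : W -> K) l (phi : W -> K) w :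
  all_Saff l -> opl eta l phi w != 0 ->
  exists2 v, phi v != 0 & (len w <= size l + len v)%N /\
    lat_norm (w_tr w) = lat_norm (w_tr v).
Proof.
elim: l phi => [|s l IH] phi lS; first by exists w.
have [sS {}lS] := all_Saff_cons lS => /(IH _ lS)[v pv [lw fw]].
have [p0|p0] := eqVneq (phi (s *w v)) 0.
  exists v; last by split => //; apply: leq_trans lw _; rewrite /= addSn leqnSn.
  by apply: contraNneq pv; rewrite /lam p0 add0r => ->; rewrite mulr0; case: ifP.
exists (s *w v) => //; split; last by rewrite lat_norm_Saff.
apply: leq_trans lw _; rewrite /= addSnnS leq_add2l.
by case: (len_simple_lP v sS); lia.
Qed.

Lemma Lop_support (K : comNzRingType) (eta : W -> K) u v w :
  Lop eta u (delta K v) w != 0 -> ext_len f w <= ext_len f u + ext_len f v.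
Proof.
have [lS w0 uE lu] := reducedP u; set l := (reduced u).1; set o := (reduced u).2.
rewrite /Lop shiftl_delta => /(opl_support lS)[x]; rewrite /delta.
have [->|_] := eqVneq x (o *w v); last by rewrite eqxx.
move=> _ [lw fw]; rewrite !ext_lenE fw -addrACA; apply: lerD.
  by rewrite -natrD ler_nat lu; move: lw; rewrite (len_mul0l _ w0).
apply: le_trans (lat_normD _ _) _; rewrite lat_norm_fw lerD2r le_eqVlt.
by rewrite [in eqbRHS]uE -/l -/o lat_norm_wprod // eqxx.
Qed.

Lemma ext_len1_ge1 w : 1 <= ext_len f w + 1.
Proof. by rewrite lerDr ext_len_ge0. Qed.

Lemma weight_gt0 n w : 0 < weight f n w.
Proof. by rewrite exprn_gt0 // (lt_le_trans ltr01) ?ext_len1_ge1. Qed.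

Lemma weightD m n w : weight f (m + n) w = weight f m w * weight f n w.
Proof. exact: exprD. Qed.

(** The mass is bounded by [opl_mass], the weight on the support of the product by [add_pow_le]. *)
Lemma Lop_weight M n u v (r : seq W) : 1 <= M -> uniq r ->
  \sum_(w <- r) Lop (fun=> M) u (delta R v) w * weight f n w <=
  M ^+ size R0 * weight f (size R0) u *
    (weight f n v + n%:R * weight f n u * weight f n.-1 v).
Proof.
move=> M1 ur; have M0 : 0 <= M := le_trans ler01 M1.
have [lS w0 uE lu] := reducedP u.
set B := (X in _ <= _ * X).
have wB w : Lop (fun=> M) u (delta R v) w != 0 -> weight f n w <= B.
  move=> /Lop_support wuv; apply: le_trans (_ : (ext_len f u + (ext_len f v + 1)) ^+ n <= _).
    by rewrite lerXn2r ?nnegrE ?addr_ge0 ?ext_ge0 // addrA lerD2r.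
  apply: le_trans (add_pow_le n (ext_len_ge0 f u) (ext_len1_ge1 v)) _.
  by rewrite [1 + _]addrC lexx.
have B0 : 0 <= B by rewrite /B addr_ge0 ?mulr_ge0 ?weight_ge0 ?ler0n.
have L0 w : 0 <= Lop (fun=> M) u (delta R v) w.
  rewrite /Lop shiftl_delta; apply: opl_ge0 => // x; exact: ler0n.
apply: (@le_trans _ _ (\sum_(w <- r) Lop (fun=> M) u (delta R v) w * B)).
  apply: ler_sum => w _; have [->|nz] := eqVneq (Lop (fun=> M) u (delta R v) w) 0.
    by rewrite !mul0r.
  by rewrite ler_wpM2l // wB.
rewrite -mulr_suml ler_wpM2r //.
set l := (reduced u).1 in lS uE lu; set o := (reduced u).2 in w0 uE.
have lred : len (wprod l one) = size l.
  by rewrite -(len_mul0r (wprod l one) w0) -wprodE -uE.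
have := opl_mass (o *w v) M1 lS lred ur; rewrite /Lop shiftl_delta -/l -/o => H.
apply: le_trans H _; rewrite -lu.
have k1 : 1 <= M * (len u).+1%:R by rewrite (le_trans M1) // ler_peMr // ler1n.
apply: le_trans (ler_weXn2l k1 (inv_count_le _ _)) _.
rewrite exprMn ler_wpM2l ?exprn_ge0 // lerXn2r ?nnegrE ?addr_ge0 ?ext_ge0 //.
by rewrite -natr1 lerD2r ext_lenE lerDl lat_norm_ge0.
Qed.
End Weights.

(** * Polynomial growth *)

Section Growth.
Context (R : realType) (D : based_root_datum) (f : length_extension R D).
Local Notation X := (lat D).
Local Notation R0 := (roots D).
Local Notation W := (weyl D).
Implicit Types (u v w : W) (x y a c d : X) (k : int).

Lemma pairing_injl x : (forall v : colat D, pairing x v = 0) -> x = 0.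
Proof.
move=> x0; pose g : colat D -> int := fun=> 0.
have gA : zmod_morphism g by move=> v v'; rewrite /g subrr.
pose G := GRing.isZmodMorphism.Build (colat D) int g gA.
pose g' : {additive colat D -> int} := HB.pack g G.
have [z [_ zU]] := perfectr g'.
by rewrite -(zU x) // -(zU 0) // => v; rewrite pairing0l.
Qed.

(** Reindexing by the reflection in [a] negates the first factor of each term. This is
    [coroot_cartan] for the form on [Y] defined by the roots. *)
Lemma root_quadratic a (v : colat D) : a \in R0 ->
  2 * (\sum_(d <- R0) pairing d (coroot a) * pairing d v) =
  (\sum_(d <- R0) pairing d (coroot a) ^+ 2) * pairing a v.
Proof.
move=> aR; set S := \sum_(d <- R0) _ * _.
have SE : S = - S + (\sum_(d <- R0) pairing d (coroot a) ^+ 2) * pairing a v.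
  rewrite {1}/S -(big_roots_fw (fw_refl aR)) /= mulr_suml -sumrN -big_split /=.
  apply: eq_bigr => d _; rewrite /refl !pairingBl !pairingMzl pairing_coroot //; ring.
by rewrite mulrDl mul1r {1}SE addrC addrA subrr add0r.
Qed.

(** The pairing is not extended to [real_lat]; the relation is transferred through the uniqueness of
    real coordinates in a lattice basis. *)
Lemma pairing_real_span x (c : X -> R) (v : colat D) :
  real_incl f x = \sum_(a <- R0) c a *: real_incl f a ->
  (pairing x v)%:~R = \sum_(a <- R0) c a * (pairing a v)%:~R :> R.
Proof.
move=> xc; have [n [[e eB] _]] := lat_free D.
pose co y : {ffun 'I_n -> int} := sval (cid (eB y)).
have coE y : y = \sum_i e i *~ co y i by have [] := svalP (cid (eB y)).
have inclE y : real_incl f y = \sum_i (co y i)%:~R *: real_incl f (e i).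
  rewrite {1}(coE y) raddf_sum; apply: eq_bigr => i _.
  by rewrite raddfMz scaler_int.
have pE y : (pairing y v)%:~R = \sum_i (co y i)%:~R * (pairing (e i) v)%:~R :> R.
  rewrite {1}(coE y) pairing_suml rmorph_sum; apply: eq_bigr => i _.
  by rewrite pairingMzl rmorphM.
have [c0 [_ cU]] := real_inclP eB (real_incl f x).
have e1 : c0 = [ffun i => (co x i)%:~R].
  by apply: cU; rewrite inclE; apply: eq_bigr => i _; rewrite ffunE.
have e2 : c0 = [ffun i => \sum_(a <- R0) c a * (co a i)%:~R].
  apply: cU; rewrite xc; under eq_bigr do rewrite inclE scaler_sumr.
  rewrite exchange_big; apply: eq_bigr => i _ /=; rewrite ffunE scaler_suml.
  by apply: eq_bigr => a _; rewrite scalerA.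
rewrite pE; under [RHS]eq_bigr do rewrite pE mulr_sumr.
rewrite exchange_big; apply: eq_bigr => i _ /=.
have /ffunP /(_ i) := etrans (esym e1) e2; rewrite !ffunE => ->.
by rewrite mulr_suml; apply: eq_bigr => a _; rewrite mulrA.
Qed.

(** By [ext_separated], [x] is a real combination of roots, and [root_quadratic] replaces its
    coefficients by [m d], each a combination of the pairings of [d] with coroots. The sum of the
    squares of the [m d] is then a combination of the pairings of [x] with coroots, which vanish. *)
Lemma lat_norm_eq0 x : lat_norm f x = 0 ->
  (forall a, a \in R0 -> pairing x (coroot a) = 0) -> x = 0.
Proof.
move=> /ext_separated[c xc] xa; apply: pairing_injl => v.
pose A a : R := (\sum_(d <- R0) pairing d (coroot a) ^+ 2)%:~R.
have A0 a : a \in R0 -> A a != 0.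
  move=> aR; rewrite intr_eq0 gt_eqF // (big_rem _ aR) /= pairing_coroot //.
  by rewrite ltr_pwDl // sumr_ge0 // => d _; rewrite sqr_ge0.
pose m d := \sum_(a <- R0) 2 * c a / A a * (pairing d (coroot a))%:~R.
have xE (v' : colat D) : (pairing x v')%:~R = \sum_(d <- R0) m d * (pairing d v')%:~R :> R.
  rewrite (pairing_real_span _ xc); under [RHS]eq_bigr do rewrite mulr_suml.
  rewrite exchange_big; apply: eq_big_seq => a aR /=.
  transitivity (c a / A a * (A a * (pairing a v')%:~R)).
    by rewrite mulrA divfK // A0.
  have -> : A a * (pairing a v')%:~R =
      2 * \sum_(d <- R0) (pairing d (coroot a))%:~R * (pairing d v')%:~R.
    rewrite /A -rmorphM -root_quadratic // rmorphM rmorph_sum; congr (_ * _).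
    by apply: eq_bigr => d _; rewrite rmorphM.
  by rewrite mulrA mulr_sumr; apply: eq_bigr => d _; ring.
have : \sum_(d <- R0) m d * m d = 0.
  transitivity (\sum_(d <- R0) \sum_(a <- R0)
      m d * (2 * c a / A a * (pairing d (coroot a))%:~R)).
    by apply: eq_bigr => d _; rewrite -mulr_sumr.
  rewrite exchange_big big1_seq // => a /= aR.
  under eq_bigr do rewrite mulrCA; rewrite -mulr_sumr -xE xa // mulr0 //.
move=> /eqP; rewrite psumr_eq0 => [/allP m0|d _]; last by rewrite -expr2 sqr_ge0.
apply/eqP; rewrite -(intr_eq0 R) xE big1_seq // => d /= dR.
by have := m0 d dR; rewrite /= mulf_eq0 orbb => /eqP ->; rewrite mul0r.
Qed.

Lemma lat_norm0 : lat_norm f 0 = 0.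
Proof. by rewrite /lat_norm raddf0 -(scale0r (0 : real_lat f)) ext_homogeneous normr0 mul0r. Qed.

Lemma lat_norm_span (c : X -> int) : lat_norm f (\sum_(a <- R0) a *~ c a) = 0.
Proof.
rewrite -lat_norm0 /lat_norm -[in LHS](add0r (\sum_(a <- R0) _)) raddfD raddf0.
apply: ext_inv; exists (fun a => (c a)%:~R); rewrite raddf_sum.
by apply: eq_bigr => a _; rewrite raddfMz scaler_int.
Qed.

(** An element of the finite Weyl group moves a vector within its coset of the root lattice, and
    [lat_norm_eq0] kills the vectors of that lattice orthogonal to all coroots. Linear parts thus
    inject into the finite set of self-maps of the roots. *)
Lemma fw_eq (g h : finite_weyl D) : {in R0, g =1 h} -> g = h.
Proof.
move=> gh; apply: finite_weyl_eq; apply/funext => x.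
apply/eqP; rewrite -subr_eq0; apply/eqP; apply: lat_norm_eq0.
  have [c gc] := fw_span g x; have [c' hc] := fw_span h x.
  rewrite gc hc opprD addrACA subrr add0r -sumrB; under eq_bigr do rewrite -mulrzBr.
  exact: lat_norm_span.
move=> a aR; rewrite pairingBl -(fw_invK g a).
have bR : fw_inv g a \in R0 by rewrite -(fw_root g) fw_invK.
by rewrite fw_pairing // gh // fw_pairing // subrr.
Qed.

Lemma lat_norm_nat x : exists n : nat, lat_norm f x = n%:R.
Proof.
have := ext_int f x; have := lat_norm_ge0 f x; rewrite -/(lat_norm f x) => x0 /intrP[k kE].
exists (absz k); rewrite kE natr_absz ger0_norm // -(ler0z R) -kE //.
Qed.

Lemma lat_normMz x k : lat_norm f (x *~ k) = `|k|%:~R * lat_norm f x.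
Proof. by rewrite /lat_norm raddfMz -scaler_int ext_homogeneous intr_norm. Qed.

Lemma lat_normN x : lat_norm f (- x) = lat_norm f x.
Proof. by rewrite -mulrN1z lat_normMz mul1r. Qed.

Lemma ext_len_nat w : exists n : nat, ext_len f w = n%:R.
Proof.
have [n nE] := lat_norm_nat (w_tr w).
by exists (len w + n)%N; rewrite ext_lenE nE natrD.
Qed.

Lemma pairing_tr_le w a : a \in R0 -> `|pairing (w_tr w) (coroot a)| <= 2 * (len w)%:Z + 1.
Proof.
move=> aR; rewrite -(fw_invK (w_lin w) a); set c := fw_inv _ a.
have cR : c \in R0 by rewrite -(fw_root (w_lin w)) fw_invK.
have : `|w_shift w c| <= 2 * (len w)%:Z.
  by rewrite len_double (big_rem _ cR) /= lerDl sumr_ge0.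
by rewrite /w_shift /depth; case: pos_root; case: pos_root => /=; lia.
Qed.

(* A lattice vector divisible by [m] on which [f] and the coroots are all less
   than [m] vanishes, as [f] takes integral values. *)
Lemma lattice_small (z : X) (m : nat) : lat_norm f (z *~ m) < m%:R ->
  (forall a, a \in R0 -> `|pairing (z *~ m) (coroot a)| < m%:Z) -> z = 0.
Proof.
move=> zm za; have m0 : (0 < m)%N.
  by have := le_lt_trans (lat_norm_ge0 f _) zm; rewrite ltr0n.
apply: lat_norm_eq0 => [|a aR]; last by have := za a aR; rewrite pairingMzl; nia.
have [n nE] := lat_norm_nat z; move: zm; rewrite lat_normMz nE ger0_norm //.
rewrite -pmulrn -natrM ltr_nat -[ltnRHS]muln1 ltn_pmul2l //.
by case: n nE.
Qed.

Lemma ext_len_count : exists K r : nat, forall (F : seq W) n, uniq F ->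
  {in F, forall w, ext_len f w <= n%:R} -> (size F <= K * (4 * n + 3) ^ r)%N.
Proof.
have [r [[e eB] _]] := lat_free D.
pose co y : {ffun 'I_r -> int} := sval (cid (eB y)).
have coE y : y = \sum_i e i *~ co y i by have [] := svalP (cid (eB y)).
(* Coordinates of translations are taken modulo [m.+1 = 4 n + 3]: a difference of two translations
   has [f] at most [2 n] and pairings with coroots at most [4 n + 2], so that [lattice_small]
   applies when the residues agree. *)
exists #|{ffun R0 -> R0}|, r => F n uF Fn; pose m := (4 * n + 2)%N.
have wR w (a : R0) : w_lin w (val a) \in R0 by rewrite fw_root; exact: valP.
pose code w : {ffun R0 -> R0} * {ffun 'I_r -> 'I_m.+1} :=
  ([ffun a => FSetSub (wR w a)], [ffun i => inord (absz (co (w_tr w) i %% m.+1)%Z)]).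
have lenn w : w \in F -> ((len w)%:R <= n%:R :> R) && (lat_norm f (w_tr w) <= n%:R).
  move=> /Fn; rewrite ext_lenE => H; apply/andP; split; apply: le_trans H.
    by rewrite lerDl lat_norm_ge0.
  by rewrite lerDr ler0n.
have codeI : {in F &, injective code}.
  move=> u v uF' vF [/ffunP c1 /ffunP c2]; apply: weyl_eq; last first.
    move=> x; congr (_ x); congr fw_fun; apply: fw_eq => a aR.
    by have := c1 (FSetSub aR); rewrite !ffunE => /(congr1 val).
  pose k i := ((co (w_tr u) i - co (w_tr v) i) %/ m.+1)%Z.
  have kE i : co (w_tr u) i - co (w_tr v) i = k i * m.+1.
    apply/esym/divzK; rewrite -eqz_mod_dvd; apply/eqP.
    have lt j : (absz (j %% m.+1)%Z < m.+1)%N.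
      by rewrite -ltz_nat gez0_abs ?modz_ge0 // ltz_pmod.
    have := congr1 (@nat_of_ord _) (c2 i); rewrite !ffunE !inordK // => /(congr1 Posz).
    by rewrite !gez0_abs ?modz_ge0.
  have dE : w_tr u - w_tr v = (\sum_i e i *~ k i) *~ m.+1.
    rewrite (coE (w_tr u)) (coE (w_tr v)) -sumrB mulrz_suml; apply: eq_bigr => i _.
    by rewrite -mulrzBr kE mulrzA.
  have /andP[lu fu] := lenn u uF'; have /andP[lv fv] := lenn v vF.
  apply/eqP; rewrite -subr_eq0 dE (@lattice_small (\sum_i e i *~ k i) m.+1) ?mul0rz // -dE.
    apply: le_lt_trans (lat_normD f _ _) _; rewrite lat_normN.
    apply: le_lt_trans (lerD fu fv) _; rewrite -natrD ltr_nat /m; lia.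
  move=> a aR; have := pairing_tr_le u aR; have := pairing_tr_le v aR.
  rewrite pairingBl; move: lu lv; rewrite !ler_nat /m; lia.
rewrite -(size_map code) (_ : _ ^ _ = #|{ffun 'I_r -> 'I_m.+1}|)%N; last first.
  by rewrite card_ffun !card_ord /m addnS.
rewrite -card_prod cardE; apply: uniq_leq_size; first by rewrite map_inj_in_uniq.
by move=> z _; rewrite mem_enum.
Qed.
End Growth.

Lemma sum_inv_sqr_le (R : realFieldType) (N : nat) :
  \sum_(i < N.+1) (i.+1%:R ^+ 2)^-1 <= 2 - (N.+1%:R)^-1 :> R.
Proof.
elim: N => [|N IH]; first by rewrite big_ord1 expr1n invr1; lra.
rewrite big_ord_recr /=; apply: le_trans (lerD IH (lexx _)) _.
have n0 : 0 < N.+1%:R :> R by rewrite ltr0n.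
rewrite -[N.+2%:R]natr1; set a : R := N.+1%:R in n0 *.
have a1 : 0 < a + 1 by rewrite addr_gt0.
have : ((a + 1) ^+ 2)^-1 <= a^-1 - (a + 1)^-1.
  rewrite (_ : a^-1 - _ = (a * (a + 1))^-1); last by field; rewrite !gt_eqF.
  by rewrite lef_pV2 ?posrE ?mulr_gt0 ?exprn_gt0 // expr2 ler_wpM2r ?(ltW a1) // lerDl.
by move: (a^-1) (_ ^-1) (_ ^-1) => x y z h; lra.
Qed.

Section Summability.
Context (R : realType) (D : based_root_datum) (f : length_extension R D).
Local Notation W := (weyl D).

Lemma weight_summable : exists b, exists2 B : R, 0 <= B &
  forall F : seq W, uniq F -> \sum_(w <- F) (weight f b w)^-1 <= B.
Proof.
have [K [r count]] := ext_len_count f.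
(* At most [K (4 i + 3)^r <= K 4^r (i + 1)^r] elements have value [i], so two more powers of the
   weight leave the sum of the [(i + 1)^-2], which is at most 2. *)
exists (r + 2)%N, ((K * 4 ^ r)%:R * 2); first by rewrite mulr_ge0.
move=> F uF; pose nl w : nat := sval (cid (ext_len_nat f w)).
have nlE w : ext_len f w = (nl w)%:R by exact: svalP (cid (ext_len_nat f w)).
pose N := (\max_(w <- F) nl w)%N.
have nlN w : w \in F -> (nl w < N.+1)%N.
  by move=> wF; rewrite ltnS /N; exact: leq_bigmax_seq.
rewrite big_seq (partition_big (fun w => inord (nl w) : 'I_N.+1) xpredT) //=.
apply: (@le_trans _ _ (\sum_(i < N.+1) (K * 4 ^ r)%:R * (i.+1%:R ^+ 2)^-1)); last first.
  rewrite -mulr_sumr ler_wpM2l //; apply: le_trans (sum_inv_sqr_le _ _) _.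
  by rewrite gerBl invr_ge0.
apply: ler_sum => i _.
pose G := [seq w <- F | nl w == i].
have -> : \sum_(w <- F | (w \in F) && (inord (nl w) == i)) (weight f (r + 2) w)^-1 =
    \sum_(w <- G) (i.+1%:R ^+ (r + 2))^-1.
  rewrite /G big_filter big_seq_cond [RHS]big_seq_cond; apply: eq_big => [w|w].
    case: (boolP (w \in F)) => //= wF; rewrite -val_eqE /= inordK ?nlN //.
  by move=> /andP[wF /andP[_ /eqP <-]]; rewrite /weight nlE inordK ?nlN // natr1.
rewrite big_const_seq count_predT iter_addr_0 -[_ *+ _]mulr_natl.
have szG : (size G <= K * 4 ^ r * i.+1 ^ r)%N.
  apply: leq_trans (count G i _ _) _; first by rewrite filter_uniq.
    by move=> w; rewrite mem_filter => /andP[/eqP wi _]; rewrite nlE wi.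
  rewrite -mulnA -expnMn leq_mul2l; apply/orP; right.
  by elim: (r) => // k IH; rewrite !expnS leq_mul //; lia.
rewrite exprD invfM mulrA ler_wpM2r ?invr_ge0 ?exprn_ge0 //.
by rewrite ler_pdivrMr ?exprn_gt0 ?ltr0n // -natrX -natrM ler_nat.
Qed.

Lemma finite_ext_len n : finite_set [set w : W | ext_len f w <= n%:R].
Proof.
have [K [r count]] := ext_len_count f; apply: contrapT => inf.
have [B Bn Bc] := infinite_set_fset (K * (4 * n + 3) ^ r).+1 inf.
have := count (enum_fset B) n (fset_uniq _) (fun w wB => Bn w wB).
by move/(leq_trans Bc); rewrite ltnn.
Qed.
End Summability.

(** * Weighted norms *)

Lemma geometric_le (R : realType) (A B K r : R) : 0 <= r < 1 ->
  (forall j : nat, A <= B + K * r ^+ j) -> A <= B.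
Proof.
move=> /andP[r0 r1] H; have rc : r ^+ j @[j --> \oo] --> (0 : R).
  by apply: cvg_expr; rewrite ger0_norm.
have Kc : B + K * r ^+ j @[j --> \oo] --> B + K * 0.
  by apply: cvgD; [exact: cvg_cst|exact: cvgMr].
rewrite mulr0 addr0 in Kc; have := limr_ge (x := A) (cvgP _ Kc).
rewrite (cvg_lim _ Kc) //; apply; near=> j; exact: H.
Unshelve. all: by end_near. Qed.

(** The limit is the common point of nested intervals of radius [g k] about [a k], with [g] such
    that [g k - g k.+1 = G * r ^+ k]; this gives the rate together with the limit. *)
Lemma geometric_limit (R : realType) (a : nat -> R) (G r : R) : 0 <= r < 1 -> 0 <= G ->
  (forall k, `|a k.+1 - a k| <= G * r ^+ k) ->
  exists l, forall k, `|l - a k| <= G * r ^+ k / (1 - r).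
Proof.
move=> /andP[r0 r1] G0 aG; have r1' : 0 < 1 - r by rewrite subr_gt0.
pose g k := G * r ^+ k / (1 - r).
have gS k : g k - g k.+1 = G * r ^+ k.
  by rewrite /g exprS; field; rewrite gt_eqF.
have g0 k : 0 <= g k by rewrite /g divr_ge0 ?mulr_ge0 ?exprn_ge0 // ltW.
pose lo k := a k - g k; pose hi k := a k + g k.
have loS k : lo k <= lo k.+1.
  have := aG k; have := gS k; rewrite /lo ler_norml => h /andP[h1 h2]; lra.
have hiS k : hi k.+1 <= hi k.
  have := aG k; have := gS k; rewrite /hi ler_norml => h /andP[h1 h2]; lra.
have lom : {homo lo : m n / (m <= n)%N >-> m <= n} by apply: homo_leq => // x y z; exact: le_trans.
have him : {homo hi : m n / (m <= n)%N >-> n <= m}.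
  by apply: (@homo_leq _ _ (fun x y => y <= x)) => // y x z xy yz; exact: le_trans yz xy.
have lohi j k : lo j <= hi k.
  apply: le_trans (lom _ _ (leq_maxl j k)) _; apply: le_trans (him _ _ (leq_maxr j k)).
  by rewrite /lo /hi; have := g0 (maxn j k); lra.
have ub : has_ubound (range lo) by exists (hi 0%N) => _ [j _ <-].
exists (sup (range lo)) => k; rewrite ler_norml; apply/andP; split.
  have : lo k <= sup (range lo) by apply: ub_le_sup => //; exists k.
  by rewrite /lo /g; lra.
have : sup (range lo) <= hi k by apply: ge_sup => [|_ [j _ <-]//]; exists (lo 0%N), 0%N.
by rewrite /hi /g; lra.
Qed.

Lemma geometric_limitC (R : realType) (a : nat -> R[i]) (G r : R) : 0 <= r < 1 -> 0 <= G ->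
  (forall k, normc (a k.+1 - a k) <= G * r ^+ k) ->
  exists l, forall k, normc (l - a k) <= 2 * (G * r ^+ k / (1 - r)).
Proof.
move=> r01 G0 aG.
have abs_Re (z : R[i]) : `|complex.Re z| <= normc z.
  case: z => x y /=; rewrite -sqrtr_sqr ler_wsqrtr // lerDl sqr_ge0 //.
have abs_Im (z : R[i]) : `|complex.Im z| <= normc z.
  case: z => x y /=; rewrite -sqrtr_sqr ler_wsqrtr // lerDr sqr_ge0 //.
have normc_le (z : R[i]) : normc z <= `|complex.Re z| + `|complex.Im z|.
  case: z => x y /=; rewrite -[leRHS]ger0_norm ?addr_ge0 // -sqrtr_sqr ler_wsqrtr //.
  by rewrite sqrrD !real_normK ?num_real // addrAC lerDl mulrn_wge0 // mulr_ge0.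
have [l1 l1P] : exists l, forall k, `|l - complex.Re (a k)| <= G * r ^+ k / (1 - r).
  apply: geometric_limit => // k; apply: le_trans (aG k).
  by apply: le_trans (abs_Re _); case: (a k.+1) => ? ?; case: (a k).
have [l2 l2P] : exists l, forall k, `|l - complex.Im (a k)| <= G * r ^+ k / (1 - r).
  apply: geometric_limit => // k; apply: le_trans (aG k).
  by apply: le_trans (abs_Im _); case: (a k.+1) => ? ?; case: (a k).
exists (l1 +i* l2) => k; apply: le_trans (normc_le _) _.
rewrite mulrDl mul1r; apply: lerD.
  by apply: le_trans (l1P k); case: (a k).
by apply: le_trans (l2P k); case: (a k).
Qed.

Section Norms.
Context (R : realType) (D : based_root_datum) (f : length_extension R D).
Local Notation W := (weyl D).
Local Notation C := R[i].
Local Notation S := (schwartz f).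
Implicit Types (x y z : S) (w : W) (n : nat) (F : seq W).

Definition growth_exp : nat := sval (cid (weight_summable f)).
Definition growth_const : R := s2val (cid2 (svalP (cid (weight_summable f)))).

Lemma growth_const_ge0 : 0 <= growth_const.
Proof. exact: (s2valP (cid2 (svalP (cid (weight_summable f))))). Qed.

Lemma growth_constP F : uniq F -> \sum_(w <- F) (weight f growth_exp w)^-1 <= growth_const.
Proof. exact: (s2valP' (cid2 (svalP (cid (weight_summable f))))). Qed.

Lemma schwartz_ext x y : (forall w, x w = y w) -> x = y.
Proof. by move=> xy; apply: val_inj; apply/funext. Qed.

Lemma schwartzDE x y w : (x + y) w = x w + y w. Proof. by []. Qed.
Lemma schwartzNE x w : (- x) w = - x w. Proof. by []. Qed.
Lemma schwartzZE (c : C) x w : (c *: x) w = c * x w. Proof. by []. Qed.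
Lemma schwartz0E w : (0 : S) w = 0. Proof. by []. Qed.

Definition wsum n (phi : W -> C) F : R := \sum_(w <- F) normc (phi w) * weight f n w.

Lemma wsum_le_seminorm n x F : uniq F ->
  wsum n x F <= growth_const * seminorm (n + growth_exp) x.
Proof.
move=> uF; apply: (@le_trans _ _
    (\sum_(w <- F) (weight f growth_exp w)^-1 * seminorm (n + growth_exp) x)).
  apply: ler_sum => w _; rewrite [leRHS]mulrC ler_pdivlMr ?weight_gt0 //.
  by rewrite -mulrA -weightD; exact: seminorm_ge.
rewrite -mulr_suml ler_wpM2r ?growth_constP //.
by apply: le_trans (seminorm_ge _ x (w_one D)); rewrite mulr_ge0 ?normc_ge0 ?weight_ge0.
Qed.

Definition l1norm n (x : S) : R := sup [set wsum n x F | F in [set F | uniq F]].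

Lemma l1norm_has_ubound n x : has_ubound [set wsum n x F | F in [set F | uniq F]].
Proof.
by exists (growth_const * seminorm (n + growth_exp) x) => _ [F uF <-]; exact: wsum_le_seminorm.
Qed.

Lemma l1norm_ge n x F : uniq F -> wsum n x F <= l1norm n x.
Proof. by move=> uF; apply: ub_le_sup; [exact: l1norm_has_ubound|exists F]. Qed.

Lemma l1norm_le n x e : (forall F, uniq F -> wsum n x F <= e) -> l1norm n x <= e.
Proof. by move=> H; apply: ge_sup => [|_ [F uF <-]]; [exists (wsum n x [::]), [::]|exact: H]. Qed.

Lemma l1norm_ge0 n x : 0 <= l1norm n x.
Proof. by apply: le_trans (l1norm_ge n x (F := [::]) isT); rewrite /wsum big_nil. Qed.

Lemma l1norm_le_seminorm n x : l1norm n x <= growth_const * seminorm (n + growth_exp) x.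
Proof. by apply: l1norm_le => F; exact: wsum_le_seminorm. Qed.

Lemma seminorm_le_l1norm n x : seminorm n x <= l1norm n x.
Proof.
apply: seminorm_le => w; apply: le_trans (l1norm_ge n x (F := [:: w]) isT).
by rewrite /wsum big_seq1.
Qed.

Lemma l1norm_pointwise n x w : normc (x w) * weight f n w <= l1norm n x.
Proof. exact: le_trans (seminorm_ge n x w) (seminorm_le_l1norm n x). Qed.

Lemma l1normD n x y : l1norm n (x + y) <= l1norm n x + l1norm n y.
Proof.
apply: l1norm_le => F uF; apply: le_trans (lerD (l1norm_ge n x uF) (l1norm_ge n y uF)).
rewrite -big_split; apply: ler_sum => w _ /=.
by rewrite -mulrDl ler_wpM2r ?weight_ge0 //; exact: le_normcD.
Qed.

Lemma normcN (c : C) : normc (- c) = normc c.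
Proof. by case: c => a b /=; rewrite !sqrrN. Qed.

Lemma l1normN n x : l1norm n (- x) = l1norm n x.
Proof.
congr sup; apply/seteqP; split => _ [F uF <-]; exists F => //;
  by apply: eq_bigr => w _; rewrite schwartzNE normcN.
Qed.

Lemma l1normB n x y : l1norm n (x - y) <= l1norm n x + l1norm n y.
Proof. by rewrite -(l1normN n y); exact: l1normD. Qed.

Lemma l1norm_mono m n x : (m <= n)%N -> l1norm m x <= l1norm n x.
Proof.
move=> mn; apply: l1norm_le => F uF; apply: le_trans (l1norm_ge n x uF).
by apply: ler_sum => w _; rewrite ler_wpM2l ?normc_ge0 ?weight_le.
Qed.

Lemma l1norm0 n : l1norm n 0 = 0.
Proof.
apply/eqP; rewrite eq_le l1norm_ge0 andbT; apply: l1norm_le => F _.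
by rewrite /wsum big1 // => w _; rewrite schwartz0E normc0 mul0r.
Qed.

Lemma l1norm_eq0 n x : l1norm n x <= 0 -> x = 0.
Proof.
move=> x0; apply: schwartz_ext => w; apply: eq0_normc; apply/eqP.
have := le_trans (l1norm_pointwise n x w) x0; rewrite pmulr_lle0 ?weight_gt0 // => H.
by rewrite eq_le H normc_ge0.
Qed.
End Norms.

Lemma exists_nat_gt (R : realType) (x : R) : exists N : nat, x < N%:R.
Proof.
by exists (Num.bound `|x|); exact: le_lt_trans (ler_norm x) (archi_boundP (normr_ge0 x)).
Qed.

Section Completeness.
Context (R : realType) (D : based_root_datum) (f : length_extension R D).
Local Notation W := (weyl D).
Local Notation C := R[i].
Local Notation S := (schwartz f).
Implicit Types (x y z : S) (w : W) (n N : nat) (F : seq W).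

Definition cutoff N (phi : W -> C) : W -> C^o :=
  fun w => if ext_len f w <= N%:R then phi w else 0.

Lemma cutoff_fin N phi : finitely_supported (cutoff N phi).
Proof.
apply: sub_finite_set (finite_ext_len f N) => w /=; rewrite /cutoff.
by case: ifP => //; rewrite eqxx.
Qed.

(** Outside the cutoff, one extra power of the weight is worth more than [N.+1]. *)
Lemma cutoff_far N n (phi : W -> C) w :
  normc (phi w - cutoff N phi w) * weight f n w <=
  normc (phi w) * weight f n.+1 w / N.+1%:R.
Proof.
rewrite /cutoff; case: ifP => [_|/negbT]; rewrite ?subrr ?subr0 ?normc0 ?mul0r.
  by rewrite divr_ge0 ?mulr_ge0 ?normc_ge0 ?weight_ge0.
rewrite -ltNge => Nw; rewrite -mulrA ler_wpM2l ?normc_ge0 // ler_pdivlMr ?ltr0n //.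
rewrite /weight exprSr ler_wpM2l ?weight_ge0 // -natr1 lerD2r ltW //.
Qed.

(** Rapid decay is enough to lie in the closure: cutoffs have finite support by polynomial growth,
    and the norm of index [n.+1] controls their error in the norm of index [n]. *)
Lemma in_schwartz_decay (phi : W -> C^o) :
  (forall n, exists B : R, forall w, normc (phi w) * weight f n w <= B) ->
  phi \in in_schwartz f.
Proof.
move=> H; apply/asboolP => n e e0; have [B phiB] := H n.+1.
have [N BN] : exists N : nat, B <= e * N.+1%:R.
  have [N] := exists_nat_gt (B / e); rewrite ltr_pdivrMr // => BN.
  exists N; rewrite mulrC (le_trans (ltW BN)) // ler_wpM2r ?(ltW e0) // ler_nat //.
exists (cutoff N phi) => [|w]; first exact: cutoff_fin.
apply: le_trans (cutoff_far N n phi w) _; rewrite ler_pdivrMr ?ltr0n //.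
exact: le_trans (phiB w) BN.
Qed.

Definition trunc N x : S := Schwartz (in_schwartz_fin f (cutoff_fin N x)).

Lemma trunc_hecke N x : hecke (trunc N x).
Proof. exact: cutoff_fin. Qed.

Lemma truncE N x w : trunc N x w = if ext_len f w <= N%:R then x w else 0.
Proof. by []. Qed.

Lemma l1norm_trunc n N x : l1norm n (trunc N x) <= l1norm n x.
Proof.
apply: l1norm_le => F uF; apply: le_trans (l1norm_ge n x uF).
apply: ler_sum => w _; rewrite ler_wpM2r ?weight_ge0 // truncE; case: ifP => // _.
by rewrite normc0 normc_ge0.
Qed.

Lemma l1norm_sub_trunc n N x : l1norm n (x - trunc N x) <= l1norm n.+1 x / N.+1%:R.
Proof.
apply: l1norm_le => F uF.
apply: le_trans (_ : wsum f n.+1 x F / N.+1%:R <= _).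
  by rewrite /wsum mulr_suml; apply: ler_sum => w _; exact: cutoff_far.
by rewrite ler_wpM2r ?invr_ge0 ?l1norm_ge0 //; exact: l1norm_ge.
Qed.

Lemma hecke_dense n x (e : R) : 0 < e -> exists2 h, hecke h & l1norm n (x - h) <= e.
Proof.
move=> e0; have [N xN] := exists_nat_gt (l1norm n.+1 x / e).
exists (trunc N x); first exact: trunc_hecke.
apply: le_trans (l1norm_sub_trunc n N x) _; rewrite ler_pdivrMr ?ltr0n //.
rewrite ltr_pdivrMr // in xN; rewrite mulrC (le_trans (ltW xN)) //.
by rewrite ler_wpM2r ?(ltW e0) // ler_nat.
Qed.

(** One ratio serves all norms and only the constant depends on [n]. The limit is fixed once, and
    the error is stated for every admissible [G], so that explicit constants survive. *)
Lemma schwartz_complete (a : nat -> S) (r : R) : 0 <= r < 1 ->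
  (forall n, exists G, forall k, l1norm n (a k.+1 - a k) <= G * r ^+ k) ->
  exists z, forall n G, 0 <= G -> (forall k, l1norm n (a k.+1 - a k) <= G * r ^+ k) ->
    forall k, l1norm n (z - a k) <= G * r ^+ k / (1 - r).
Proof.
move=> r01 aG; have /andP[r0 r1] := r01; have r1' : 0 < 1 - r by rewrite subr_gt0.
have aG' n : exists2 G, 0 <= G & forall k, l1norm n (a k.+1 - a k) <= G * r ^+ k.
  have [G H] := aG n; exists G => //.
  by have := H 0%N; rewrite expr0 mulr1; apply: le_trans (l1norm_ge0 _ _).
have subrB3 (p q t : C) : p - q = (p - t) + (t - q) by rewrite addrA subrK.
have [G0 G0_ge0 aG0] := aG' 0%N.
have lim w : exists l : C, forall k, normc (l - a k w) <= 2 * (G0 * r ^+ k / (1 - r)).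
  apply: geometric_limitC => // k; apply: le_trans (aG0 k).
  by have := l1norm_pointwise 0 (a k.+1 - a k) w; rewrite /weight expr0 mulr1.
pose z w : C := sval (cid (lim w)).
have zP w k : normc (z w - a k w) <= 2 * (G0 * r ^+ k / (1 - r)).
  exact: (svalP (cid (lim w)) k).
have tele n G k j : (forall k, l1norm n (a k.+1 - a k) <= G * r ^+ k) -> 0 <= G ->
    l1norm n (a (k + j)%N - a k) <= G * r ^+ k / (1 - r).
  move=> H GG0; have : l1norm n (a (k + j)%N - a k) <= G * r ^+ k / (1 - r) * (1 - r ^+ j).
    elim: j => [|j IH]; first by rewrite addn0 subrr l1norm0 expr0 subrr mulr0.
    rewrite addnS -[a (k + j).+1](subrK (a (k + j)%N)) -addrA.
    apply: le_trans (l1normD _ _ _) _; apply: le_trans (lerD (H _) IH) _.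
    rewrite exprD exprS le_eqVlt; apply/orP; left; apply/eqP; field.
    by rewrite gt_eqF.
  move/le_trans; apply; rewrite ler_piMr ?gerBl ?exprn_ge0 //.
  by rewrite divr_ge0 ?mulr_ge0 ?exprn_ge0 // ltW.
have wsumz n G k F : uniq F -> (forall k, l1norm n (a k.+1 - a k) <= G * r ^+ k) -> 0 <= G ->
    wsum f n (fun w => z w - a k w) F <= G * r ^+ k / (1 - r).
  move=> uF H GG0; pose T := \sum_(w <- F) weight f n w.
  (* On the finite list [F], of total weight [T], pointwise convergence is uniform; [geometric_le]
     lets [j] tend to infinity. *)
  apply: (@geometric_le _ _ _ (T * (2 * (G0 * r ^+ k / (1 - r)))) r) => // j.
  apply: (@le_trans _ _ (wsum f n (a (k + j)%N - a k) F +
      \sum_(w <- F) 2 * (G0 * r ^+ (k + j) / (1 - r)) * weight f n w)).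
    rewrite /wsum -big_split; apply: ler_sum => w _ /=; rewrite -mulrDl.
    rewrite ler_wpM2r ?weight_ge0 // [leRHS]addrC.
    apply: (@le_trans _ _ (normc ((z w - a (k + j)%N w) + (a (k + j)%N w - a k w)))).
      rewrite le_eqVlt; apply/orP; left; apply/eqP; congr normc.
      exact: (subrB3 (z w) (a k w) (a (k + j)%N w)).
    by apply: le_trans (le_normcD _ _) _; rewrite lerD2r.
  apply: lerD; first exact: le_trans (l1norm_ge _ _ uF) (tele _ _ _ _ H GG0).
  rewrite -mulr_sumr -/T exprD le_eqVlt; apply/orP; left; apply/eqP; ring.
have zS : (z : W -> C^o) \in in_schwartz f.
  apply: in_schwartz_decay => n; have [G GG0 H] := aG' n.
  exists (G * r ^+ 0 / (1 - r) + l1norm n (a 0%N)) => w.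
  have := wsumz n G 0%N [:: w] isT H GG0; rewrite /wsum big_seq1 => H1.
  have := lerD H1 (l1norm_pointwise n (a 0%N) w); apply: le_trans.
  rewrite -mulrDl ler_wpM2r ?weight_ge0 // -[X in normc X <= _](subrK (a 0%N w)).
  exact: le_normcD.
exists (Schwartz zS) => n G GG0 H k; apply: l1norm_le => F uF.
exact: (wsumz n G k F uF H GG0).
Qed.
End Completeness.

(** * The Hecke algebra *)

Section HeckeProduct.
Context (R : realType) (D : based_root_datum) (f : length_extension R D).
Local Notation W := (weyl D).
Local Notation C := R[i].
Local Notation S := (schwartz f).
Local Notation "u *w v" := (w_mul u v) (at level 40, left associativity).
Local Notation one := (w_one D).
Implicit Types (x y z : S) (u v w s t : W) (n N : nat) (r : seq W) (phi psi : W -> C).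

(** Empty if the support is infinite, by the default value of [fset_set]. *)
Definition supp phi : seq W := enum_fset (fset_set [set w | phi w != 0]).

Lemma supp_uniq phi : uniq (supp phi). Proof. exact: fset_uniq. Qed.

Lemma suppP phi u : finitely_supported phi -> phi u != 0 -> u \in supp phi.
Proof. by move=> fphi pu; rewrite /supp in_fset_set // inE. Qed.

Lemma big_supp phi r (F : W -> C) : uniq r -> finitely_supported phi ->
  (forall u, phi u != 0 -> u \in r) ->
  \sum_(u <- supp phi) phi u * F u = \sum_(u <- r) phi u * F u.
Proof.
move=> ur fphi rP; have side (s : seq W) :
    \sum_(u <- s) phi u * F u = \sum_(u <- [seq u <- s | phi u != 0]) phi u * F u.
  rewrite big_filter [RHS]big_mkcond; apply: eq_bigr => u _.
  by case: eqVneq => // ->; rewrite mul0r.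
rewrite side [RHS]side; apply: perm_big; apply: uniq_perm.
- by rewrite filter_uniq ?supp_uniq.
- by rewrite filter_uniq.
by move=> u; rewrite !mem_filter; apply: andb_id2l => pu; rewrite suppP // rP.
Qed.

Lemma delta_expand phi r : uniq r -> (forall u, phi u != 0 -> u \in r) ->
  phi = fun w => \sum_(v <- r) phi v * delta C v w.
Proof.
move=> ur rP; apply/funext => w; rewrite /delta; case: (boolP (w \in r)) => wr.
  rewrite (bigD1_seq w) //= eqxx mulr1 big1 ?addr0 // => v vw.
  by rewrite eq_sym (negbTE vw) mulr0.
rewrite big1_seq; first by apply/eqP; apply: contraNT wr => /rP.
by move=> v /= vr; case: eqP wr => [->|_ _]; rewrite ?vr ?mulr0.
Qed.

Lemma delta_expand_supp phi : finitely_supported phi ->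
  phi = fun w => \sum_(v <- supp phi) phi v * delta C v w.
Proof. by move=> fphi; apply: delta_expand (supp_uniq _) _ => v; exact: suppP. Qed.

Section Coefficients.
Context (eta : W -> C).

Definition mulf phi psi : W -> C^o := fun w => \sum_(u <- supp phi) phi u * Lop eta u psi w.

Lemma mulf_seq phi psi r w : uniq r -> finitely_supported phi ->
  (forall u, phi u != 0 -> u \in r) ->
  mulf phi psi w = \sum_(u <- r) phi u * Lop eta u psi w.
Proof. by move=> ur fphi rP; exact: (big_supp (fun u => Lop eta u psi w)). Qed.

Lemma mulf_expand phi psi w : finitely_supported psi ->
  mulf phi psi w = \sum_(u <- supp phi) \sum_(v <- supp psi)
    phi u * psi v * Lop eta u (delta C v) w.
Proof.
move=> fpsi; apply: eq_bigr => u _.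
rewrite {1}(delta_expand_supp fpsi) linear_Lop mulr_sumr.
by apply: eq_bigr => v _; rewrite mulrA.
Qed.

Lemma ext_len_seq_bound r : exists N : nat, forall u, u \in r -> ext_len f u <= N%:R.
Proof.
have [N rN] := exists_nat_gt (\sum_(u <- r) ext_len f u).
exists N => u ur; apply: le_trans (ltW rN); rewrite (big_rem _ ur) /= lerDl.
by rewrite sumr_ge0 // => v _; exact: ext_len_ge0.
Qed.

Lemma mulf_fin phi psi : finitely_supported psi -> finitely_supported (mulf phi psi).
Proof.
move=> fpsi; have [N1 H1] := ext_len_seq_bound (supp phi).
have [N2 H2] := ext_len_seq_bound (supp psi).
apply: sub_finite_set (finite_ext_len f (N1 + N2)) => w /=; rewrite mulf_expand //.
apply: contraR; rewrite -ltNge => wN; apply/eqP; rewrite big1_seq // => u /= us.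
rewrite big1_seq // => v /= vs; rewrite [Lop _ _ _ _](_ : _ = 0) ?mulr0 //.
apply: contraTeq wN => /(@Lop_support _ _ f) wuv; rewrite -leNgt.
by apply: le_trans wuv _; rewrite natrD lerD ?H1 ?H2.
Qed.

Context (etaI : eta_invariant eta).

Lemma mulf_Rop phi psi w : finitely_supported phi -> finitely_supported psi ->
  mulf phi psi w = \sum_(v <- supp psi) psi v * Rop eta v phi w.
Proof.
move=> fphi fpsi; rewrite mulf_expand // exchange_big; apply: eq_bigr => v _ /=.
rewrite [in RHS](delta_expand_supp fphi) linear_Rop mulr_sumr.
by apply: eq_bigr => u _; rewrite Lop_delta_Rop // mulrCA mulrA.
Qed.

(** With [psi] in the middle, [phi] acts by left operators and [chi] by right ones, and these
    commute. *)
Lemma mulfA phi psi chi : finitely_supported phi -> finitely_supported psi ->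
  finitely_supported chi -> mulf phi (mulf psi chi) = mulf (mulf phi psi) chi.
Proof.
move=> fphi fpsi fchi; apply/funext => w; rewrite [RHS]mulf_Rop //; last exact: mulf_fin.
rewrite /mulf; have -> : (fun w => \sum_(u <- supp psi) psi u * Lop eta u chi w) =
    (fun w => \sum_(v <- supp chi) chi v * Rop eta v psi w).
  by apply/funext => w'; exact: mulf_Rop.
under eq_bigr do rewrite linear_Lop mulr_sumr.
under [RHS]eq_bigr do rewrite linear_Rop mulr_sumr.
rewrite exchange_big; apply: eq_bigr => v _; apply: eq_bigr => u _ /=.
by rewrite Lop_Rop // mulrCA.
Qed.

Lemma delta_fin v : finitely_supported (delta C v).
Proof.
apply: (@sub_finite_set _ _ [set v]) => // w /=; rewrite /delta.
by apply: contra_neqP => /eqP /negbTE ->.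
Qed.

Lemma mulf_delta u psi : mulf (delta C u) psi = Lop eta u psi.
Proof.
apply/funext => w; rewrite (@mulf_seq _ _ [:: u]) //.
- by rewrite big_seq1 /delta eqxx mul1r.
- exact: delta_fin.
by move=> v; rewrite /delta inE; case: (v == u) => //; rewrite eqxx.
Qed.

Lemma mulf1r phi : finitely_supported phi -> mulf phi (delta C one) = phi.
Proof.
move=> fphi; apply/funext => w; rewrite /mulf; under eq_bigr do rewrite Lop_delta1.
by rewrite [RHS](congr1 (@^~ w) (delta_expand_supp fphi)).
Qed.

Lemma mulf1l phi : finitely_supported phi -> mulf (delta C one) phi = phi.
Proof.
move=> fphi; apply/funext => w; rewrite mulf_Rop //; last exact: delta_fin.
under eq_bigr do rewrite Rop_delta1.
by rewrite [RHS](congr1 (@^~ w) (delta_expand_supp fphi)).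
Qed.

Lemma mulf_linl (c : C) phi phi' psi w : finitely_supported phi -> finitely_supported phi' ->
  mulf (fun w => c * phi w + phi' w) psi w = c * mulf phi psi w + mulf phi' psi w.
Proof.
move=> fphi fphi'; pose r := undup (supp phi ++ supp phi').
have ur : uniq r by exact: undup_uniq.
have r1 u : phi u != 0 -> u \in r by move=> pu; rewrite mem_undup mem_cat suppP.
have r2 u : phi' u != 0 -> u \in r by move=> pu; rewrite mem_undup mem_cat (suppP fphi') ?orbT.
have r3 u : c * phi u + phi' u != 0 -> u \in r.
  move=> nz; have [p0|/r1//] := eqVneq (phi u) 0; apply: r2.
  by move: nz; rewrite p0 mulr0 add0r.
have f3 : finitely_supported (fun w => c * phi w + phi' w).
  by apply: sub_finite_set (finite_seq r) => u /=; exact: r3.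
rewrite !(@mulf_seq _ _ r) // mulr_sumr -big_split; apply: eq_bigr => u _ /=.
by rewrite mulrDl mulrA.
Qed.

Lemma mulf_linr (c : C) phi psi psi' w :
  mulf phi (fun w => c * psi w + psi' w) w = c * mulf phi psi w + mulf phi psi' w.
Proof.
rewrite /mulf mulr_sumr -big_split; apply: eq_bigr => u _ /=.
have -> : (fun w => c * psi w + psi' w) = (fun w => c * psi w + 1 * psi' w).
  by apply/funext => w'; rewrite mul1r.
by rewrite (linear_op2 _ _ _ _ (linear_Lop _ _)) mul1r mulrDr mulrCA.
Qed.
End Coefficients.
End HeckeProduct.

Section HeckeAlgebra.
Context (R : realType) (D : based_root_datum) (f : length_extension R D).
Local Notation W := (weyl D).
Local Notation C := R[i].
Local Notation S := (schwartz f).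
Local Notation "u *w v" := (w_mul u v) (at level 40, left associativity).
Local Notation one := (w_one D).
Context (q : label R D).
Implicit Types (x y z : S) (u v w s t : W) (n N : nat) (r : seq W) (phi psi : W -> C).

Definition eta_of : W -> C := fun s => (label_param q s)%:C.

(** Two factorizations are compared, of [s w = w t] or, if [s] is a descent, of [w]; both contain
    the same nonzero value of [q]. *)
Lemma label_eq s t w : Saff s -> Saff t -> s *w w = w *w t -> q s = q t.
Proof.
move=> sS tS sw; have q0 := lt0r_neq0 (lab_gt0 q w).
have [h|h] := len_simple_lP w sS.
  have h1 : q (s *w w) = q s * q w by apply: lab_mul; rewrite h (len_Saff sS).
  have h2 : q (w *w t) = q w * q t.
    by apply: lab_mul; rewrite -sw h (len_Saff tS) addn1.
  by apply: (mulIf q0); rewrite -h1 sw h2 mulrC.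
have q1 := lt0r_neq0 (lab_gt0 q (s *w w)).
have h1 : q w = q s * q (s *w w).
  by rewrite -lab_mul (Saff_mulK w sS) // h (len_Saff sS).
have h2 : q w = q (w *w t) * q t.
  by rewrite -lab_mul (Saff_mulrK w tS) // -sw h (len_Saff tS) addn1.
by apply: (mulIf q1); rewrite -h1 h2 sw mulrC.
Qed.

Lemma eta_ofI : eta_invariant eta_of.
Proof.
by move=> s t w sS tS sw; rewrite /eta_of /label_param (label_eq sS tS sw).
Qed.
Hint Resolve eta_ofI : core.

(** The default 0 does not arise for [y] of finite support, as [mulf_fin] then gives a finitely
    supported function. *)
Definition hmul x y : S := insubd (0 : S) (mulf eta_of x y).

Lemma hmulE x y : hecke y -> hmul x y =1 mulf eta_of x y.
Proof.
move=> hy w; rewrite /hmul -[LHS]/(val (insubd _ _) w) insubdK //.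
by apply: in_schwartz_fin; exact: mulf_fin.
Qed.

Lemma hmul_funE x y : hecke y -> hmul x y = mulf eta_of x y :> (W -> C).
Proof. by move=> hy; apply/funext; exact: hmulE. Qed.

Lemma hecke_hmul x y : hecke y -> hecke (hmul x y).
Proof. by move=> hy; rewrite /hecke /= hmul_funE //; exact: mulf_fin. Qed.

Lemma hecke_lin (c : C) x y : hecke x -> hecke y -> hecke (c *: x + y).
Proof.
move=> hx hy; apply: (@sub_finite_set _ _ ([set w | x w != 0] `|` [set w | y w != 0])).
  move=> w nz; have [x0|x0] := eqVneq (x w) 0; last by left.
  right; apply: contra_neq nz => y0.
  by rewrite -[LHS]/(c * x w + y w) x0 y0 mulr0 addr0.
by rewrite finite_setU.
Qed.

Lemma basisN_fun w : basisN f w = delta C w :> (W -> C).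
Proof. by []. Qed.

Lemma hecke_basisN w : hecke (basisN f w).
Proof. exact: delta_fin. Qed.

Lemma basisTE w : basisT f q w = (Num.sqrt (q w))%:C *: basisN f w. Proof. by []. Qed.

Lemma basisT1 : basisT f q one = basisN f one.
Proof. by rewrite basisTE lab_len0 ?len1 // sqrtr1 scale1r. Qed.

Lemma hecke0 : hecke (0 : S).
Proof. by apply: (@sub_finite_set _ _ set0) => // w /negP[]; exact/eqP. Qed.

Lemma hecke_scale (c : C) x : hecke x -> hecke (c *: x).
Proof.
by move=> hx; rewrite -[c *: x]addr0; apply: hecke_lin => //; exact: hecke0.
Qed.

Lemma hecke_basisT w : hecke (basisT f q w).
Proof. exact/hecke_scale/hecke_basisN. Qed.

Lemma hmul_linl (c : C) x x' y : hecke x -> hecke x' -> hecke y ->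
  hmul (c *: x + x') y = c *: hmul x y + hmul x' y.
Proof.
move=> hx hx' hy; apply: schwartz_ext => w; rewrite hmulE // [RHS]/= -[RHS]/(c * hmul x y w + hmul x' y w).
by rewrite (hmulE x hy) (hmulE x' hy) -mulf_linl.
Qed.

Lemma hmul_linr (c : C) x y y' : hecke x -> hecke y -> hecke y' ->
  hmul x (c *: y + y') = c *: hmul x y + hmul x y'.
Proof.
move=> hx hy hy'; apply: schwartz_ext => w; have hy'' := hecke_lin c hy hy'.
rewrite (hmulE x hy'') -[RHS]/(c * hmul x y w + hmul x y' w).
by rewrite (hmulE x hy) (hmulE x hy') -mulf_linr.
Qed.

Lemma hmulA x y z : hecke x -> hecke y -> hecke z -> hmul x (hmul y z) = hmul (hmul x y) z.
Proof.
move=> hx hy hz; apply: schwartz_ext => w; rewrite !hmulE ?hmul_funE //.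
  by rewrite mulfA.
exact: hecke_hmul.
Qed.

Lemma hmul1l x : hecke x -> hmul (basisN f one) x = x.
Proof. by move=> hx; apply: schwartz_ext => w; rewrite hmulE // mulf1l. Qed.

Lemma hmul1r x : hecke x -> hmul x (basisN f one) = x.
Proof.
by move=> hx; apply: schwartz_ext => w; rewrite hmulE ?mulf1r //; exact: hecke_basisN.
Qed.

Lemma hmul_basisN u v : len (u *w v) = (len u + len v)%N ->
  hmul (basisN f u) (basisN f v) = basisN f (u *w v).
Proof.
move=> uv; apply: schwartz_ext => w; rewrite hmulE; last exact: hecke_basisN.
by rewrite !basisN_fun mulf_delta Lop_delta.
Qed.

Lemma hmul_Saff s v : Saff s ->
  hmul (basisN f s) (basisN f v) =
  basisN f (s *w v) + (if descent_l s v then eta_of s else 0) *: basisN f v.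
Proof.
move=> sS; apply: schwartz_ext => w; rewrite hmulE; last exact: hecke_basisN.
rewrite schwartzDE schwartzZE !basisN_fun mulf_delta Lop_Saff // lam_delta //.
by congr (_ + _); case: ifP; rewrite ?mul0r.
Qed.

Lemma descent_ss s : Saff s -> descent_l s s.
Proof. by move=> sS; rewrite /descent_l Saff_invol // len1 len_Saff. Qed.

Section Bilinear.
Context (m : S -> S -> S)
  (ml : forall (c : C) x x' y, hecke x -> hecke x' -> hecke y ->
    m (c *: x + x') y = c *: m x y + m x' y)
  (mr : forall (c : C) x y y', hecke x -> hecke y -> hecke y' ->
    m x (c *: y + y') = c *: m x y + m x y').

Lemma bilin0l y : hecke y -> m 0 y = 0.
Proof.
move=> hy; have := ml 1 hecke0 hecke0 hy; rewrite !scale1r addr0 => /eqP.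
by rewrite -subr_eq0 opprD addrA subrr sub0r oppr_eq0 => /eqP.
Qed.

Lemma bilin0r x : hecke x -> m x 0 = 0.
Proof.
move=> hx; have := mr 1 hx hecke0 hecke0; rewrite !scale1r addr0 => /eqP.
by rewrite -subr_eq0 opprD addrA subrr sub0r oppr_eq0 => /eqP.
Qed.

Lemma bilin_scale (a b : C) x y : hecke x -> hecke y ->
  m (a *: x) (b *: y) = (a * b) *: m x y.
Proof.
move=> hx hy; have h0 := hecke0; have hb := hecke_scale b hy.
rewrite -[a *: x]addr0 ml // bilin0l // addr0 -[b *: y]addr0 mr // bilin0r // addr0.
by rewrite scalerA.
Qed.

Lemma bilin_suml y (r : seq W) (c : W -> C) : hecke y ->
  m (\sum_(v <- r) c v *: basisN f v) y = \sum_(v <- r) c v *: m (basisN f v) y.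
Proof.
move=> hy; have hN := hecke_basisN; have h0 := hecke0.
have hsum r' : hecke (\sum_(v <- r') c v *: basisN f v).
  by elim: r' => [|v r' IH]; rewrite ?big_nil // big_cons; apply: hecke_lin.
by elim: r => [|v r IH]; rewrite ?big_nil ?big_cons ?bilin0l // ml // IH.
Qed.

Lemma bilin_sumr x (r : seq W) (c : W -> C) : hecke x ->
  m x (\sum_(v <- r) c v *: basisN f v) = \sum_(v <- r) c v *: m x (basisN f v).
Proof.
move=> hx; have hN := hecke_basisN; have h0 := hecke0.
have hsum r' : hecke (\sum_(v <- r') c v *: basisN f v).
  by elim: r' => [|v r' IH]; rewrite ?big_nil // big_cons; apply: hecke_lin.
by elim: r => [|v r IH]; rewrite ?big_nil ?big_cons ?bilin0r // mr // IH.
Qed.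
End Bilinear.

Lemma sqrt_label_param s : label_param q s * Num.sqrt (q s) = q s - 1.
Proof.
have q0 := lab_gt0 q s; have s0 : 0 < Num.sqrt (q s) by rewrite sqrtr_gt0.
by rewrite /label_param mulrBl mulVf ?gt_eqF // -expr2 sqr_sqrtr // ltW.
Qed.

(** Existence matters as much as uniqueness: [hecke_mul] would be the zero map if no product
    satisfied the relations. *)
Lemma hmul_is_hecke_mul : is_hecke_mul q hmul.
Proof.
split.
- by move=> x y _; exact: hecke_hmul.
- exact: hmul_linl.
- exact: hmul_linr.
- exact: hmulA.
- by move=> x hx; rewrite basisT1 hmul1l.
- by move=> x hx; rewrite basisT1 hmul1r.
- move=> w v wv; rewrite !basisTE (bilin_scale hmul_linl hmul_linr) ?hmul_basisN //;
    try exact: hecke_basisN.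
  by rewrite -rmorphM lab_mul // sqrtrM // ltW // lab_gt0.
move=> s sS; rewrite basisT1 !basisTE (bilin_scale hmul_linl hmul_linr);
  try exact: hecke_basisN.
have ss : Num.sqrt (q s) * Num.sqrt (q s) = q s.
  by rewrite -expr2 sqr_sqrtr // ltW // lab_gt0.
rewrite hmul_Saff // Saff_invol // descent_ss // -rmorphM ss scalerDr addrC !scalerA.
rewrite -!rmorphM; congr (_%:C *: _ + _).
by rewrite -sqrt_label_param -mulrA ss mulrC.
Qed.

Lemma hecke_expand x : hecke x -> x = \sum_(u <- supp x) x u *: basisN f u.
Proof.
move=> hx; apply: schwartz_ext => w.
rewrite [LHS](congr1 (@^~ w) (delta_expand_supp hx)).
by elim/big_rec2: _ => // u y1 y2 _; rewrite schwartzDE schwartzZE basisN_fun => ->.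
Qed.

Section Uniqueness.
Context (m : S -> S -> S) (mP : is_hecke_mul q m).
Let N := basisN f.

Lemma hecke_mul_scale (a b : C) x y : hecke x -> hecke y ->
  m (a *: x) (b *: y) = (a * b) *: m x y.
Proof. exact: (bilin_scale (hecke_mul_linearl mP) (hecke_mul_linearr mP)). Qed.

Lemma basisN_T w : N w = (Num.sqrt (q w))^-1%:C *: basisT f q w.
Proof.
rewrite basisTE scalerA -rmorphM mulVf ?scale1r //.
by rewrite gt_eqF // sqrtr_gt0 lab_gt0.
Qed.

Lemma m_basisN u v : len (u *w v) = (len u + len v)%N -> m (N u) (N v) = N (u *w v).
Proof.
move=> uv; rewrite !basisN_T hecke_mul_scale ?(hecke_mul_length mP) //; try exact: hecke_basisT.
by rewrite lab_mul // sqrtrM ?(ltW (lab_gt0 q u)) // invfM rmorphM.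
Qed.

Lemma m_Saff_sqr s : Saff s -> m (N s) (N s) = eta_of s *: N s + N one.
Proof.
move=> sS; have q0 := lab_gt0 q s; have s0 : 0 < Num.sqrt (q s) by rewrite sqrtr_gt0.
rewrite {1 2}basisN_T hecke_mul_scale ?(hecke_mul_quadratic mP) //; try exact: hecke_basisT.
rewrite basisT1 basisTE scalerDr !scalerA -!rmorphM -invfM -expr2 sqr_sqrtr ?ltW //.
rewrite mulVf ?gt_eqF // scale1r; congr (_%:C *: _ + _).
rewrite -sqrt_label_param -{1}[q s]sqr_sqrtr ?ltW //; field.
by rewrite gt_eqF.
Qed.

Lemma m_Saff s v : Saff s -> m (N s) (N v) = hmul (N s) (N v).
Proof.
move=> sS; have hN := hecke_basisN; rewrite hmul_Saff //.
have [h|h] := len_simple_lP v sS.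
  rewrite m_basisN ?h ?(len_Saff sS) // /descent_l h ltnNge leqnSn /= scale0r addr0 //.
(* At a descent [N_v] has the left factor [N_s], and the quadratic relation applies to the square of
   [N_s]. *)
have svE : m (N s) (N (s *w v)) = N v.
  by rewrite m_basisN ?Saff_mulK // h (len_Saff sS).
rewrite /descent_l h ltnSn -[in LHS]svE (hecke_mulA mP) //; try exact: hN.
rewrite m_Saff_sqr // (hecke_mul_linearl mP) //; try exact: hN.
have -> : N one = basisT f q one by rewrite basisT1.
by rewrite svE (hecke_mul1l mP) 1?addrC //; exact: hN.
Qed.

(** Induction on the length of [u], one letter at a time by associativity; the inner product is
    expanded in the basis so that [m_Saff] applies. *)
Lemma m_basis u v : m (N u) (N v) = hmul (N u) (N v).
Proof.
have hN := hecke_basisN; have [k] := ubnP (len u); elim: k u v => // k IH u v uk.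
have [u0|u0] := posnP (len u).
  by rewrite m_basisN ?hmul_basisN // (len_mul0l _ u0) u0.
have [s sS su] := exists_left_descent u0.
have uE : N u = m (N s) (N (s *w u)) by rewrite m_basisN Saff_mulK // su (len_Saff sS).
have uE' : N u = hmul (N s) (N (s *w u)) by rewrite hmul_basisN Saff_mulK // su (len_Saff sS).
rewrite {1}uE uE' -(hecke_mulA mP) //; try exact: hN.
rewrite -hmulA //; try exact: hN.
rewrite IH; last by rewrite su in uk.
have hh : hecke (hmul (N (s *w u)) (N v)) by exact: hecke_hmul.
rewrite (hecke_expand hh) (bilin_sumr (hecke_mul_linearr mP)) // (bilin_sumr hmul_linr) //.
by apply: eq_bigr => w _; rewrite m_Saff.
Qed.

Lemma hecke_mul_unique x y : hecke x -> hecke y -> m x y = hmul x y.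
Proof.
move=> hx hy; have hN := hecke_basisN.
rewrite (hecke_expand hx) (bilin_suml (hecke_mul_linearl mP)) // (bilin_suml hmul_linl) //.
apply: eq_bigr => u _; congr (_ *: _).
rewrite (hecke_expand hy) (bilin_sumr (hecke_mul_linearr mP)) // (bilin_sumr hmul_linr) //.
by apply: eq_bigr => v _; rewrite m_basis.
Qed.
End Uniqueness.

Lemma hecke_mulE x y : hecke x -> hecke y -> @hecke_mul R D f q x y = hmul x y.
Proof.
apply: hecke_mul_unique; rewrite /hecke_mul.
have := @xgetPex _ (fun _ _ => 0) [set m | @is_hecke_mul R D f q m].
by apply; exists hmul; exact: hmul_is_hecke_mul.
Qed.
End HeckeAlgebra.

(** * Norm estimates for the product, uniform in the label *)

Section Estimates.
Context (R : realType) (D : based_root_datum) (f : length_extension R D).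
Local Notation W := (weyl D).
Local Notation C := R[i].
Local Notation S := (schwartz f).
Local Notation one := (w_one D).
Implicit Types (x y z : S) (u v w s t : W) (n N : nat) (r : seq W) (M : R).

Definition nroots : nat := size (roots D).

Definition label_bounded M (q : label R D) : Prop :=
  1 <= M /\ forall s, Saff s -> `|label_param q s| <= M.

(** The constant of the product estimate: at most [nroots] factors, each bounded by the majorant
    [2 * M]. *)
Definition mul_const M : R := (2 * M) ^+ nroots.

Lemma mul_const_ge0 M : 1 <= M -> 0 <= mul_const M.
Proof. by move=> M1; rewrite exprn_ge0 //; lra. Qed.

Lemma normc_sum (I : Type) (r : seq I) (F : I -> C) :
  normc (\sum_(i <- r) F i) <= \sum_(i <- r) normc (F i).
Proof.
elim: r => [|i r IH]; first by rewrite !big_nil normc0.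
by rewrite !big_cons; apply: le_trans (le_normcD _ _) _; rewrite lerD2l.
Qed.

Lemma normc_real (a : R) : normc a%:C = `|a|.
Proof. by rewrite /normc /= expr0n addr0 sqrtr_sqr. Qed.

Lemma normc_delta v w : normc (delta C v w) = delta R v w.
Proof. by rewrite /delta; case: (w == v); rewrite ?normc0 // -[1]/(1%:C) normc_real normr1. Qed.

(** Stated for an arbitrary kernel so as to serve both the product, with [c = 1], and its variation
    with the label, with [c] the distance of the labels. *)
Lemma kernel_bound (kappa : W -> W -> W -> C) (c M : R) n x y (g : W -> C) r : 1 <= M -> 0 <= c ->
  hecke x -> hecke y ->
  (forall u v w, normc (kappa u v w) <= c * Lop (fun=> 2 * M) u (delta R v) w) ->
  (forall w, g w = \sum_(u <- supp x) \sum_(v <- supp y) x u * y v * kappa u v w) -> uniq r ->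
  wsum f n g r <= c * mul_const M * (l1norm nroots x * l1norm n y +
    n%:R * l1norm (nroots + n) x * l1norm n.-1 y).
Proof.
move=> M1 c0 hx hy kL gE ur; pose sx := supp x; pose sy := supp y.
have C0 : 0 <= mul_const M := mul_const_ge0 M1.
pose A u v := mul_const M * weight f nroots u *
    (weight f n v + n%:R * weight f n u * weight f n.-1 v).
apply: (@le_trans _ _ (\sum_(u <- sx) \sum_(v <- sy) normc (x u) * normc (y v) * (c * A u v))).
  rewrite /wsum; apply: (@le_trans _ _ (\sum_(w <- r) \sum_(u <- sx) \sum_(v <- sy)
      normc (x u) * normc (y v) * (c * (Lop (fun=> 2 * M) u (delta R v) w * weight f n w)))).
    apply: ler_sum => w _; rewrite gE.
    apply: (@le_trans _ _ ((\sum_(u <- sx) \sum_(v <- sy)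
        normc (x u * y v * kappa u v w)) * weight f n w)).
      rewrite ler_wpM2r ?weight_ge0 //; apply: le_trans (normc_sum _ _) _.
      by apply: ler_sum => u _; exact: normc_sum.
    rewrite mulr_suml; apply: ler_sum => u _; rewrite mulr_suml; apply: ler_sum => v _.
    have -> : normc (x u * y v * kappa u v w) =
        normc (x u) * normc (y v) * normc (kappa u v w).
      by rewrite (normcM (x u * y v) (kappa u v w)) (normcM (x u) (y v)).
    rewrite -[leLHS]mulrA; apply: ler_wpM2l; first by rewrite mulr_ge0 ?normc_ge0.
    by rewrite mulrA ler_wpM2r ?weight_ge0.
  rewrite exchange_big; apply: ler_sum => u _ /=; rewrite exchange_big; apply: ler_sum => v _ /=.
  rewrite -mulr_sumr ler_wpM2l ?mulr_ge0 ?normc_ge0 // -mulr_sumr ler_wpM2l //.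
  by apply: Lop_weight => //; lra.
have -> : \sum_(u <- sx) \sum_(v <- sy) normc (x u) * normc (y v) * (c * A u v) =
    c * mul_const M * (wsum f nroots x sx * wsum f n y sy +
      n%:R * wsum f (nroots + n) x sx * wsum f n.-1 y sy).
  have inner u : \sum_(v <- sy) normc (x u) * normc (y v) * (c * A u v) = c * mul_const M *
      (normc (x u) * weight f nroots u * wsum f n y sy +
       n%:R * (normc (x u) * weight f (nroots + n) u) * wsum f n.-1 y sy).
    rewrite /wsum weightD !mulr_sumr -big_split mulr_sumr; apply: eq_bigr => v _ /=.
    by rewrite /A; ring.
  under eq_bigr do rewrite inner.
  by rewrite -mulr_sumr big_split /= -!mulr_suml -mulr_sumr.
rewrite ler_wpM2l ?mulr_ge0 //.
have L m z : 0 <= wsum f m z (supp z) <= l1norm m z.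
  rewrite l1norm_ge ?supp_uniq // andbT sumr_ge0 // => w _.
  by rewrite mulr_ge0 ?normc_ge0 ?weight_ge0.
have /andP[a1 b1] := L nroots x; have /andP[a2 b2] := L n y.
have /andP[a3 b3] := L (nroots + n)%N x; have /andP[a4 b4] := L n.-1 y.
by rewrite lerD // ?ler_pM ?mulr_ge0 // ler_wpM2l.
Qed.

Lemma Lop_diff (q q' : label R D) M d u v w : label_bounded M q -> label_bounded M q' ->
  0 <= d -> (forall s, Saff s -> `|label_param q s - label_param q' s| <= d) ->
  normc (Lop (eta_of q') u (delta C v) w) <= Lop (fun=> 2 * M) u (delta R v) w /\
  normc (Lop (eta_of q) u (delta C v) w - Lop (eta_of q') u (delta C v) w) <=
    d * Lop (fun=> 2 * M) u (delta R v) w.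
Proof.
move=> [M1 qM] [_ q'M] d0 qq; have [lS _ _ _] := reducedP u.
rewrite /Lop !shiftl_delta; apply: opl_diff_majorant => //.
- by move=> s sS; rewrite normc_real qM.
- by move=> s sS; rewrite normc_real q'M.
- by move=> s sS; rewrite /eta_of -rmorphB normc_real qq.
- by move=> w'; rewrite normc_delta.
by move=> w'; rewrite subrr normc0 mulr_ge0 // ler0n.
Qed.

Lemma l1norm_hmul (q : label R D) M n x y : label_bounded M q -> hecke x -> hecke y ->
  l1norm n (hmul q x y) <= mul_const M * (l1norm nroots x * l1norm n y +
    n%:R * l1norm (nroots + n) x * l1norm n.-1 y).
Proof.
move=> qM hx hy; have [M1 _] := qM; apply: l1norm_le => F uF; rewrite -[mul_const M]mul1r.
apply: (@kernel_bound (fun u v w => Lop (eta_of q) u (delta C v) w)) => //.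
  move=> u v w; rewrite mul1r.
  have [] // := @Lop_diff q q M 0 u v w qM qM (lexx _) _.
  by move=> s _; rewrite subrr normr0.
by move=> w; rewrite hmulE // mulf_expand.
Qed.

Lemma l1norm_hmul_label (q q' : label R D) M n x y :
  label_bounded M q -> label_bounded M q' -> hecke x -> hecke y ->
  l1norm n (hmul q x y - hmul q' x y) <= label_dist q q' * mul_const M *
    (l1norm nroots x * l1norm n y + n%:R * l1norm (nroots + n) x * l1norm n.-1 y).
Proof.
move=> qM q'M hx hy; have [M1 _] := qM; apply: l1norm_le => F uF.
apply: (@kernel_bound (fun u v w => Lop (eta_of q) u (delta C v) w - Lop (eta_of q') u (delta C v) w)) => //.
- exact: label_dist_ge0.
- move=> u v w; have [] // := @Lop_diff q q' M (label_dist q q') u v w qM q'M.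
    exact: label_dist_ge0.
  by move=> s; exact: label_dist_ge.
move=> w; have H p : hmul p x y w = \sum_(u <- supp x) \sum_(v <- supp y)
    x u * y v * Lop (eta_of p) u (delta C v) w by rewrite hmulE // mulf_expand.
have E (a b : S) : (a - b) w = a w - b w by rewrite schwartzDE schwartzNE.
apply: etrans (E _ _) _; apply: etrans (f_equal2 (fun a b => a - b) (H q) (H q')) _.
rewrite -sumrB; apply: eq_bigr => u _; rewrite -sumrB; apply: eq_bigr => v _.
by rewrite mulrBr.
Qed.

Lemma label_bounded_ball (q0 : label R D) : exists M, forall q,
  label_dist q0 q < 1 -> label_bounded M q.
Proof.
pose A := [set `|label_param q0 s| | s in @Saff D].
have [B HB] : has_ubound A.
  by apply: finite_has_ubound; apply: finite_image; exact: finite_Saff.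
exists (2 + `|B|) => q qq; split => [|s sS]; first by have := normr_ge0 B; lra.
have h1 : `|label_param q0 s| <= B by apply: HB; exists s.
have h2 := label_dist_ge q0 q sS.
have h3 : `|label_param q s| <= `|label_param q0 s| + `|label_param q0 s - label_param q s|.
  by rewrite -[X in `|X| <= _](subKr (label_param q0 s)) ler_normB.
have := ler_norm B; lra.
Qed.
End Estimates.

(** * The Schwartz algebra *)

Section SchwartzProduct.
Context (R : realType) (D : based_root_datum) (f : length_extension R D).
Local Notation W := (weyl D).
Local Notation C := R[i].
Local Notation S := (schwartz f).
Local Notation one := (w_one D).
Local Notation nu := (nroots D).
Local Notation half := (2^-1 : R).
Implicit Types (x y z : S) (u v w s t : W) (n N : nat) (a b : nat -> S).

Lemma half01 : 0 <= half < 1.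
Proof. by rewrite invr_ge0 ler0n invf_lt1 ?ltr1n. Qed.

(** Fixing the rate of convergence makes [schwartz_complete] and [geometric_le] applicable; [approx]
    attains this rate for every element. *)
Definition rapid_cvg a z : Prop :=
  forall n, exists2 G : R, 0 <= G & forall k, l1norm n (z - a k) <= G * half ^+ k.

Lemma l1norm_distC n x y : l1norm n (x - y) = l1norm n (y - x).
Proof. by rewrite -l1normN opprB. Qed.

Lemma l1norm_distD n z x y : l1norm n (x - y) <= l1norm n (x - z) + l1norm n (z - y).
Proof. by rewrite -[x - y](subrKA z); exact: l1normD. Qed.

Lemma rapid_cvg_unique a x y : rapid_cvg a x -> rapid_cvg a y -> x = y.
Proof.
move=> /(_ 0%N)[G _ aG] /(_ 0%N)[H _ aH]; apply/eqP; rewrite -subr_eq0; apply/eqP.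
apply: (@l1norm_eq0 _ _ _ 0); apply: (@geometric_le _ _ _ (G + H) _ half01) => k.
rewrite add0r mulrDl; apply: le_trans (l1norm_distD 0 (a k) x y) _.
by rewrite lerD // l1norm_distC.
Qed.

Lemma rapid_cvgD a b x y : rapid_cvg a x -> rapid_cvg b y ->
  rapid_cvg (fun k => a k + b k) (x + y).
Proof.
move=> ax bY n; have [G G0 aG] := ax n; have [H H0 bH] := bY n.
exists (G + H) => [|k]; first exact: addr_ge0.
by rewrite opprD addrACA mulrDl; apply: le_trans (l1normD _ _ _) _; rewrite lerD.
Qed.

Lemma rapid_cvgN a x : rapid_cvg a x -> rapid_cvg (fun k => - a k) (- x).
Proof.
move=> ax n; have [G G0 aG] := ax n; exists G => // k.
by rewrite -opprD l1normN.
Qed.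

Lemma rapid_cvg_cst x : rapid_cvg (fun=> x) x.
Proof. by move=> n; exists 0 => // k; rewrite subrr l1norm0 mul0r. Qed.

(** A cutoff at [N] gains a factor [1 / (N + 1)], so cutoffs at powers of 2 converge at the rate of
    [rapid_cvg]. *)
Definition approx x k : S := trunc (2 ^ k) x.

Lemma approx_hecke x k : hecke (approx x k). Proof. exact: trunc_hecke. Qed.

Lemma l1norm_approx n x k : l1norm n (approx x k) <= l1norm n x.
Proof. exact: l1norm_trunc. Qed.

Lemma l1norm_sub_approx n x k : l1norm n (x - approx x k) <= l1norm n.+1 x * half ^+ k.
Proof.
apply: le_trans (l1norm_sub_trunc n (2 ^ k) x) _; rewrite ler_wpM2l ?l1norm_ge0 //.
by rewrite exprVn lef_pV2 ?posrE ?exprn_gt0 ?ltr0n // -natrX ler_nat.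
Qed.

Lemma approx_cvg x : rapid_cvg (approx x) x.
Proof.
move=> n; exists (l1norm n.+1 x); first exact: l1norm_ge0.
by move=> k; exact: l1norm_sub_approx.
Qed.

Lemma hecke_sub x y : hecke x -> hecke y -> hecke (x - y).
Proof. by move=> hx hy; rewrite addrC -scaleN1r; exact: hecke_lin. Qed.

Section Label.
Context (q : label R D).

Lemma hmulBl x x' y : hecke x -> hecke x' -> hecke y ->
  hmul q (x - x') y = hmul q x y - hmul q x' y.
Proof. by move=> hx hx' hy; rewrite addrC -scaleN1r hmul_linl // scaleN1r addrC. Qed.

Lemma hmulBr x y y' : hecke x -> hecke y -> hecke y' ->
  hmul q x (y - y') = hmul q x y - hmul q x y'.
Proof. by move=> hx hy hy'; rewrite addrC -scaleN1r hmul_linr // scaleN1r addrC. Qed.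

Lemma label_boundedP : exists M, label_bounded M q.
Proof.
have [M H] := label_bounded_ball q; exists M; apply: H.
by rewrite label_distxx.
Qed.

Lemma l1norm_hmul_crude n : exists2 K : R, 0 <= K & forall x y, hecke x -> hecke y ->
  l1norm n (hmul q x y) <= K * (l1norm (nu + n) x * l1norm n y).
Proof.
have [M qM] := label_boundedP; have C0 := mul_const_ge0 D qM.1.
exists (mul_const D M * n.+1%:R) => [|x y hx hy]; first by rewrite mulr_ge0.
apply: le_trans (l1norm_hmul n qM hx hy) _; rewrite -[leRHS]mulrA ler_wpM2l //.
rewrite -natr1 [leRHS]mulrDl mul1r addrC lerD //.
  rewrite -mulrA ler_wpM2l // ler_wpM2l ?l1norm_ge0 // l1norm_mono // leq_pred //.
by rewrite ler_wpM2r ?l1norm_ge0 // l1norm_mono // leq_addr.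
Qed.

Lemma hmul_diff n : exists2 K : R, 0 <= K & forall x y h g,
  hecke x -> hecke y -> hecke h -> hecke g ->
  l1norm n (hmul q x y - hmul q h g) <=
  K * (l1norm (nu + n) (x - h) * l1norm n y + l1norm (nu + n) h * l1norm n (y - g)).
Proof.
have [K K0 HK] := l1norm_hmul_crude n; exists K => // x y h g hx hy hh hg.
have -> : hmul q x y - hmul q h g = hmul q (x - h) y + hmul q h (y - g).
  by rewrite hmulBl // hmulBr // subrKA.
apply: le_trans (l1normD _ _ _) _; rewrite mulrDr.
by rewrite lerD // HK //; exact: hecke_sub.
Qed.

Lemma smul_exists x y : exists z, rapid_cvg (fun k => hmul q (approx x k) (approx y k)) z.
Proof.
have bnd n : exists2 G, 0 <= G & forall k,
    l1norm n (hmul q (approx x k.+1) (approx y k.+1) - hmul q (approx x k) (approx y k)) <=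
    G * half ^+ k.
  have [K K0 HK] := hmul_diff n.
  have step m z k : l1norm m (approx z k.+1 - approx z k) <= 2 * l1norm m.+1 z * half ^+ k.
    apply: le_trans (l1norm_distD m z _ _) _; rewrite l1norm_distC.
    apply: le_trans (lerD (l1norm_sub_approx _ _ _) (l1norm_sub_approx _ _ _)) _.
    rewrite exprS; have := mulr_ge0 (l1norm_ge0 m.+1 z) (exprn_ge0 k (andP half01).1).
    rewrite mulrCA -[2 * _ * _]mulrA mulrDl mul1r => p0; rewrite lerD2r ler_piMl //.
    by rewrite ltW // (andP half01).2.
  exists (K * (2 * l1norm (nu + n).+1 x * l1norm n y + l1norm (nu + n) x * (2 * l1norm n.+1 y))).
    by rewrite mulr_ge0 // addr_ge0 // !mulr_ge0 // l1norm_ge0.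
  move=> k; apply: le_trans (HK _ _ _ _ _ _ _ _) _; try exact: approx_hecke.
  rewrite -[leRHS]mulrA ler_wpM2l // mulrDl; apply: lerD.
    by rewrite [leRHS]mulrAC; apply: ler_pM; rewrite ?l1norm_ge0 ?l1norm_approx ?step.
  by rewrite -[leRHS]mulrA; apply: ler_pM; rewrite ?l1norm_ge0 ?l1norm_approx ?step.
have [z zP] := schwartz_complete half01 (fun n => let: ex_intro2 G _ H := bnd n in ex_intro _ G H).
exists z => n; have [G G0 H] := bnd n; exists (2 * G); first by rewrite mulr_ge0.
move=> k; apply: le_trans (zP n G G0 H k) _.
have -> : 1 - half = half by rewrite {1}(splitr 1) div1r addrK.
by rewrite invrK mulrC mulrA.
Qed.

Definition smul x y : S := sval (cid (smul_exists x y)).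

Lemma smul_approx x y : rapid_cvg (fun k => hmul q (approx x k) (approx y k)) (smul x y).
Proof. exact: svalP (cid (smul_exists x y)). Qed.

(** Only finitely supported [h] and [g] are compared with [x] and [y]: this is the estimate required
    by a limit taken within the Hecke algebra. *)
Lemma smul_diff n : exists2 K : R, 0 <= K & forall x y h g, hecke h -> hecke g ->
  l1norm n (smul x y - hmul q h g) <=
  K * (l1norm (nu + n) (x - h) * l1norm n y + l1norm (nu + n) h * l1norm n (y - g)).
Proof.
have [K K0 HK] := hmul_diff n; exists K => // x y h g hh hg.
have [G G0 HG] := smul_approx x y n.
apply: (@geometric_le _ _ _ (G + K * (l1norm (nu + n).+1 x * l1norm n y +
  l1norm (nu + n) h * l1norm n.+1 y)) _ half01) => k.
apply: le_trans (l1norm_distD n (hmul q (approx x k) (approx y k)) _ _) _.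
apply: le_trans (lerD (HG k) (HK _ _ _ _ (approx_hecke x k) (approx_hecke y k) hh hg)) _.
have near m z h' : l1norm m (approx z k - h') <= l1norm m (z - h') + l1norm m.+1 z * half ^+ k.
  apply: le_trans (l1norm_distD m z _ _) _; rewrite addrC lerD2l l1norm_distC.
  exact: l1norm_sub_approx.
apply: (@le_trans _ _ (G * half ^+ k + K *
    ((l1norm (nu + n) (x - h) + l1norm (nu + n).+1 x * half ^+ k) * l1norm n y +
     l1norm (nu + n) h * (l1norm n (y - g) + l1norm n.+1 y * half ^+ k)))).
  rewrite lerD2l ler_wpM2l //; apply: lerD.
    by apply: ler_pM; rewrite ?l1norm_ge0 // l1norm_approx.
  by rewrite ler_wpM2l ?l1norm_ge0.
by rewrite le_eqVlt; apply/orP; left; apply/eqP; ring.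
Qed.

(** Together with [rapid_cvg_unique], this carries the algebraic identities over from finitely
    supported elements. *)
Lemma smul_cvg a b x y : (forall k, hecke (a k)) -> (forall k, hecke (b k)) ->
  rapid_cvg a x -> rapid_cvg b y -> rapid_cvg (fun k => hmul q (a k) (b k)) (smul x y).
Proof.
move=> ha hb ax bY n; have [K K0 HK] := smul_diff n.
have [G G0 HG] := ax (nu + n)%N; have [H H0 HH] := bY n.
exists (K * (G * l1norm n y + (l1norm (nu + n) x + G) * H)).
  by rewrite mulr_ge0 // addr_ge0 ?mulr_ge0 ?addr_ge0 ?l1norm_ge0.
move=> k; apply: le_trans (HK x y _ _ (ha k) (hb k)) _.
rewrite -[leRHS]mulrA ler_wpM2l // mulrDl; apply: lerD.
  by rewrite [leRHS]mulrAC ler_wpM2r ?l1norm_ge0.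
rewrite -[leRHS]mulrA; apply: ler_pM; rewrite ?l1norm_ge0 //.
rewrite -[a k](subKr x); apply: le_trans (l1normB _ _ _) _; rewrite lerD2l.
apply: le_trans (HG k) _; rewrite ler_piMr // exprn_ile1 //; lra.
Qed.

Lemma smulBl x x' y : smul (x - x') y = smul x y - smul x' y.
Proof.
apply: (@rapid_cvg_unique (fun k => hmul q (approx x k - approx x' k) (approx y k))).
  apply: smul_cvg => [k|k||]; try exact: approx_hecke.
  - by apply: hecke_sub; exact: approx_hecke.
  - by apply: rapid_cvgD; [|apply: rapid_cvgN]; exact: approx_cvg.
  exact: approx_cvg.
rewrite (_ : (fun k => _) = (fun k => hmul q (approx x k) (approx y k) +
    - hmul q (approx x' k) (approx y k))).
  by apply: rapid_cvgD; [|apply: rapid_cvgN]; exact: smul_approx.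
by apply/funext => k; rewrite hmulBl //; exact: approx_hecke.
Qed.

Lemma smulBr x y y' : smul x (y - y') = smul x y - smul x y'.
Proof.
apply: (@rapid_cvg_unique (fun k => hmul q (approx x k) (approx y k - approx y' k))).
  apply: smul_cvg => [k|k||]; try exact: approx_hecke.
  - by apply: hecke_sub; exact: approx_hecke.
  - exact: approx_cvg.
  by apply: rapid_cvgD; [|apply: rapid_cvgN]; exact: approx_cvg.
rewrite (_ : (fun k => _) = (fun k => hmul q (approx x k) (approx y k) +
    - hmul q (approx x k) (approx y' k))).
  by apply: rapid_cvgD; [|apply: rapid_cvgN]; exact: smul_approx.
by apply/funext => k; rewrite hmulBr //; exact: approx_hecke.
Qed.

Lemma smulA x y z : smul x (smul y z) = smul (smul x y) z.
Proof.
pose a k := hmul q (approx x k) (hmul q (approx y k) (approx z k)).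
have hA := approx_hecke; have cA := approx_cvg.
apply: (@rapid_cvg_unique a).
  by apply: smul_cvg => // [k|]; [exact: hecke_hmul|exact: smul_approx].
rewrite (_ : a = fun k => hmul q (hmul q (approx x k) (approx y k)) (approx z k)); last first.
  by apply/funext => k; rewrite /a hmulA.
by apply: smul_cvg => // [k|]; [exact: hecke_hmul|exact: smul_approx].
Qed.

Lemma smul1l x : smul (basisN f one) x = x.
Proof.
apply: (@rapid_cvg_unique (fun k => hmul q (basisN f one) (approx x k))).
  apply: smul_cvg => [k|k||]; [exact: hecke_basisN|exact: approx_hecke| |exact: approx_cvg].
  exact: rapid_cvg_cst.
rewrite (_ : (fun k => _) = approx x); first exact: approx_cvg.
by apply/funext => k; rewrite hmul1l //; exact: approx_hecke.
Qed.

Lemma smul1r x : smul x (basisN f one) = x.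
Proof.
apply: (@rapid_cvg_unique (fun k => hmul q (approx x k) (basisN f one))).
  apply: smul_cvg => [k|k||]; [exact: approx_hecke|exact: hecke_basisN|exact: approx_cvg|].
  exact: rapid_cvg_cst.
rewrite (_ : (fun k => _) = approx x); first exact: approx_cvg.
by apply/funext => k; rewrite hmul1r //; exact: approx_hecke.
Qed.

Lemma l1norm_smul M n x y : label_bounded M q ->
  l1norm n (smul x y) <= mul_const D M * (l1norm nu x * l1norm n y +
    n%:R * l1norm (nu + n) x * l1norm n.-1 y).
Proof.
move=> qM; have [G G0 HG] := smul_approx x y n.
apply: (@geometric_le _ _ _ G _ half01) => k.
rewrite -[smul x y](subrK (hmul q (approx x k) (approx y k))) addrC.
apply: le_trans (l1normD _ _ _) _; apply: lerD => //.
apply: le_trans (l1norm_hmul n qM (approx_hecke x k) (approx_hecke y k)) _.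
rewrite ler_wpM2l ?mul_const_ge0 ?qM.1 //; apply: lerD.
  by apply: ler_pM; rewrite ?l1norm_ge0 ?l1norm_approx.
apply: ler_pM; rewrite ?mulr_ge0 ?l1norm_ge0 ?l1norm_approx //.
by rewrite ler_wpM2l ?l1norm_approx.
Qed.
End Label.

Lemma l1norm_smul_label (q q' : label R D) M n x y :
  label_bounded M q -> label_bounded M q' ->
  l1norm n (smul q x y - smul q' x y) <= label_dist q q' * mul_const D M *
    (l1norm nu x * l1norm n y + n%:R * l1norm (nu + n) x * l1norm n.-1 y).
Proof.
move=> qM q'M; have [G G0 HG] := smul_approx q x y n; have [H H0 HH] := smul_approx q' x y n.
apply: (@geometric_le _ _ _ (G + H) _ half01) => k.
apply: le_trans (l1norm_distD n (hmul q (approx x k) (approx y k)) _ _) _.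
rewrite mulrDl [leRHS]addrCA; apply: lerD; first exact: HG.
apply: le_trans (l1norm_distD n (hmul q' (approx x k) (approx y k)) _ _) _.
apply: lerD; last by rewrite l1norm_distC; exact: HH.
apply: le_trans (l1norm_hmul_label n qM q'M (approx_hecke x k) (approx_hecke y k)) _.
rewrite ler_wpM2l ?mulr_ge0 ?label_dist_ge0 ?mul_const_ge0 ?qM.1 //.
apply: lerD; first by apply: ler_pM; rewrite ?l1norm_ge0 ?l1norm_approx.
apply: ler_pM; rewrite ?mulr_ge0 ?l1norm_ge0 ?l1norm_approx //.
by rewrite ler_wpM2l ?l1norm_approx.
Qed.
End SchwartzProduct.

(** * The topology and the product as a limit *)

Section Topology.
Context (R : realType) (D : based_root_datum) (f : length_extension R D).
Local Notation W := (weyl D).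
Local Notation C := R[i].
Local Notation S := (schwartz f).
Local Notation nu := (nroots D).
Implicit Types (x y z : S) (n : nat) (q : label R D).

Lemma nbhs_schwartzP x (A : set S) :
  nbhs x A <-> exists n, exists2 e : R, 0 < e & forall y, l1norm n (y - x) < e -> A y.
Proof.
split=> [[[n e] /= e0 H]|[n [e e0 H]]].
  exists n, e => // y ye; apply: H; rewrite /schwartz_ball /=.
  exact: le_lt_trans (seminorm_le_l1norm n _) ye.
have c0 : 0 < growth_const f + 1 by rewrite ltr_wpDl // growth_const_ge0.
exists ((n + growth_exp f)%N, e / (growth_const f + 1)) => /=; first by rewrite divr_gt0.
move=> y; rewrite /schwartz_ball /= ltr_pdivlMr // => ye; apply: H.
apply: le_lt_trans (l1norm_le_seminorm n _) _; apply: le_lt_trans ye.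
rewrite mulrC ler_wpM2l ?lerDl //.
by apply: le_trans (seminorm_ge _ _ (w_one D)); rewrite mulr_ge0 ?normc_ge0 ?weight_ge0.
Qed.

Lemma schwartz_hausdorff : hausdorff_space S.
Proof.
move=> x y xy; apply/eqP; rewrite -subr_eq0; apply/eqP; apply: (@l1norm_eq0 _ _ _ 0).
apply/ler_addgt0Pl => e e0; rewrite addr0.
have e2 : 0 < e / 2 by rewrite divr_gt0.
have bx z : nbhs z [set t | l1norm 0 (t - z) < e / 2] by apply/nbhs_schwartzP; exists 0%N, (e / 2).
have [t [tx ty]] := xy _ _ (bx x) (bx y).
apply: le_trans (l1norm_distD 0 t x y) _; rewrite [e]splitr lerD // ltW //.
by rewrite l1norm_distC.
Qed.

Lemma hecke_mul_cvg q x y :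
  (fun z : S * S => hecke_mul q z.1 z.2) @ within (@hecke R D f `*` @hecke R D f) (nbhs (x, y))
  --> smul q x y.
Proof.
move=> A /nbhs_schwartzP[n [e e0 HA]]; have [K K0 HK] := smul_diff f q n.
pose B := 1 + l1norm n y + l1norm (nu + n) x.
have B0 : 0 < B by rewrite /B -addrA ltr_pwDl // addr_ge0 ?l1norm_ge0.
(* The 1 keeps the norm of [h] below [B]; [K + 1] in place of [K] makes the denominator positive and
   the last inequality strict. *)
pose d := Num.min 1 (e / (2 * (K + 1) * B)).
have K1 : 0 < K + 1 by rewrite ltr_wpDl.
have d0 : 0 < d by rewrite lt_min ltr01 divr_gt0 ?mulr_gt0.
have d1 : d <= 1 by rewrite ge_min lexx.
have dE : 2 * (K + 1) * B * d <= e.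
  by rewrite mulrC -ler_pdivlMr ?mulr_gt0 // ge_min lexx orbT.
rewrite /= /within /=.
exists ([set h | l1norm (nu + n) (h - x) < d], [set g | l1norm n (g - y) < d]) => /=.
  by split; apply/nbhs_schwartzP; [exists (nu + n)%N, d|exists n, d].
move=> [h g] /= [hx gy] [/= hh hg]; apply: HA; rewrite hecke_mulE // l1norm_distC.
apply: le_lt_trans (HK x y h g hh hg) _.
have hB : l1norm (nu + n) h <= B.
  rewrite -[h](subrK x); apply: le_trans (l1normD _ _ _) _.
  rewrite /B; apply: lerD => //; apply: (@le_trans _ _ 1).
    exact: le_trans (ltW hx) d1.
  by rewrite lerDl l1norm_ge0.
have yB : l1norm n y <= B.
  by rewrite /B addrAC lerDr addr_ge0 ?l1norm_ge0.
apply: (@le_lt_trans _ _ (K * (d * B + B * d))).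
  rewrite ler_wpM2l // lerD //; apply: ler_pM; rewrite ?l1norm_ge0 //.
    by rewrite l1norm_distC ltW.
  by rewrite l1norm_distC ltW.
apply: lt_le_trans dE.
rewrite (_ : 2 * (K + 1) * B * d = K * (d * B + B * d) + 2 * (B * d)); last by ring.
by rewrite ltrDl !mulr_gt0.
Qed.

(** Density of finitely supported elements, in the form that makes the limit defining [schwartz_mul]
    unique. *)
Lemma within_hecke_proper x y :
  ProperFilter (within (@hecke R D f `*` @hecke R D f) (nbhs (x, y))).
Proof.
apply: Build_ProperFilter_ex => A [[A1 A2] /= [/nbhs_schwartzP[n [e e0 H1]] /nbhs_schwartzP[m [d d0 H2]]] sub].
have [h hh hx] := hecke_dense n x (divr_gt0 e0 (ltr0Sn R 1)).
have [g hg gy] := hecke_dense m y (divr_gt0 d0 (ltr0Sn R 1)).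
exists (h, g); apply: (sub (h, g)) => /=; last by split.
split; [apply: H1|apply: H2]; rewrite l1norm_distC.
  by apply: le_lt_trans hx _; rewrite ltr_pdivrMr // ltr_pMr // ltr1n.
by apply: le_lt_trans gy _; rewrite ltr_pdivrMr // ltr_pMr // ltr1n.
Qed.

Lemma schwartz_mulE q x y : schwartz_mul q x y = smul q x y.
Proof.
have P := within_hecke_proper x y.
rewrite /schwartz_mul; apply: cvg_lim; first exact: schwartz_hausdorff.
exact: hecke_mul_cvg.
Qed.
End Topology.

(** * Inversion *)

Section Inversion.
Context (R : realType) (D : based_root_datum) (f : length_extension R D).
Local Notation W := (weyl D).
Local Notation C := R[i].
Local Notation S := (schwartz f).
Local Notation nu := (nroots D).
Local Notation e := (basisN f (w_one D)).
Implicit Types (x y z eps : S) (n : nat) (q : label R D) (M : R).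

Lemma smulNl q x y : smul q (- x) y = - smul q x y.
Proof. by rewrite -[- x]sub0r -(subrr x) !smulBl subrr sub0r. Qed.

Lemma smulDl q x x' y : smul q (x + x') y = smul q x y + smul q x' y.
Proof. by rewrite -{1}[x']opprK smulBl smulNl opprK. Qed.

(** From one norm to the next, the lower norm contributes [m.+1 * c] times the previous constant; it
    must fit into the quarter left between the contraction 1/2 and the ratio 3/4, whence the factor
    4. The [+ 1] keeps the constant at least 1, as the start of the series requires. *)
Fixpoint neumann_const (c : R) n : R :=
  if n is m.+1 then 4 * m.+1%:R * c * neumann_const c m + 1 else 1.

Lemma neumann_const_ge1 c n : 0 <= c -> 1 <= neumann_const c n.
Proof.
by move=> c0; elim: n => //= n IH; rewrite lerDr !mulr_ge0 // (le_trans ler01 IH).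
Qed.

Definition neumann_bound M n eps : R := neumann_const (mul_const D M) n *
  (1 + l1norm (nu + n) eps) ^+ n * l1norm (nu + n) eps.

Lemma neumann_bound_ge0 M n eps : 1 <= M -> 0 <= neumann_bound M n eps.
Proof.
move=> M1; have := neumann_const_ge1 n (mul_const_ge0 D M1) => K1.
by rewrite !mulr_ge0 ?exprn_ge0 ?addr_ge0 ?l1norm_ge0 // (le_trans ler01).
Qed.

Section Neumann.
Context (q : label R D) (M : R) (qM : label_bounded M q) (eps : S).
Context (eps_small : mul_const D M * l1norm nu eps <= 2^-1).
Let c := mul_const D M.
Let c0 : 0 <= c := mul_const_ge0 D qM.1.
(** One half is the contraction granted by [eps_small]; the remaining quarter absorbs the lower
    norms. *)
Let ratio : R := 3 / 4.

Lemma ratio01 : 0 <= ratio < 1.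
Proof. by rewrite /ratio divr_ge0 //= ltr_pdivrMr // mul1r ltr_nat. Qed.

(* The second term on the right involves only a lower norm of [d], so that the
   smallness of the one number [l1norm nu eps] controls all norms of the series. *)
Lemma l1norm_smul_small n d : l1norm n (smul q eps d) <=
  2^-1 * l1norm n d + c * n%:R * l1norm (nu + n) eps * l1norm n.-1 d.
Proof.
apply: le_trans (l1norm_smul n eps d qM) _; rewrite mulrDr -/c; apply: lerD.
  by rewrite mulrA ler_wpM2r ?l1norm_ge0.
by rewrite !mulrA lexx.
Qed.

(** Iteration of [z = e - eps z], which produces the partial sums of the series of powers of
    [- eps]. *)
Fixpoint neumann_sum k : S := if k is j.+1 then e - smul q eps (neumann_sum j) else e.

Lemma neumann_sumS k : neumann_sum k.+2 - neumann_sum k.+1 =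
  - smul q eps (neumann_sum k.+1 - neumann_sum k).
Proof.
transitivity ((e - smul q eps (neumann_sum k.+1)) - (e - smul q eps (neumann_sum k))) => //.
rewrite (smulBr q eps (neumann_sum k.+1)) [RHS]opprB.
by rewrite [X in _ + X = _]opprB [LHS]addrC subrKA.
Qed.

(** In the double induction, the passage from [k] to [k.+1] for the norm [n.+1] uses the bound for
    the norm [n] at [k], which decays with the same ratio. *)
Lemma neumann_step n k : l1norm n (neumann_sum k.+1 - neumann_sum k) <=
  neumann_bound M n eps * ratio ^+ k.
Proof.
have r0 j : 0 <= ratio ^+ j by rewrite exprn_ge0 // divr_ge0.
elim: n k => [|n IHn]; elim=> [|k IHk].
- rewrite /= smul1r addrC addKr l1normN expr0 mulr1 /neumann_bound /= expr0 !mul1r.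
  by rewrite l1norm_mono // leq_addl.
- rewrite neumann_sumS l1normN; apply: le_trans (l1norm_smul_small _ _) _.
  rewrite mulr0 !mul0r addr0 exprS mulrCA.
  have := neumann_bound_ge0 0 eps qM.1; move: IHk (r0 k).
  move: (neumann_bound _ _ _) (l1norm _ _) (ratio ^+ k) => B N p NB p0 B0.
  apply: le_trans (ler_wpM2l _ NB) _; first by rewrite invr_ge0.
  by rewrite ler_wpM2r ?mulr_ge0 // /ratio; lra.
- rewrite /= smul1r addrC addKr l1normN expr0 mulr1 /neumann_bound.
  apply: le_trans (l1norm_mono eps (leq_addl nu n.+1)) _.
  rewrite ler_peMl ?l1norm_ge0 // mulr_ege1 ?(neumann_const_ge1 _ c0) //.
  by rewrite exprn_ege1 // lerDl l1norm_ge0.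
rewrite neumann_sumS l1normN; apply: le_trans (l1norm_smul_small _ _) _.
set d := _ - _ in IHk *; have := IHn k; rewrite -/d [n.+1.-1]/= => Hn.
rewrite exprS; set E := l1norm (nu + n.+1) eps; set p := ratio ^+ k in Hn IHk *.
have E0 : 0 <= E := l1norm_ge0 _ _; have p0 : 0 <= p := r0 k.
pose K := neumann_const c n; have K1 : 1 <= K := neumann_const_ge1 n c0.
have K0 : 0 <= K := le_trans ler01 K1.
pose A := (1 + E) ^+ n; have A0 : 0 <= A by rewrite exprn_ge0 // addr_ge0.
have EE : l1norm (nu + n) eps <= E by rewrite l1norm_mono // leq_add2l.
have Hn' : l1norm n d <= K * A * E * p.
  apply: le_trans Hn _; rewrite ler_wpM2r // /neumann_bound -/c -/K.
  apply: ler_pM; rewrite ?mulr_ge0 ?exprn_ge0 ?addr_ge0 ?l1norm_ge0 //.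
  rewrite ler_wpM2l //.
  by rewrite lerXn2r ?nnegrE ?addr_ge0 ?l1norm_ge0 // lerD2l.
have Kp : 0 <= c * n.+1%:R * K by rewrite !mulr_ge0.
have h1 : c * n.+1%:R * E * l1norm n d <= c * n.+1%:R * K * A * (1 + E) * E * p.
  apply: (@le_trans _ _ (c * n.+1%:R * E * (K * A * E * p))).
    by rewrite ler_wpM2l ?mulr_ge0.
  rewrite (_ : c * n.+1%:R * E * _ = c * n.+1%:R * K * A * E * p * E); last by ring.
  rewrite (_ : c * n.+1%:R * K * A * (1 + E) * E * p = c * n.+1%:R * K * A * E * p * (1 + E)); last by ring.
  by rewrite ler_wpM2l ?mulr_ge0 // lerDr.
apply: le_trans (lerD (ler_wpM2l _ IHk) h1) _; first by rewrite invr_ge0.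
rewrite /neumann_bound -/E -/c [neumann_const c n.+1]/= -/K exprS -/A.
rewrite /ratio -subr_ge0.
(* The surplus is a quarter of the contribution of the [+ 1] in [neumann_const]. *)
rewrite [X in 0 <= X](_ : _ = 4^-1 * ((1 + E) * A * E * p)); last by field.
by rewrite !mulr_ge0 ?addr_ge0 // invr_ge0.
Qed.

Lemma neumann_right_inverse : exists2 z, smul q (e + eps) z = e &
  forall n, l1norm n (z - e) <= 4 * neumann_bound M n eps.
Proof.
have [z zP] := schwartz_complete ratio01
  (fun n => ex_intro _ (neumann_bound M n eps) (neumann_step n)).
have rE : (1 - ratio)^-1 = 4 by rewrite /ratio; field.
have zn n k : l1norm n (z - neumann_sum k) <= 4 * neumann_bound M n eps * ratio ^+ k.
  have := zP n _ (neumann_bound_ge0 n eps qM.1) (neumann_step n) k.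
  by rewrite rE mulrC mulrA.
exists z => [|n]; last by have := zn n 0%N; rewrite expr0 mulr1.
rewrite smulDl smul1l; apply/eqP; rewrite -subr_eq0; apply/eqP.
apply: (@l1norm_eq0 _ _ _ 0).
apply: (@geometric_le _ _ _ (8 * neumann_bound M 0 eps) _ ratio01) => k; rewrite add0r.
have -> : z + smul q eps z - e = (z - neumann_sum k.+1) + smul q eps (z - neumann_sum k).
  by rewrite (smulBr q eps z) /= opprB addrACA [X in _ = _ + X]addrAC subrr add0r.
apply: le_trans (l1normD _ _ _) _.
have B0 := neumann_bound_ge0 0 eps qM.1.
have r0 : 0 <= ratio ^+ k by rewrite exprn_ge0 // divr_ge0.
apply: le_trans (lerD (zn 0%N k.+1) (l1norm_smul_small 0 _)) _.
rewrite mulr0 !mul0r addr0; have := zn 0%N k; rewrite exprS.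
have : ratio * (4 * neumann_bound M 0 eps * ratio ^+ k) <= 4 * neumann_bound M 0 eps * ratio ^+ k.
  have /andP[_ /ltW r1] := ratio01.
  by apply: ler_piMl => //; apply: mulr_ge0 => //; apply: mulr_ge0.
have : 2^-1 * l1norm 0 (z - neumann_sum k) <= l1norm 0 (z - neumann_sum k).
  by rewrite ler_piMl ?l1norm_ge0 // invf_le1 // ler1n.
rewrite mulrCA; move: (l1norm 0 _) => N; move: (ratio * _) (2^-1 * N) => a b hb ha hN.
have : 8 * neumann_bound M 0 eps * ratio ^+ k =
  4 * neumann_bound M 0 eps * ratio ^+ k + 4 * neumann_bound M 0 eps * ratio ^+ k by ring.
move=> ->; apply: lerD => //; exact: le_trans hb hN.
Qed.
End Neumann.
End Inversion.

(** * Two-sided inverses and their dependence on the element and the label *)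

Section LocalInversion.
Context (R : realType) (D : based_root_datum) (f : length_extension R D).
Local Notation S := (schwartz f).
Local Notation nu := (nroots D).
Local Notation e := (basisN f (w_one D)).
Implicit Types (x y z eps : S) (n m : nat) (q : label R D) (M : R).

Lemma exists_scale (a b : R) : 0 < b -> 0 <= a ->
  exists2 d, 0 < d & forall d', d' <= d -> a * d' < b.
Proof.
move=> b0 a0; have a1 : 0 < a + 1 by rewrite ltr_wpDl.
exists (b / (a + 1)) => [|d' dd]; first by rewrite divr_gt0.
apply: le_lt_trans (ler_wpM2l a0 dd) _.
by rewrite mulrCA gtr_pMr // ltr_pdivrMr // mul1r ltrDl.
Qed.

Lemma neumann_bound_le M n eps : 1 <= M -> l1norm (nu + n) eps <= 1 ->
  neumann_bound M n eps <= neumann_const (mul_const D M) n * 2 ^+ n * l1norm (nu + n) eps.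
Proof.
move=> M1 E1; have K1 := neumann_const_ge1 n (mul_const_ge0 D M1).
rewrite /neumann_bound ler_wpM2r ?l1norm_ge0 // ler_wpM2l ?(le_trans ler01 K1) //.
rewrite lerXn2r ?nnegrE ?addr_ge0 ?l1norm_ge0 //; lra.
Qed.

(** The series gives a right inverse [z]. It is two-sided because [z] is itself close to [e] and so
    has a right inverse; closeness in the norm [nu] costs the norm [nu + nu] of [eps]. *)
Lemma near_one_invertible M : 1 <= M -> exists2 d : R, 0 < d & forall q eps,
  label_bounded M q -> l1norm (nu + nu) eps <= d ->
  exists z, [/\ smul q (e + eps) z = e, smul q z (e + eps) = e &
    forall n, l1norm n (z - e) <= 4 * neumann_bound M n eps].
Proof.
move=> M1; have c0 := mul_const_ge0 D M1; set c := mul_const D M in c0 *.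
pose K := neumann_const c nu; have K1 : 1 <= K := neumann_const_ge1 nu c0.
have p1 : 1 <= 2 ^+ nu :> R by rewrite exprn_ege1 // ler1n.
(* The product of [c] with the bound [4 K 2^nu d] for the norm of [z - e] must be at most 1/2,
   whence the 8; [c + 1] in place of [c] makes [B] at least 1. *)
pose B := 8 * (c + 1) * (K * 2 ^+ nu).
have KP : 1 <= K * 2 ^+ nu by rewrite mulr_ege1.
have B0 : 0 < B by rewrite !mulr_gt0 ?ltr_wpDl // (lt_le_trans ltr01).
have cB d : 0 <= d -> d <= B^-1 -> c * (4 * (K * 2 ^+ nu * d)) <= 2^-1.
  move=> d0 dB; have Bd : B * d <= 1 by rewrite mulrC -ler_pdivlMr // mul1r.
  have KPd : 0 <= K * 2 ^+ nu * d by rewrite mulr_ge0 // (le_trans ler01).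
  move: Bd; rewrite /B -mulrA; move: (K * 2 ^+ nu * d) KPd => t t0 Bt; lra.
have Bi0 : 0 <= B^-1 by rewrite invr_ge0 ltW.
have Bi1 : B^-1 <= 1.
  rewrite invf_le1 //; apply: mulr_ege1 => //; lra.
exists B^-1 => [|q eps qM epsB]; first by rewrite invr_gt0.
have small : c * l1norm nu eps <= 2^-1.
  apply: le_trans (cB _ Bi0 (lexx _)); rewrite ler_wpM2l // mulrA.
  apply: le_trans (le_trans (l1norm_mono eps (leq_addl nu nu)) epsB) _.
  by rewrite ler_peMl //; lra.
have [z z1 zn] := neumann_right_inverse qM small.
have zsmall : c * l1norm nu (z - e) <= 2^-1.
  apply: le_trans (cB _ (l1norm_ge0 _ _) epsB); rewrite ler_wpM2l //.
  apply: le_trans (zn nu) _; rewrite ler_wpM2l //.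
  exact: neumann_bound_le M1 (le_trans epsB Bi1).
have [w] := neumann_right_inverse qM zsmall; rewrite addrC subrK => w1 _.
exists z; split; [exact: z1| |exact: zn]; rewrite -[RHS]w1; congr smul.
by rewrite -[RHS](smul1l q w) -[in RHS]z1 -smulA w1 smul1r.
Qed.

Lemma l1norm_smul_crude M q n x y : label_bounded M q ->
  l1norm n (smul q x y) <= mul_const D M * n.+1%:R * (l1norm (nu + n) x * l1norm n y).
Proof.
move=> qM; apply: le_trans (l1norm_smul n x y qM) _.
rewrite -[leRHS]mulrA ler_wpM2l ?mul_const_ge0 ?qM.1 //.
rewrite -natr1 [leRHS]mulrDl mul1r addrC lerD //.
  by rewrite -mulrA ler_wpM2l // ler_wpM2l ?l1norm_ge0 // l1norm_mono // leq_pred.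
by rewrite ler_wpM2r ?l1norm_ge0 // l1norm_mono // leq_addr.
Qed.

Lemma l1norm_smul_label_crude M q q' n x y : label_bounded M q -> label_bounded M q' ->
  l1norm n (smul q x y - smul q' x y) <=
  label_dist q q' * (mul_const D M * n.+1%:R * (l1norm (nu + n) x * l1norm n y)).
Proof.
move=> qM q'M; apply: le_trans (l1norm_smul_label n x y qM q'M) _.
rewrite -mulrA ler_wpM2l ?label_dist_ge0 // -[leRHS]mulrA ler_wpM2l ?mul_const_ge0 ?qM.1 //.
rewrite -natr1 [leRHS]mulrDl mul1r addrC lerD //.
  by rewrite -mulrA ler_wpM2l // ler_wpM2l ?l1norm_ge0 // l1norm_mono // leq_pred.
by rewrite ler_wpM2r ?l1norm_ge0 // l1norm_mono // leq_addr.
Qed.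

Definition smul_inverse q x y : Prop := smul q x y = e /\ smul q y x = e.

Lemma smul_inverse_unique q x y y' : smul_inverse q x y -> smul_inverse q x y' -> y = y'.
Proof. by move=> [_ yx] [xy' _]; rewrite -(smul1r q y) -xy' smulA yx smul1l. Qed.

(** Correcting [x y0] gives a right inverse of [x] and correcting [y0 x] a left one; the two
    coincide by associativity. The continuity of the inverse comes from [y - y0 = y0 (z - e)]. *)
Lemma local_inverse q0 x0 y0 n (t : R) : smul_inverse q0 x0 y0 -> 0 < t ->
  exists m, exists2 d : R, 0 < d & forall q x, label_dist q0 q < d -> l1norm m (x - x0) < d ->
    exists2 y, smul_inverse q x y & l1norm n (y - y0) < t.
Proof.
move=> [xy0 yx0] t0; have [M HM] := label_bounded_ball q0.
have q0M : label_bounded M q0 by apply: HM; rewrite label_distxx.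
have [M1 _] := q0M; have c0 := mul_const_ge0 D M1; set c := mul_const D M in c0 *.
have [d1 d1_gt0 unit] := near_one_invertible M1.
(* [near_one_invertible] asks for the norm [nu + nu] of [eps], and the norm [n] of [z - e] is
   bounded through the norm [nu + n]; [p] exceeds both. *)
pose p := (nu + nu + n)%N.
pose B : R := c * p.+1%:R * (1 + l1norm (nu + p) x0) * (1 + l1norm (nu + p) y0).
have B0 : 0 <= B by rewrite !mulr_ge0 ?addr_ge0 ?l1norm_ge0.
pose K : R := neumann_const c n * 2 ^+ n.
have K0 : 0 <= K by rewrite mulr_ge0 ?exprn_ge0 // (le_trans ler01) // neumann_const_ge1.
pose T : R := c * n.+1%:R * l1norm (nu + n) y0 * (4 * K).
have T0 : 0 <= T by apply: mulr_ge0; apply: mulr_ge0; rewrite ?l1norm_ge0 // mulr_ge0.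
have [d [d_gt0 dle1 dd1 dB1 dT]] : exists d, [/\ 0 < d, d <= 1, 2 * B * d <= d1, 2 * B * d <= 1 &
    T * (2 * B * d) < t].
  have B2 : 0 <= 2 * B by rewrite mulr_ge0.
  have [da da0 Ha] := exists_scale d1_gt0 B2.
  have [db db0 Hb] := exists_scale (@ltr01 R) B2.
  have [dc dc0 Hc] := exists_scale t0 (mulr_ge0 T0 B2).
  exists (Num.min (Num.min 1 da) (Num.min db dc)); split.
  - by rewrite !lt_min ltr01 da0 db0 dc0.
  - by rewrite !ge_min lexx.
  - by rewrite ltW // Ha // !ge_min lexx orbT.
  - by rewrite ltW // Hb // !ge_min lexx !orbT.
  by rewrite mulrA Hc // !ge_min lexx !orbT.
exists (nu + p)%N, d => // q x qd xd.
have qM : label_bounded M q by apply: HM; exact: lt_le_trans qd dle1.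
have x0_le m : (m <= nu + p)%N -> l1norm m x0 <= 1 + l1norm (nu + p) x0.
  by move=> mp; apply: le_trans (l1norm_mono x0 mp) _; rewrite lerDr.
have y0_le m : (m <= nu + p)%N -> l1norm m y0 <= 1 + l1norm (nu + p) y0.
  by move=> mp; apply: le_trans (l1norm_mono y0 mp) _; rewrite lerDr.
have dx m : (m <= nu + p)%N -> l1norm m (x - x0) <= d.
  by move=> mp; apply: le_trans (l1norm_mono _ mp) (ltW xd).
have cp0 : 0 <= c * p.+1%:R by rewrite mulr_ge0.
have X1 : 1 <= 1 + l1norm (nu + p) x0 by rewrite lerDl l1norm_ge0.
have Y1 : 1 <= 1 + l1norm (nu + p) y0 by rewrite lerDl l1norm_ge0.
have pp : (p <= nu + p)%N by rewrite leq_addl.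
pose eps := smul q x y0 - e; pose eps' := smul q y0 x - e.
have epsB : l1norm p eps <= 2 * B * d.
  (* Element and label vary separately: the first term is small with [x - x0], the second with the
     distance of the labels, since [x0 y0 = e] at [q0]. *)
  have -> : eps = smul q (x - x0) y0 + (smul q x0 y0 - smul q0 x0 y0).
    by rewrite /eps smulBl xy0 addrA subrK.
  apply: le_trans (l1normD _ _ _) _; rewrite -mulrA mulrDl mul1r; apply: lerD.
    apply: le_trans (l1norm_smul_crude _ _ _ qM) _; rewrite -/c /B -!mulrA.
    rewrite ler_wpM2l // ler_wpM2l //.
    rewrite [leRHS](_ : _ = (d * (1 + l1norm (nu + p) x0)) * (1 + l1norm (nu + p) y0)); last by ring.
    apply: ler_pM; rewrite ?l1norm_ge0 ?y0_le //.
    by apply: le_trans (dx _ (leqnn _)) _; rewrite ler_peMr // ltW.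
  apply: le_trans (l1norm_smul_label_crude _ _ _ qM q0M) _; rewrite label_distC [leRHS]mulrC.
  apply: ler_pM; rewrite ?label_dist_ge0 ?(ltW qd) // ?mulr_ge0 ?l1norm_ge0 //.
  rewrite -/c /B -!mulrA ler_wpM2l // ler_wpM2l // ler_pM ?l1norm_ge0 ?x0_le ?y0_le //.
have epsB' : l1norm p eps' <= 2 * B * d.
  have -> : eps' = smul q y0 (x - x0) + (smul q y0 x0 - smul q0 y0 x0).
    by rewrite /eps' smulBr yx0 addrA subrK.
  apply: le_trans (l1normD _ _ _) _; rewrite -mulrA mulrDl mul1r; apply: lerD.
    apply: le_trans (l1norm_smul_crude _ _ _ qM) _; rewrite -/c /B -!mulrA.
    rewrite ler_wpM2l // ler_wpM2l //.
    rewrite [leRHS](_ : _ = (1 + l1norm (nu + p) y0) * (d * (1 + l1norm (nu + p) x0))); last by ring.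
    apply: ler_pM; rewrite ?l1norm_ge0 ?y0_le //.
    by apply: le_trans (dx _ pp) _; rewrite ler_peMr // ltW.
  apply: le_trans (l1norm_smul_label_crude _ _ _ qM q0M) _; rewrite label_distC [leRHS]mulrC.
  apply: ler_pM; rewrite ?label_dist_ge0 ?(ltW qd) // ?mulr_ge0 ?l1norm_ge0 //.
  rewrite -/c /B -!mulrA ler_wpM2l // ler_wpM2l // [leRHS]mulrC.
  by rewrite ler_pM ?l1norm_ge0 ?x0_le ?y0_le.
have le_p m : (m <= p)%N -> l1norm m eps <= 2 * B * d.
  by move=> mp; apply: le_trans (l1norm_mono _ mp) epsB.
have [z [z1 z2 zn]] := unit q eps qM (le_trans (le_p _ (leq_addr _ _)) dd1).
have [z' [_ z'2 _]] := unit q eps' qM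
  (le_trans (l1norm_mono _ (leq_addr _ _)) (le_trans epsB' dd1)).
have ee : e + eps = smul q x y0 by rewrite addrC subrK.
have ee' : e + eps' = smul q y0 x by rewrite addrC subrK.
rewrite ee in z1 z2; rewrite ee' in z'2.
have xy : smul q x (smul q y0 z) = e by rewrite smulA.
have yx : smul q (smul q z' y0) x = e by rewrite -smulA.
have yy : smul q z' y0 = smul q y0 z.
  by rewrite -[LHS](smul1r q) -xy smulA yx smul1l.
exists (smul q y0 z); first by split; [exact: xy|rewrite -yy; exact: yx].
have -> : smul q y0 z - y0 = smul q y0 (z - e) by rewrite smulBr smul1r.
apply: le_lt_trans dT; apply: le_trans (l1norm_smul_crude _ _ _ qM) _.
have np : (nu + n <= p)%N by rewrite /p -addnA leq_addl.
rewrite -/c mulrA /T -[leRHS]mulrA ler_wpM2l ?mulr_ge0 ?l1norm_ge0 //.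
apply: le_trans (zn n) _; rewrite -mulrA ler_wpM2l //.
apply: le_trans (neumann_bound_le M1 (le_trans (le_p _ np) dB1)) _.
apply: ler_wpM2l; [exact: K0|exact: le_p np].
Qed.
End LocalInversion.

Section Final.
Context (R : realType) (D : based_root_datum) (f : length_extension R D).
Local Notation S := (schwartz f).
Implicit Types (x y z : S) (n : nat) (q : label R D).

Lemma schwartz_inverseE q x y : schwartz_is_inverse q x y <-> smul_inverse q x y.
Proof. by rewrite /schwartz_is_inverse /smul_inverse !schwartz_mulE basisT1. Qed.

Lemma schwartz_invE q x y : smul_inverse q x y -> schwartz_inv q x = y.
Proof.
move=> xy; apply: (@smul_inverse_unique _ _ _ q x) => //; apply/schwartz_inverseE.
by apply: (getPex (P := schwartz_is_inverse q x)); exists y; apply/schwartz_inverseE.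
Qed.

Lemma nbhs_schwartz_label x q (A : set (S * label R D)) m (d : R) : 0 < d ->
  (forall x' q', l1norm m (x' - x) < d -> label_dist q q' < d -> A (x', q')) ->
  nbhs (x, q) A.
Proof.
move=> d0 H; exists ([set x' | l1norm m (x' - x) < d], [set q' | label_dist q q' < d]).
  split => /=; first by apply/nbhs_schwartzP; exists m, d.
  by apply/nbhs_ballP; exists d.
by move=> [x' q'] [/= xx qq]; exact: H.
Qed.

Lemma invertible_set_open : open (invertible_set f).
Proof.
rewrite openE => -[x q] [y /schwartz_inverseE /= xy]; rewrite /interior.
have [m [d d0 H]] := local_inverse 0 xy ltr01.
apply: nbhs_schwartz_label d0 _ => x' q' xx qq.
by have [y' xy' _] := H q' x' qq xx; exists y'; apply/schwartz_inverseE.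
Qed.

Lemma inversion_invertible (z : S * label R D) : invertible_set f z -> invertible_set f (inversion z).
Proof.
move=> [y /schwartz_inverseE xy]; exists z.1; apply/schwartz_inverseE.
by rewrite /inversion /= (schwartz_invE xy); case: xy; split.
Qed.

Lemma inversion_continuous : {within invertible_set f, continuous (@inversion _ _ f)}.
Proof.
apply/subspace_continuousP => -[x q] [y /schwartz_inverseE /= xy].
have -> : from_subspace (invertible_set f) (inversion (f:=f)) (x, q) = (y, q).
  by rewrite -[LHS]/(schwartz_inv q x, q) (schwartz_invE xy).
move=> B [[B1 B2] /= [hB1 hB2] sub].
have [n [e e0 HB1]] := (nbhs_schwartzP _ _).1 hB1.
have /nbhs_ballP[e' /= e'0 HB2] := hB2.
have [m [d d0 H]] := local_inverse n xy e0.
have de0 : 0 < Num.min d e' by rewrite lt_min d0.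
apply: nbhs_schwartz_label de0 _ => x' q'; rewrite !lt_min => /andP[xx _] /andP[qq qe] _.
apply: sub; split => /=; last exact: HB2.
by have [y' xy' yy'] := H q' x' qq xx; rewrite (schwartz_invE xy'); exact: HB1.
Qed.
End Final.

Theorem proposition5p9 (R : realType) (D : based_root_datum)
    (f : length_extension R D) :
  [/\ open (invertible_set f),
      (forall z, invertible_set f z -> invertible_set f (inversion z)) &
      {within invertible_set f, continuous (@inversion _ _ f)}].
Proof.
split; [exact: invertible_set_open|exact: inversion_invertible|].
exact: inversion_continuous.
Qed.
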